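(* Assume the setting of the context, with a perfect random instrument given by Kraus operators $V_{a;\omega}$, and suppose: (H1) $\theta$ is invertible (with measurable inverse), ergodic and $\mathbb P$-preserving; (H2) there is $\delta>0$ with $\sum_{n\ge1}\alpha_{\mathbb P}(n)^{\delta/(2+\delta)}<\infty$; (H3) there exist a dynamically stationary state $\mathfrak s$ and a deterministic sequence $(r_n)\subseteq[0,\infty)$ with $\sum_n r_n^{\delta/(2+\delta)}<\infty$ such that for every random initial state $\vartheta$ and $n\in\mathbb N$, $\mathbb E_{\mathbb P}\big[\|\Phi^{(n)}_\omega(\vartheta(\omega))-\mathfrak s(\theta^n\omega)\|_1\big]\le r_n$; (A) there is an orthonormal basis $(e_i)_{i=1}^d$ of $\mathbb C^d$ such that (A.1) for each $a\in\mathcal A$ there is a deterministic map $f_a:\{1,\dots,d\}\to\{1,\dots,d\}$ with, for $\mathbb P$-a.e. $\omega$ and all $i$, $V_{a;\omega}e_i\in\mathbb C e_{f_a(i)}$, and $\langle V_{a;\omega}e_i,V_{a;\omega}e_j\rangle=0$ whenever $i\ne j$; (A.2) there exist $L\in\mathbb N$, $\varepsilon>0$ and, for each $(i,j)$, an $\mathcal F$-measurable map $\omega\mapsto\kappa_{\omega;i,j}\in\mathcal P(\mathcal A^L\times\mathcal A^L)$ such that for $\mathbb P$-a.e. $\omega$ and all $i,j$, $\kappa_{\omega;i,j}$ is a coupling of $\mathbb Q_{\rho^{(i)};\omega}\circ A_{1:L}^{-1}$ and $\mathbb Q_{\rho^{(j)};\omega}\circ A_{1:L}^{-1}$ (where $\rho^{(i)}=|e_i\rangle\langle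 e_i|$) and $\kappa_{\omega;i,j}(\{(u,v):f_u(i)=f_v(j)\})\ge\varepsilon$, where $f_u:=f_{u_L}\circ\cdots\circ f_{u_1}$ for $u=(u_1,\dots,u_L)$. Then for every $m\in\mathbb N$, every $\mathbf b\in\mathcal A^m$ and every random initial state $\vartheta:\Omega\to\mathcal S_d$, under $\overline{\mathbb Q}_\vartheta$, $$\frac1{\sqrt n}\sum_{k=1}^n(\delta N_k^{\mathbf b}-\mu_{\mathbf b})\xrightarrow{\ d\ }\mathcal N(0,\Sigma_{\mathbf b}^2),$$ where $\mu_{\mathbf b}=\int_\Omega\mathbb Q_{\mathfrak s(\omega);\omega}(C_{\mathbf b})\,d\mathbb P(\omega)$ and $\Sigma_{\mathbf b}^2=\mathbb E_{\overline{\mathbb Q}_{\mathfrak s}}[(\delta N_1^{\mathbf b}-\mu_{\mathbf b})^2]+2\sum_{k\ge1}\mathbb E_{\overline{\mathbb Q}_{\mathfrak s}}[(\delta N_1^{\mathbf b}-\mu_{\mathbf b})(\delta N_{1+k}^{\mathbf b}-\mu_{\mathbf b})]$.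
   Context: Let $d\in\mathbb N$, $M_d$ the $d\times d$ complex matrices with trace norm $\|\cdot\|_1$, $\mathcal S_d$ the density matrices. Let $\mathcal A$ be finite, $(\mathcal A^{\mathbb N},\Sigma)$ the sequence space with product $\sigma$-algebra, coordinates $A_n(\bar a)=a_n$, and $A_{1:L}=(A_1,\dots,A_L)$. $(\Omega,\mathcal F,\mathbb P)$ is a probability space, $\theta:\Omega\to\Omega$ measurable. Perfect random instrument: for each $a\in\mathcal A$, $\omega\mapsto V_{a;\omega}\in M_d$ with $\mathcal T_{a;\omega}(X)=V_{a;\omega}XV_{a;\omega}^*$, $\omega\mapsto\mathcal T_{a;\omega}$ measurable, and $\sum_aV_{a;\omega}^*V_{a;\omega}=I$ $\mathbb P$-a.s.; $\mathcal V_\omega=(\mathcal T_{a;\omega})_a$, $\Phi_{k;\omega}=\sum_a\mathcal T_{a;\theta^k\omega}$, $\Phi^{(n)}_\omega=\Phi_{n;\omega}\circ\cdots\circ\Phi_{1;\omega}$. Quenched law $\mathbb Q_{\rho;\omega}$: the probability on $\Sigma$ with $\mathbb Q_{\rho;\omega}(A_1=a_1,\dots,A_n=a_n)=\operatorname{tr}[(\mathcal T_{a_n;\theta^n\omega}\circ\cdots\circ\mathcal T_{a_1;\theta\omega})(\rho)]$. A random initial state is a measurable $\vartheta:\Omega\to\mathcal S_d$, with annealed law $\overline{\mathbb Q}_\vartheta(d\omega,d\bar a)=\mathbb P(d\omega)\mathbb Q_{\vartheta(\omega);\omega}(d\bar a)$. $\mathfrak s$ is dynamically stationary if $\Phi^{(n)}_\omega(\mathfrak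 s(\omega))=\mathfrak s(\theta^n\omega)$ for all $n$, $\mathbb P$-a.s. For $\mathbf b=(b_1,\dots,b_m)$: $C_{\mathbf b}=\{\bar a:a_1=b_1,\dots,a_m=b_m\}$, $\delta N_k^{\mathbf b}(\bar a)=\mathbf 1\{a_k=b_1,\dots,a_{k+m-1}=b_m\}$. Mixing: $\mathcal F_k=\sigma(\omega\mapsto\mathcal V_{\theta^j\omega}:j\le k)$, $\mathcal F^k=\sigma(\omega\mapsto\mathcal V_{\theta^j\omega}:j\ge k)$, $\alpha_{\mathbb P}(n)=\sup_k\sup\{|\mathbb P(B\cap C)-\mathbb P(B)\mathbb P(C)|:B\in\mathcal F_k,C\in\mathcal F^{k+n}\}$. $\mathcal P(X)$ denotes probability measures on $X$; a coupling of $\mu,\nu$ is a probability on the product with marginals $\mu,\nu$. *)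

(* Defs.v *)
From HB Require Import structures.
From mathcomp Require Import all_boot all_order all_algebra.
From mathcomp Require Import all_classical all_reals all_analysis.
From mathcomp Require Import complex.

Set Implicit Arguments.
Unset Strict Implicit.
Unset Printing Implicit Defensive.

Import Order.TTheory GRing.Theory Num.Theory.
Import numFieldNormedType.Exports.
Local Open Scope classical_set_scope.
Local Open Scope ring_scope.

Section QTDefs.
Variable R : realType.
Local Notation C := R[i].

Definition adjmx m n (A : 'M[C]_(m, n)) : 'M[C]_(n, m) :=
  \matrix_(i, j) (A j i)^*.

(* positive semidefinite (over C this forces hermiticity) *)
Definition psdmx d (A : 'M[C]_d) : Prop :=
  forall x : 'cV[C]_d, 0 <= (adjmx x *m A *m x) 0 0.

Definition is_state d (rho : 'M[C]_d) : Prop := psdmx rho /\ \tr rho = 1.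

(* trace norm ||X||_1 = tr |X|, |X| the (unique) psd square root of X^* X *)
Definition trnorm d (X : 'M[C]_d) : R :=
  complex.Re (\tr (xget 0 [set Q : 'M[C]_d | psdmx Q /\ Q *m Q = adjmx X *m X])).

Definition mx_measurable (d0 : measure_display) (Omega : measurableType d0)
  m n (f : Omega -> 'M[C]_(m, n)) : Prop :=
  forall i j, measurable_fun setT (fun w => complex.Re (f w i j)) /\
              measurable_fun setT (fun w => complex.Im (f w i j)).

Definition random_state (d0 : measure_display) (Omega : measurableType d0) d
  (vth : Omega -> 'M[C]_d) : Prop :=
  mx_measurable vth /\ forall w, is_state (vth w).

Section Instrument.
Variables (d0 : measure_display) (Omega : measurableType d0).
Variables (A : finType) (d : nat) (V : A -> Omega -> 'M[C]_d).
Variable theta : Omega -> Omega.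

Definition Top (a : A) (w : Omega) (X : 'M[C]_d) : 'M[C]_d :=
  V a w *m X *m adjmx (V a w).

(* entries of the superoperator T_{a;w}: T_{a;w}(E_{kl})_{ij} = V_ik conj(V_jl);
   the real (b = true) or imaginary (b = false) part *)
Definition Tcoef (a : A) (i k j l : 'I_d) (b : bool) (w : Omega) : R :=
  let z := V a w i k * (V a w j l)^* in
  if b then complex.Re z else complex.Im z.

Definition Top_measurable : Prop :=
  forall a i k j l b, measurable_fun setT (Tcoef a i k j l b).

Definition Phik (k : nat) (w : Omega) (X : 'M[C]_d) : 'M[C]_d :=
  \sum_(a : A) Top a (iter k theta w) X.

Fixpoint Phin (n : nat) (w : Omega) (X : 'M[C]_d) : 'M[C]_d :=
  match n with
  | 0 => X
  | n'.+1 => Phik n'.+1 w (Phin n' w X)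
  end.

Fixpoint Tword (t : nat) (u : seq A) (w : Omega) (X : 'M[C]_d) : 'M[C]_d :=
  match u with
  | [::] => X
  | a :: u' => Tword t.+1 u' w (Top a (iter t theta w) X)
  end.

(* quenched cylinder probability Q_{rho;w}(A_1 = u_1, ..., A_n = u_n) *)
Definition qprob (rho : 'M[C]_d) (w : Omega) (u : seq A) : R :=
  complex.Re (\tr (Tword 1 u w rho)).

Definition dyn_stationary (P : probability Omega R) (s : Omega -> 'M[C]_d) : Prop :=
  forall n : nat, {ae P, forall w, Phin n w (s w) = s (iter n theta w)}.

(* expectation under the annealed law bar Q_vth of a function F(A_1,...,A_N):
   E[F(A_{1:N})] = int_Omega sum_{u in A^N} Q_{vth w; w}(A_{1:N} = u) F(u) dP(w) *)
Definition aexp (P : probability Omega R) (vth : Omega -> 'M[C]_d) (N : nat)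
  (F : seq A -> R) : R :=
  fine (\int[P]_w (\sum_(u : N.-tuple A) qprob (vth w) w u * F u)%:E).

End Instrument.

(* delta N_k^b(a) = 1{a_k = b_1, ..., a_{k+m-1} = b_m}  (k >= 1) *)
Definition dN (A : eqType) (b : seq A) (k : nat) (u : seq A) : R :=
  ((take (size b) (drop k.-1 u) == b) : bool)%:R.

Definition fword (A : Type) d (f : A -> 'I_d -> 'I_d) (u : seq A) (i : 'I_d) : 'I_d :=
  foldl (fun j a => f a j) i u.

Definition iterz (Omega : Type) (th thinv : Omega -> Omega) (j : int) : Omega -> Omega :=
  match j with
  | Posz n => iter n th
  | Negz n => iter n.+1 thinv
  end.

Definition ergodic (d0 : measure_display) (Omega : measurableType d0)
  (P : probability Omega R) (theta : Omega -> Omega) : Prop :=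
  forall B : set Omega, measurable B -> theta @^-1` B = B -> P B = 0%E \/ P B = 1%E.

Definition preserving (d0 : measure_display) (Omega : measurableType d0)
  (P : probability Omega R) (theta : Omega -> Omega) : Prop :=
  forall B : set Omega, measurable B -> P (theta @^-1` B) = P B.

Section Mixing.
Variables (d0 : measure_display) (Omega : measurableType d0).
Variables (A : finType) (d : nat) (V : A -> Omega -> 'M[C]_d).
Variables (theta thinv : Omega -> Omega).

Definition env_gen (J : set int) : set (set Omega) :=
  [set B | exists j a i k j' l b (D : set R), J j /\ measurable D /\
     B = (fun w => Tcoef V a i k j' l b (iterz theta thinv j w)) @^-1` D].

Definition Fpast (k : int) : set (set Omega) := <<s env_gen [set j | (j <= k)%R] >>.
Definition Ffut (k : int) : set (set Omega) := <<s env_gen [set j | (k <= j)%R] >>.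

Definition alpha_mix (P : probability Omega R) (n : nat) : R :=
  sup [set x : R | exists (k : int) (B Cc : set Omega),
    Fpast k B /\ Ffut (k + n%:Z) Cc /\
    x = `| fine (P (B `&` Cc)) - fine (P B) * fine (P Cc) | ].
End Mixing.

Definition gaussE (s2 : R) (g : R -> R) : R :=
  fine (\int[@lebesgue_measure R]_x
          (g (Num.sqrt s2 * x) * (expR (- (x ^+ 2) / 2) / Num.sqrt (pi *+ 2)))%:E).

Definition bounded_continuous (g : R -> R) : Prop :=
  continuous g /\ exists M : R, forall x, `|g x| <= M.

End QTDefs.
Arguments dN {R A}.

(* Main.v *)
(* Under the stationary annealed law the letters form a stationary mixing
   sequence: the future of a word after a gap depends on its past only through
   the unnormalised state carried across the gap, which the channel forgets at
   rate [r] by (H3), and the remaining dependence is that of the environment,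
   controlled by [alpha_mix]; both rates are summable. For a summable rate and
   bounded summands Lindeberg's block argument gives the central limit theorem:
   blocks separated by a gap are replaced one by one by independent Gaussians,
   which for a Gaussian test function merely widens it. Convergence against all
   Gaussian bumps, which can be mixed into any smoothed test function, implies
   weak convergence. For another initial state one discards a fixed number of
   initial letters, after which its law is close to the stationary one. *)

(* The sums in the limit theorem depend on words of length [n + m - 1] only, so the block argument
   runs on weighted finite types; the environment enters through the word weights and the mixing
   estimates. The Gaussians of Lindeberg's exchange are never constructed: by the heat equation,
   averaging over one of variance [tau] is the passage from [heatk H] to [heatk (H + tau)]. The
   variance never drops below the initial [h], which gives one bound on derivatives for all steps
   and admits a limit variance 0. Two obstacles shape the mixing estimate. (H3) speaks of normalised
   random states, whereas the gap is crossed by a weighted, unnormalised one; a multiple of [s]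
   completes it to a state. And forgetting that state leaves [s] at the end of the gap, which
   depends on the whole past of the environment; it is approximated in turn by a state rebuilt from
   recent times. The exponent [delta / (2 + delta)] is at most 1, so summability of the powers
   yields that of the rates themselves, which is enough for bounded summands. *)
Require Import Defs.
From HB Require Import structures.
From mathcomp Require Import all_boot all_order all_algebra.
From mathcomp Require Import all_classical all_reals all_analysis.
From mathcomp Require Import measurable_realfun complex sesquilinear spectral.
From mathcomp Require Import ring lra zify.
Set Implicit Arguments.
Unset Strict Implicit.
Unset Printing Implicit Defensive.
Import Order.TTheory GRing.Theory Num.Theory.
Import numFieldNormedType.Exports.
Local Open Scope classical_set_scope.
Local Open Scope ring_scope.

(** * Gaussian bumps *)

Section Gauss.
Variable R : realType.
Local Notation mu := (@lebesgue_measure R).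

(* The centred Gaussian density of variance [H], without the factor
   [1 / sqrt (2 pi)]; it solves the heat equation [d/dH = (1/2) d^2/dx^2]. *)
Definition heatk (H x : R) : R := expR (- (x ^+ 2 / (2 * H)) - ln H / 2).
Definition gdens (x : R) : R := expR (- (x ^+ 2) / 2) / Num.sqrt (pi *+ 2).

Lemma heatk_ge0 H x : 0 <= heatk H x. Proof. exact: expR_ge0. Qed.

Lemma heatk_le h H x : 0 < h -> h <= H -> heatk H x <= expR (- ln h / 2).
Proof.
move=> h0 hH; have H0 : 0 < H by exact: lt_le_trans hH.
rewrite /heatk ler_expR.
have : ln h <= ln H by rewrite ler_ln ?posrE.
have : 0 <= x ^+ 2 / (2 * H) by rewrite divr_ge0 ?sqr_ge0 ?mulr_ge0 // ltW.
lra.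
Qed.

Lemma gdens_ge0 x : 0 <= gdens x.
Proof. by rewrite divr_ge0 ?expR_ge0 ?sqrtr_ge0. Qed.

Lemma gdensE : gdens = normal_pdf 0 1.
Proof.
rewrite normal_pdfE ?oner_neq0 //; apply/funext => x.
by rewrite /gdens /normal_peak /normal_fun subr0 expr1n mul1r mulrC.
Qed.

Lemma integral_gdens : (\int[mu]_x (gdens x)%:E = 1)%E.
Proof. by rewrite gdensE integral_normal_pdf. Qed.

Lemma integrable_gdens : mu.-integrable setT (EFin \o gdens).
Proof. by rewrite gdensE; exact: integrable_normal_pdf. Qed.

Lemma continuous_gdens : continuous gdens.
Proof. by rewrite gdensE; apply: continuous_normal_pdf; rewrite oner_neq0. Qed.

Lemma continuous_heatk H : continuous (heatk H).
Proof.
move=> x; apply: (cvg_comp _ expR); last exact: continuous_expR.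
apply: (@cvgB _ R^o); last exact: cvg_cst.
apply: (@cvgN _ R^o); apply: cvgM; last exact: cvg_cst.
exact: sqr_continuous.
Qed.

Lemma expR_half_ln (H : R) : 0 < H -> expR (ln H / 2) = Num.sqrt H.
Proof.
move=> H0; apply/eqP; rewrite -(eqrXn2 (n := 2)) ?expR_ge0 ?sqrtr_ge0 //.
rewrite sqr_sqrtr ?(ltW H0) // -expRM_natl (_ : 2%:R * _ = ln H); last by field.
by rewrite lnK ?posrE.
Qed.

Lemma heatk_scale (H x : R) : 0 < H ->
  heatk H (Num.sqrt H * x) * Num.sqrt H = expR (- (x ^+ 2) / 2).
Proof.
move=> H0; rewrite -{2}expR_half_ln // /heatk -expRD exprMn sqr_sqrtr ?(ltW H0) //.
by congr expR; field; rewrite gt_eqF.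
Qed.

Lemma heatkN (H x : R) : heatk H (- x) = heatk H x.
Proof. by rewrite /heatk sqrrN. Qed.

(** Under [y = z + Num.sqrt H * x] the bump of variance [H] becomes the standard density, so
    averaging [g] against bumps is averaging it over a Gaussian around [z]. For nonnegative [g] the
    identity holds in the extended reals, without integrability. *)
Lemma gauss_subst (g : R -> R) (z H : R) : 0 < H -> continuous g ->
  (forall x, 0 <= g x) ->
  (\int[mu]_y (g y * (heatk H (z - y) / Num.sqrt (pi *+ 2)))%:E =
   \int[mu]_x (g (z + Num.sqrt H * x) * gdens x)%:E)%E.
Proof.
move=> H0 cg g0.
pose F (x : R^o) : R^o := z + Num.sqrt H * x.
have sH : 0 < Num.sqrt H by rewrite sqrtr_gt0.
have dF x : is_derive (x : R^o) 1 F (Num.sqrt H).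
  rewrite /F; apply: is_derive_eq; by rewrite add0r mul1r; exact: mulr1.
have F'E : F^`()%classic = cst (Num.sqrt H).
  by apply/funext => x; rewrite derive1E; case: (dF x).
rewrite (increasing_ge0_integration_by_substitutionT (F := F)); first last.
- by move=> x; rewrite mulr_ge0 ?divr_ge0 ?heatk_ge0 ?sqrtr_ge0.
- move=> x; apply: cvgM; first exact: cg.
  apply: cvgM; last exact: cvg_cst.
  apply: (cvg_comp (fun y => z - y) (heatk H)); last exact: continuous_heatk.
  by apply: (@cvgB _ R^o); [exact: cvg_cst|exact: cvg_id].
- rewrite /F; under eq_fun do rewrite addrC.
  apply: (cvg_comp (fun x => Num.sqrt H * x) (fun y => y + z)).
    by apply/gt0_cvgMry => //; exact: cvg_id.
  exact: cvg_addrr.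
- rewrite /F; under eq_fun do rewrite addrC.
  apply: (cvg_comp (fun x => Num.sqrt H * x) (fun y => y + z)).
    by apply/gt0_cvgMrNy => //; exact: cvg_id.
  exact: cvg_addrr_Ny.
- by move=> x; case: (dF x).
- by rewrite F'E; exact: is_cvg_cst.
- by rewrite F'E; exact: is_cvg_cst.
- by rewrite F'E => ?; exact: cvg_cst.
- by move=> x y xy; rewrite /F ltrD2l ltr_pM2l.
apply: eq_integral => x _; rewrite F'E /= !fctE /F /=; congr (_%:E).
rewrite -mulrA; congr (_ * _); rewrite opprD addrA subrr add0r heatkN.
by rewrite mulrAC heatk_scale.
Qed.

Definition gint (f : R -> R) : R := \int[mu]_x (f x * gdens x).

Lemma gaussEE s2 g : gaussE s2 g = gint (fun x => g (Num.sqrt s2 * x)).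
Proof. by []. Qed.

Lemma integrable_bounded_gdens (f : R -> R) (M : R) : continuous f ->
  (forall x, `|f x| <= M) -> mu.-integrable setT (EFin \o (fun x => f x * gdens x)).
Proof.
move=> cf fM.
apply: (@le_integrable _ _ _ mu setT measurableT _ (EFin \o (fun x => M * gdens x))).
- apply/measurable_EFinP/measurable_funM; apply: continuous_measurable_fun => //.
  exact: continuous_gdens.
- move=> x _; rewrite /= lee_fin (normrM (f x)) (normrM M) (ger0_norm (gdens_ge0 x)).
  by rewrite ler_wpM2r ?gdens_ge0 // (le_trans (fM x)) // ler_norm.
- have := integrableZl measurableT M integrable_gdens.
  by apply: eq_integrable => // x _; rewrite /= EFinM.
Qed.

Lemma integrable_sqr_gdens :
  mu.-integrable setT (EFin \o (fun x => x ^+ 2 * gdens x)).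
Proof.
have s20 : Num.sqrt 2 != 0 :> R by rewrite gt_eqF // sqrtr_gt0.
(* From [x ^+ 2 <= 4 * expR (x ^+ 2 / 4)]: the integrand lies below a multiple of the normal density
   of variance 2. *)
pose c := 4 / Num.sqrt (pi *+ 2) / normal_peak (Num.sqrt 2) : R.
apply: (@le_integrable _ _ _ mu setT measurableT _
  (EFin \o (fun x => c * normal_pdf 0 (Num.sqrt 2) x))).
- apply/measurable_EFinP/measurable_funM; apply: continuous_measurable_fun => //.
    exact: sqr_continuous.
  exact: continuous_gdens.
- move=> x _; rewrite /= lee_fin normal_pdfE //.
  rewrite ger0_norm; last exact: mulr_ge0 (sqr_ge0 _) (gdens_ge0 _).
  apply: le_trans (ler_norm _).
  rewrite (mulrA c) mulfVK ?gt_eqF ?normal_peak_gt0 // /gdens /normal_fun subr0.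
  rewrite sqr_sqrtr // (mulrA (x ^+ 2)) (mulrAC 4) ler_wpM2r ?invr_ge0 ?sqrtr_ge0 //.
  have -> : - x ^+ 2 / 2 = - (x ^+ 2 / 4) + - x ^+ 2 / (2 *+ 2) by field.
  rewrite expRD mulrA ler_wpM2r ?expR_ge0 // expRN ler_pdivrMr ?expR_gt0 //.
  have := expR_ge1Dx (x ^+ 2 / 4); lra.
- have := integrableZl measurableT c (@integrable_normal_pdf R 0 (Num.sqrt 2)).
  by apply: eq_integrable => // x _; rewrite /= EFinM.
Qed.

(** The quadratic error serves both the modulus of continuity and, with [e = 0], Chebyshev's
    inequality for a cut-off. *)
Lemma gint_close (f1 f2 : R -> R) (M e C : R) : continuous f1 -> continuous f2 ->
  (forall x, `|f1 x| <= M) -> (forall x, `|f2 x| <= M) ->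
  (forall x, `|f1 x - f2 x| <= e + C * x ^+ 2) ->
  `|gint f1 - gint f2| <= e + C * gint (fun x => x ^+ 2).
Proof.
move=> c1 c2 b1 b2 f12.
have i1 := integrable_bounded_gdens c1 b1.
have i2 := integrable_bounded_gdens c2 b2.
have i3 : mu.-integrable setT (EFin \o (fun x => e * gdens x)).
  have := integrableZl measurableT e integrable_gdens.
  by apply: eq_integrable => // x _; rewrite /= EFinM.
have i4 : mu.-integrable setT (EFin \o (fun x => C * (x ^+ 2 * gdens x))).
  have := integrableZl measurableT C integrable_sqr_gdens.
  by apply: eq_integrable => // x _; rewrite /= EFinM.
rewrite /gint -RintegralB //.
have i12 : mu.-integrable setT (EFin \o (fun x => f1 x * gdens x - f2 x * gdens x)).
  by have := integrableB measurableT i1 i2; apply: eq_integrable.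
apply: le_trans (le_normr_Rintegral measurableT i12) _.
rewrite -[in leRHS]RintegralZl //; last exact: integrable_sqr_gdens.
have -> : e = \int[mu]_x (e * gdens x).
  rewrite RintegralZl //; last exact: integrable_gdens.
  by rewrite /Rintegral integral_gdens mulr1.
rewrite -RintegralD //; apply: le_Rintegral => //.
- exact: integrable_norm i12.
- by have := integrableD measurableT i3 i4; apply: eq_integrable.
- move=> x _ /=; rewrite -mulrBl (normrM (_ - _)) (ger0_norm (gdens_ge0 x)).
  by rewrite mulrA -mulrDl ler_wpM2r ?gdens_ge0.
Qed.

Lemma gint_cst c : gint (fun=> c) = c.
Proof.
rewrite /gint RintegralZl //; last exact: integrable_gdens.
by rewrite /Rintegral integral_gdens mulr1.
Qed.

Lemma gint_sqr_ge0 : 0 <= gint (fun x => x ^+ 2).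
Proof. by apply: Rintegral_ge0 => x _; rewrite mulr_ge0 ?sqr_ge0 ?gdens_ge0. Qed.
End Gauss.

(** * Weak convergence from Gaussian bumps *)

(** Pairs closer than a uniform [d] cost at most [e]; for the others the total oscillation [2 * M]
    is below [2 * M / d ^+ 2] times the squared distance. A quadratic modulus is affordable because
    a Gaussian shift of variance [h] has mean square [h]. *)
Lemma uniform_modulus (R : realType) (g : R -> R) (M K : R) : continuous g ->
  (forall x, `|g x| <= M) -> (forall x, K < `|x| -> g x = 0) ->
  forall e : R, 0 < e -> exists2 C : R, 0 <= C &
    forall x y, `|g x - g y| <= e + C * (x - y) ^+ 2.
Proof.
move=> cg gM gK e e0.
have M0 : 0 <= M by apply: le_trans (normr_ge0 _) (gM 0).
(* Uniform continuity near the compact interval: only [x] has to lie in it. *)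
have : \forall d \near 0^'+, `[- K, K] `<=`
    [set x : R | forall y, `|x - y| < d -> `|g x - g y| <= e].
  have /compact_near_coveringP NC := @segment_compact R (- K) K.
  apply: NC => x _; near_simpl.
  have /cvgrPdist_lt /(_ (e / 2)) := cg x.
  rewrite divr_gt0 // => /(_ isT) /nbhs_ballP [dx /= dx0 hx].
  exists (ball x (dx / 2), [set d | d < dx / 2]) => /=.
    split; first by apply: nbhsx_ballx; rewrite divr_gt0.
    by apply: nbhs_right_lt; rewrite divr_gt0.
  move=> [x' d] /= [xx' dd] y x'y.
  have h1 : `|g x - g x'| < e / 2.
    by apply: hx; rewrite /ball /= in xx' *; apply: lt_le_trans xx' _; lra.
  have h2 : `|g x - g y| < e / 2.
    apply: hx; rewrite /ball /= in xx' *.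
    by have := ler_distD x' x y; lra.
  by have := ler_distD (g x) (g x') (g y); rewrite (distrC (g x') (g x)); lra.
move=> H; near (0 : R)^'+ => d.
have d0 : 0 < d by [].
have Hd : `[- K, K] `<=` [set x | forall y, `|x - y| < d -> `|g x - g y| <= e].
  by near: d.
exists (2 * M / d ^+ 2); first by rewrite divr_ge0 ?mulr_ge0 ?sqr_ge0.
move=> x y; have [xy|xy] := ltP `|x - y| d; last first.
  apply: (@le_trans _ _ (2 * M)).
    by apply: le_trans (ler_normB _ _) _; have := gM x; have := gM y; lra.
  apply: ler_wpDl; first exact: ltW.
  rewrite mulrAC ler_pdivlMr ?exprn_gt0 //.
  rewrite ler_wpM2l ?mulr_ge0 // -(real_normK (num_real (x - y))).
  by rewrite lerXn2r // nnegrE ltW.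
apply: (@le_trans _ _ e); last first.
  by rewrite lerDl mulr_ge0 ?sqr_ge0 // divr_ge0 ?mulr_ge0 ?sqr_ge0.
have [xK|xK] := leP `|x| K.
  by apply: Hd => //=; rewrite in_itv /= -ler_norml.
have [yK|yK] := leP `|y| K.
  by rewrite distrC; apply: Hd => //=; [rewrite in_itv /= -ler_norml|rewrite distrC].
by rewrite !gK // subrr normr0 ltW.
Unshelve. all: by end_near.
Qed.

Section WeakConvergence.
Variable R : realType.
Local Notation mu := (@lebesgue_measure R).
Variables (T : nat -> finType) (p Z : forall n, T n -> R) (s2 : R).
Arguments p {n}.
Arguments Z {n}.
Hypothesis p_ge0 : forall n t, 0 <= @p n t.
Hypothesis p_sum1 : forall n, \sum_(t : T n) p t = 1.
Hypothesis s2_ge0 : 0 <= s2.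

Definition lawE n (f : R -> R) : R := \sum_(t : T n) p t * f (Z t).

Hypothesis bump : forall h y : R, 0 < h ->
  (fun n => lawE n (fun z => heatk h (z - y))) @ \oo --> heatk (h + s2) y.

Lemma lawE_norm n f (M : R) : (forall x, `|f x| <= M) -> `|lawE n f| <= M.
Proof.
move=> fM; apply: le_trans (ler_norm_sum _ _ _) _.
rewrite -[leRHS]mul1r -(p_sum1 n) mulr_suml; apply: ler_sum => t _.
by rewrite normrM ger0_norm // ler_wpM2l.
Qed.

Lemma lawEB n f g : lawE n f - lawE n g = lawE n (fun x => f x - g x).
Proof. by rewrite /lawE -sumrB; apply: eq_bigr => t _; rewrite mulrBr. Qed.

(* Integrating [g] against the bumps [heatk h (z - y)] in [y] yields [g]
   smoothed at scale [sqrt h]. *)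
Lemma lawE_smooth_cvg (g : R -> R) (M K h : R) : 0 < h -> continuous g ->
  (forall x, 0 <= g x <= M) -> (forall x, K < `|x| -> g x = 0) ->
  (fun n => lawE n (fun z => gint (fun x => g (z + Num.sqrt h * x)))) @ \oo
     --> gaussE (h + s2) g.
Proof.
move=> h0 cg gM gK; pose q : R := Num.sqrt (pi *+ 2).
have q0 : 0 <= q by exact: sqrtr_ge0.
have g0 x : 0 <= g x by case/andP: (gM x).
have gN x : `|g x| <= M by rewrite ger0_norm //; case/andP: (gM x).
have cgs z H : continuous (fun x => g (z + Num.sqrt H * x)).
  move=> x; apply: (cvg_comp (fun x => z + Num.sqrt H * x) g); last exact: cg.
  apply: (@cvgD _ R^o); first exact: cvg_cst.
  by apply: cvgM; [exact: cvg_cst|exact: cvg_id].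
have gintE z H : (gint (fun x => g (z + Num.sqrt H * x)))%:E =
    (\int[mu]_x (g (z + Num.sqrt H * x) * gdens x)%:E)%E.
  rewrite fineK //; apply: integrable_fin_num => //.
  exact: (integrable_bounded_gdens (cgs z H) (fun x => gN _)).
have hs2 : 0 < h + s2 by rewrite ltr_pwDl.
have mheat H c : measurable_fun setT (fun y => g y * (heatk H (c - y) / q)).
  apply: measurable_funM; first exact: continuous_measurable_fun.
  apply: continuous_measurable_fun => y; apply: cvgM; last exact: cvg_cst.
  apply: (cvg_comp (fun y => c - y) (heatk H)); last exact: continuous_heatk.
  by apply: (@cvgB _ R^o); [exact: cvg_cst|exact: cvg_id].
pose F n y := g y * (lawE n (fun z => heatk h (z - y)) / q).
have FE n y : F n y = \sum_(t : T n) p t * (g y * (heatk h (Z t - y) / q)).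
  rewrite /F /lawE mulr_suml mulr_sumr; apply: eq_bigr => t _.
  by rewrite -[in RHS]mulrCA -!mulrA.
have mF n : measurable_fun setT (F n).
  by rewrite (funext (FE n)); apply: measurable_sum => t; apply: measurable_funM.
have E1 n : (\int[mu]_y (F n y)%:E)%E =
    (lawE n (fun z => gint (fun x => g (z + Num.sqrt h * x))))%:E.
  under eq_integral do rewrite FE -sumEFin.
  rewrite ge0_integral_sum //=; first last.
  - by move=> t y _; rewrite lee_fin !mulr_ge0 ?heatk_ge0 ?invr_ge0.
  - move=> t; apply/measurable_EFinP; apply: measurable_funM; last exact: mheat.
    exact: measurable_cst.
  rewrite /lawE -sumEFin; apply: eq_bigr => t _.
  under eq_integral do rewrite EFinM.
  rewrite ge0_integralZl_EFin //; first last.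
  - by apply/measurable_EFinP; exact: mheat.
  - by move=> y _; rewrite lee_fin !mulr_ge0 ?heatk_ge0 ?invr_ge0.
  by rewrite gauss_subst // EFinM gintE.
have E2 : (\int[mu]_y (g y * (heatk (h + s2) (0 - y) / q))%:E)%E =
    (gaussE (h + s2) g)%:E.
  by rewrite gauss_subst // -gintE gaussEE; do 2 f_equal; apply/funext => x; rewrite add0r.
suff: (fun n => \int[mu]_y (F n y)%:E)%E @ \oo -->
    (\int[mu]_y (g y * (heatk (h + s2) (0 - y) / q))%:E)%E.
  by rewrite E2; under eq_fun do rewrite E1; move/fine_cvg.
(* Dominating constant: [F n] is supported where [g] is, inside [[- K, K]], and a bump of variance
   [h] never exceeds [expR (- ln h / 2)]. *)
pose B := M * (expR (- ln h / 2) / q).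
case: (@dominated_convergence _ _ _ mu setT measurableT (fun n y => (F n y)%:E)
  (fun y => (g y * (heatk (h + s2) (0 - y) / q))%:E)
  (fun y => (B * \1_(`[- K, K] : set R) y)%:E)
  (fun n => (measurable_EFinP _ _).2 (mF n)) ((measurable_EFinP _ _).2 (mheat _ _))) => [|||_ _ //].
- apply: aeW => y _; apply: cvg_EFin; first exact: nearW.
  apply: cvgM; first exact: cvg_cst.
  apply: cvgM; last exact: cvg_cst.
  by rewrite sub0r heatkN; exact: bump.
- have := integrableZl measurableT B (integrable_indic_itv (- K) K true false).
  by apply: eq_integrable => // x _; rewrite /= EFinM.
- apply: aeW => y n _; rewrite lee_fin indicE.
  have [yK|/negP yK] := boolP (y \in `[- K, K]).
    rewrite mem_set // mulr1 /F normrM ler_pM //.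
    rewrite normrM (ger0_norm (_ : 0 <= q^-1)) ?invr_ge0 //.
    rewrite ler_wpM2r ?invr_ge0 //; apply: lawE_norm => z.
    by rewrite ger0_norm ?heatk_ge0 // heatk_le.
  rewrite memNset // mulr0 /F gK ?mul0r ?normr0 //.
  by rewrite ltNge; apply/negP; rewrite ler_norml => ?; apply: yK; rewrite in_itv.
Qed.

(** Smoothing at variance [h] moves the laws and the limit by at most [e / 5 + C * h * m2],
    uniformly in [n]. The choice of [h] makes this two fifths of [e], and the smoothed quantities
    converge. *)
Lemma lawE_cvg_compact (g : R -> R) (M K : R) : continuous g ->
  (forall x, 0 <= g x <= M) -> (forall x, K < `|x| -> g x = 0) ->
  (fun n => lawE n g) @ \oo --> gaussE s2 g.
Proof.
move=> cg gM gK; have gN x : `|g x| <= M.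
  by have /andP[g0 ?] := gM x; rewrite ger0_norm.
pose m2 : R := gint (fun x => x ^+ 2).
have m20 : 0 <= m2 by exact: gint_sqr_ge0.
apply/cvgrPdist_le => /= e e0.
have e5 : 0 < e / 5 by rewrite divr_gt0.
have [C C0 gC] := uniform_modulus cg gN gK e5.
pose h := e / 5 / (C * m2 + 1).
have Cm : 0 < C * m2 + 1 by rewrite ltr_wpDl ?mulr_ge0.
have h0 : 0 < h by rewrite divr_gt0.
have hC : C * h * m2 <= e / 5.
  rewrite /h mulrAC mulrA ler_pdivrMr // mulrC ler_wpM2l ?(ltW e5) //.
  by rewrite lerDl.
have cgs z H : continuous (fun x => g (z + Num.sqrt H * x)).
  move=> x; apply: (cvg_comp (fun x => z + Num.sqrt H * x) g); last exact: cg.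
  apply: (@cvgD _ R^o); first exact: cvg_cst.
  by apply: cvgM; [exact: cvg_cst|exact: cvg_id].
have cgs0 H : continuous (fun x => g (Num.sqrt H * x)).
  by have := cgs 0 H; under eq_fun do rewrite add0r.
have close1 n : `|lawE n g - lawE n (fun z => gint (fun x => g (z + Num.sqrt h * x)))|
    <= 2 * (e / 5).
  rewrite lawEB; apply: lawE_norm => z.
  rewrite -[X in `|X - _|]gint_cst.
  apply: le_trans (gint_close (M := M) (e := e / 5) (C := C * h) _ _ _ _ _) _ => //.
  - by move=> x; exact: cvg_cst.
  - move=> x; apply: le_trans (gC _ _) _.
    by rewrite opprD addrA subrr add0r sqrrN exprMn sqr_sqrtr ?(ltW h0) // mulrA.
  - by rewrite -/m2; move: hC; lra.
have close2 : `|gaussE s2 g - gaussE (h + s2) g| <= 2 * (e / 5).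
  rewrite !gaussEE.
  apply: le_trans (gint_close (M := M) (e := e / 5) (C := C * h) _ _ _ _ _) _ => //.
  - move=> x; apply: le_trans (gC _ _) _.
    rewrite lerD2l -mulrBl exprMn mulrA ler_wpM2r ?sqr_ge0 // ler_wpM2l //.
    rewrite -sqrrN opprB sqrrB !sqr_sqrtr ?addr_ge0 ?(ltW h0) //.
    rewrite -sqrtrM ?addr_ge0 ?(ltW h0) //.
    (* The squared difference of [Num.sqrt (h + s2)] and [Num.sqrt s2] is then at most [h], also for
       [s2 = 0]. *)
    have : s2 <= Num.sqrt ((h + s2) * s2).
      rewrite -{1}(ger0_norm s2_ge0) -sqrtr_sqr ler_wsqrtr // expr2.
      by rewrite ler_wpM2r // lerDr ltW.
    by rewrite mulr2n; lra.
  - by rewrite -/m2; move: hC; lra.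
have := @lawE_smooth_cvg g M K h h0 cg gM gK.
move=> /cvgrPdist_le /(_ _ e5); apply: filterS => n close3.
have -> : e = 2 * (e / 5) + e / 5 + 2 * (e / 5) by field.
apply: le_trans (ler_distD (gaussE (h + s2) g) _ _) _; rewrite -addrA lerD //.
apply: le_trans (ler_distD (lawE n (fun z => gint (fun x => g (z + Num.sqrt h * x)))) _ _) _.
by rewrite lerD // distrC.
Qed.

(** Tightness is not assumed: the cut-off [chi K] is itself a compactly supported test function, so
    the mass that the laws leave outside converges to the Gaussian one, which is of order [K ^- 2]
    by Chebyshev's inequality. *)
Lemma lawE_cvg (g : R -> R) : bounded_continuous g ->
  (fun n => lawE n g) @ \oo --> gaussE s2 g.
Proof.
case=> cg [M gM]; have M0 : 0 <= M by apply: le_trans (normr_ge0 _) (gM 0).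
pose m2 : R := gint (fun x => x ^+ 2).
have m20 : 0 <= m2 by exact: gint_sqr_ge0.
pose chi (K x : R) : R := Num.max 0 (Num.min 1 (K + 1 - `|x|)).
have cchi K : continuous (chi K).
  move=> x; apply: (@continuous_max R R (cst 0) (fun x => Num.min 1 (K + 1 - `|x|))).
    exact: cvg_cst.
  apply: (@continuous_min R R (cst 1) (fun x => K + 1 - `|x|)); first exact: cvg_cst.
  by apply: (@cvgB _ R^o); [exact: cvg_cst|exact: norm_continuous].
have chi01 K x : 0 <= chi K x <= 1.
  by rewrite /chi le_max lexx /= ge_max ler01 /= ge_min lexx.
have chi1 K x : 0 < K -> 1 - chi K x <= K ^- 2 * x ^+ 2.
  move=> K0; rewrite /chi; have [xK|xK] := leP `|x| K.
    rewrite (min_idPl _) ?(max_idPr _) ?ler01 //; last by lra.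
    by rewrite subrr mulr_ge0 ?sqr_ge0 // invr_ge0 sqr_ge0.
  apply: (@le_trans _ _ 1); first by rewrite gerBl le_max lexx.
  rewrite mulrC ler_pdivlMr ?exprn_gt0 // mul1r -(real_normK (num_real x)).
  by rewrite lerXn2r ?nnegrE ?normr_ge0 //; exact: ltW.
have chi0 K x : K + 1 < `|x| -> chi K x = 0.
  by move=> xK; rewrite /chi; apply/max_idPl; rewrite ge_min; apply/orP; right; lra.
(* The compactly supported case asks for nonnegative functions. *)
pose gp x := g x + M.
have gp0 x : 0 <= gp x <= 2 * M.
  by have := gM x; rewrite ler_norml /gp => /andP[? ?]; apply/andP; split; lra.
have cgp : continuous gp by move=> x; apply: (@cvgD _ R^o); [exact: cg|exact: cvg_cst].
apply/cvgrPdist_le => /= e e0.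
have e4 : 0 < e / 4 by rewrite divr_gt0.
(* The bound [2 * M] on [gp] is paid twice, for truncation in the laws and in the limit; the 1 keeps
   [B] positive when [M = 0]. *)
pose B := 4 * M + 1; have B0 : 0 < B by rewrite /B; lra.
have [K K0 HK] : exists2 K : R, 0 < K & B * (K ^- 2 * s2 * m2) <= e / 4.
  pose D := B * s2 * m2; have D0 : 0 <= D by rewrite !mulr_ge0 // ltW.
  exists (Num.sqrt (D / (e / 4) + 1)).
    by rewrite sqrtr_gt0 ltr_wpDl // divr_ge0 // ltW.
  have E0 : 0 < D / (e / 4) + 1 by rewrite ltr_wpDl // divr_ge0 // ltW.
  rewrite sqr_sqrtr ?(ltW E0) // (_ : B * _ = D / (D / (e / 4) + 1)); last first.
    by set i := (D / (e / 4) + 1)^-1; rewrite /D; ring.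
  rewrite ler_pdivrMr // mulrDr mulr1 mulrC divfK ?gt_eqF //.
  by rewrite lerDl ltW.
have csc (f : R -> R) : continuous f -> continuous (fun x => f (Num.sqrt s2 * x)).
  move=> cf x; apply: (cvg_comp (fun x => Num.sqrt s2 * x) f); last exact: cf.
  by apply: cvgM; [exact: cvg_cst|exact: cvg_id].
pose gc x := gp x * chi K x.
have cgc : continuous gc by move=> x; apply: cvgM; [exact: cgp|exact: cchi].
have gc0 x : 0 <= gc x <= 2 * M.
  have /andP[? ?] := gp0 x; have /andP[? ?] := chi01 K x.
  rewrite mulr_ge0 //= -[leRHS]mulr1 ler_pM //.
have gcK x : K + 1 < `|x| -> gc x = 0 by move=> /chi0; rewrite /gc => ->; rewrite mulr0.
have chiK x : K + 1 < `|x| -> chi K x = 0 by exact: chi0.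
have L1 := lawE_cvg_compact cgc gc0 gcK.
have L2 := lawE_cvg_compact (cchi K) (chi01 K) chiK.
have bd (f : R -> R) (c : R) : (forall x, 0 <= f x <= c) -> forall x, `|f x| <= c.
  by move=> f0 x; have /andP[? ?] := f0 x; rewrite ger0_norm.
have G1 : `|gaussE s2 gp - gaussE s2 gc| <= 2 * M * (K ^- 2 * s2 * m2).
  rewrite !gaussEE; apply: le_trans
    (gint_close (M := 2 * M) (e := 0) (C := 2 * M * (K ^- 2 * s2)) _ _ _ _ _) _;
    [exact: csc|exact: csc|by move=> x; exact: bd|by move=> x; exact: bd| |].
  - move=> x; rewrite add0r /gc -{1}[gp _]mulr1 -mulrBr normrM -mulrA.
    have /andP[? ?] := chi01 K (Num.sqrt s2 * x).
    apply: ler_pM => //; first by exact: bd.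
    rewrite ger0_norm ?subr_ge0 //; apply: le_trans (chi1 _ _ K0) _.
    by rewrite exprMn sqr_sqrtr // mulrA.
  - by rewrite add0r -/m2 -!mulrA.
have G2 : `|1 - gaussE s2 (chi K)| <= K ^- 2 * s2 * m2.
  rewrite gaussEE -{1}(gint_cst 1); apply: le_trans
    (gint_close (M := 1) (e := 0) (C := K ^- 2 * s2) _ _ _ _ _) _;
    [by move=> x; exact: cvg_cst|exact: csc|by move=> x; rewrite normr1
    |by move=> x; exact: bd| |by rewrite add0r].
  move=> x; rewrite add0r; have /andP[? ?] := chi01 K (Num.sqrt s2 * x).
  rewrite ger0_norm ?subr_ge0 //; apply: le_trans (chi1 _ _ K0) _.
  by rewrite exprMn sqr_sqrtr // mulrA.
have Ggp : gaussE s2 gp = gaussE s2 g + M.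
  rewrite !gaussEE -[X in _ + X]gint_cst /gint -RintegralD //.
  - by apply: eq_Rintegral => x _; rewrite -mulrDl.
  - exact: (integrable_bounded_gdens (csc _ cg) (fun x => gM _)).
  - by apply: (@integrable_bounded_gdens _ (fun=> M) `|M|) => // x; exact: cvg_cst.
have Lgp n : lawE n gp = lawE n g + M.
  rewrite /lawE /gp; under eq_bigr do rewrite mulrDr.
  by rewrite big_split /= -mulr_suml p_sum1 mul1r.
have Lgc n : `|lawE n gp - lawE n gc| <= 2 * M * (1 - lawE n (chi K)).
  rewrite lawEB; apply: le_trans (ler_norm_sum _ _ _) _.
  rewrite -[X in X - lawE _ _](p_sum1 n) /lawE -sumrB mulr_sumr; apply: ler_sum => t _.
  rewrite normrM ger0_norm // /gc -{1}[gp _]mulr1 -mulrBr normrM.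
  rewrite (_ : p t - _ = p t * (1 - chi K (Z t))); last by rewrite mulrBr mulr1.
  rewrite [leRHS]mulrCA ler_wpM2l //.
  have /andP[? ?] := chi01 K (Z t).
  by rewrite (ger0_norm (_ : 0 <= 1 - chi K (Z t))) ?subr_ge0 // ler_wpM2r ?subr_ge0 // bd.
have eB : 0 < e / 4 / B by rewrite divr_gt0.
move/cvgrPdist_le: L1 => /(_ _ e4) L1; move/cvgrPdist_le: L2 => /(_ _ eB) L2.
near=> n.
have H1 : `|gaussE s2 gc - lawE n gc| <= e / 4 by near: n.
have H2 : `|gaussE s2 (chi K) - lawE n (chi K)| <= e / 4 / B by near: n.
have H3 : 1 - lawE n (chi K) <= K ^- 2 * s2 * m2 + e / 4 / B.
  have := le_trans (ler_norm _) G2; have := le_trans (ler_norm _) H2; lra.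
have H4 : 2 * M * (1 - lawE n (chi K)) <= 2 * M * (K ^- 2 * s2 * m2) + e / 4.
  apply: le_trans (ler_wpM2l _ H3) _; rewrite ?mulr_ge0 // mulrDr lerD2l.
  rewrite mulrA ler_pdivrMr // mulrC ler_wpM2l ?(ltW e4) // /B; lra.
have H5 : 4 * M * (K ^- 2 * s2 * m2) <= e / 4.
  apply: le_trans HK; rewrite ler_wpM2r ?mulr_ge0 ?invr_ge0 ?sqr_ge0 //.
  by rewrite /B; lra.
have -> : gaussE s2 g - lawE n g = (gaussE s2 gp - gaussE s2 gc) +
   (gaussE s2 gc - lawE n gc) + (lawE n gc - lawE n gp) by rewrite Ggp Lgp; ring.
apply: le_trans (ler_normD _ _) _; apply: le_trans (lerD (ler_normD _ _) (lexx _)) _.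
rewrite (distrC (lawE n gc)); have := Lgc n; move: H1 H4 H5 G1; lra.
Unshelve. all: by end_near.
Qed.
End WeakConvergence.

(** * Summability of mixing rates *)

Section Summability.
Variable R : realType.
Implicit Types (u : nat -> R) (B k : R).

Lemma bounded_series_cvg u B : (forall n, 0 <= u n) ->
  (forall N, \sum_(i < N) u i <= B) -> cvgn (series u).
Proof.
move=> u0 uB; apply: nondecreasing_is_cvgn.
  by apply: nondecreasing_series => n _ _; exact: u0.
by exists B => _ [N _ <-]; rewrite /series /= big_mkord.
Qed.

(** Each value of [i./2] is taken by two indices. Needed because the mixing rate is evaluated at
    half of the gap. *)
Lemma sum_half_le u N : (forall n, 0 <= u n) ->
  \sum_(i < N) u i./2 <= 2 * \sum_(i < N) u i.
Proof.
move=> u0; have -> : 2 * \sum_(i < N) u i = \sum_(i < N.*2) u i./2.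
  elim: N => [|N IH]; first by rewrite !big_ord0 mulr0.
  rewrite doubleS !big_ord_recr /= mulrDr IH uphalf_double half_double.
  by rewrite -addrA; congr (_ + _); rewrite mulrDl !mul1r.
rewrite -!(big_mkord xpredT (fun i => u i./2)) [leRHS](big_cat_nat _ (n := N)) //=.
  by rewrite lerDl sumr_ge0.
by rewrite -addnn leq_addr.
Qed.

(** The powers [u ^ k] are bounded by their sum [B]. Writing [u] as the power [(1 - k) / k] of
    [u ^ k], times [u ^ k], the first factor is bounded because [k <= 1]. *)
Lemma powR_summable u k : 0 < k <= 1 -> (forall n, 0 <= u n) ->
  (\sum_(1 <= n <oo) ((u n) `^ k)%:E < +oo)%E ->
  exists2 B, 0 <= B & forall N, \sum_(i < N) u i.+1 <= B.
Proof.
move=> /andP[k0 k1] u0 ulty.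
set S := (X in (X < _)%E) in ulty.
have S0 : (0 <= S)%E by apply: nneseries_ge0 => n _ _; rewrite lee_fin powR_ge0.
have [B SB] : exists B, S = B%:E by move: S0 ulty; case: S => // B; exists B.
have B0 : 0 <= B by rewrite -lee_fin -SB.
have sB N : \sum_(i < N) (u i.+1) `^ k <= B.
  rewrite -lee_fin -SB -sumEFin.
  apply: le_trans (nneseries_lim_ge N.+1 _); last by move=> n _ _; rewrite lee_fin powR_ge0.
  by rewrite big_add1 /= big_mkord.
have tB n : (u n.+1) `^ k <= B.
  by apply: le_trans (sB n.+1); rewrite big_ord_recr /= lerDr sumr_ge0 // => i _; exact: powR_ge0.
pose K := B `^ ((1 - k) / k).
have uK n : u n.+1 <= K * (u n.+1) `^ k.
  have {1}-> : u n.+1 = ((u n.+1) `^ k) `^ ((1 - k) / k) * (u n.+1) `^ k.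
    rewrite -powRrM mulrCA divff ?gt_eqF // mulr1.
    have [->|un] := eqVneq (u n.+1) 0; first by rewrite (powR0 (lt0r_neq0 k0)) mulr0.
    by rewrite -powRD ?un ?implybT // subrK powRr1.
  rewrite ler_wpM2r ?powR_ge0 // ge0_ler_powR ?nnegrE ?powR_ge0 //.
  by rewrite divr_ge0 ?subr_ge0 // ltW.
exists (K * B) => [|N]; first by rewrite mulr_ge0 // powR_ge0.
apply: le_trans (ler_sum _ (fun (i : 'I_N) _ => uK i)) _.
by rewrite -mulr_sumr ler_wpM2l ?powR_ge0 //; exact: sB.
Qed.

Lemma summable_small u B : (forall N, \sum_(i < N) u i.+1 <= B) ->
  forall e, 0 < e -> exists2 n, (0 < n)%N & u n <= e.
Proof.
move=> uB e e0; apply: contrapT => nex.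
have ue n : e <= u n.+1.
  by have [//|h] := leP e (u n.+1); case: nex; exists n.+1 => //; exact: ltW.
pose N := (Num.truncn (B / e)).+1.
have := uB N; apply/negP; rewrite -ltNge.
apply: lt_le_trans (ler_sum _ (fun (i : 'I_N) _ => ue i)).
rewrite sumr_const card_ord -mulr_natl -ltr_pdivrMr //.
exact: truncnS_gt.
Qed.
End Summability.

(** * Taylor expansion of the heat kernel *)

Section HeatTaylor.
Variable R : realType.
Implicit Types (x H b c t : R).

(** By the mean value theorem a power bound on the derivative gains one exponent. Iteration gives
    Taylor remainders, with the crude constant [C] and no factorials. One-sided, because the
    variance has to stay positive. *)
Lemma derive_growth_pos (F F' : R -> R) (C : R) k : F 0 = 0 ->
  (forall t, 0 <= t -> is_derive t 1 F (F' t)) ->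
  (forall t, 0 <= t -> `|F' t| <= C * t ^+ k) ->
  forall t, 0 <= t -> `|F t| <= C * t ^+ k.+1.
Proof.
move=> F0 dF bF t t0.
have cF : {within `[0, t], continuous F}.
  by apply: derivable_within_continuous => x; rewrite in_itv /= => /andP[x0 _]; case: (dF x x0).
have C0 : 0 <= C by have := le_trans (normr_ge0 _) (bF 1 ler01); rewrite expr1n mulr1.
have dF' x : x \in `]0, t[ -> is_derive x 1 F (F' x).
  by rewrite in_itv /= => /andP[x0 _]; apply: dF; exact: ltW.
have [x] := MVT_segment t0 dF' cF.
rewrite in_itv /= F0 !subr0 => /andP[x0 xt] ->.
rewrite normrM (ger0_norm t0) exprSr mulrA ler_wpM2r //.
by apply: le_trans (bF x x0) _; rewrite ler_wpM2l // lerXn2r ?nnegrE.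
Qed.

Lemma derive_growth (F F' : R -> R) (C : R) k : F 0 = 0 ->
  (forall t, is_derive t 1 F (F' t)) -> (forall t, `|F' t| <= C * `|t| ^+ k) ->
  forall t, `|F t| <= C * `|t| ^+ k.+1.
Proof.
move=> F0 dF bF t; have [t0|t0] := leP 0 t.
  rewrite (ger0_norm t0); apply: (@derive_growth_pos F F') => // u u0.
  by rewrite -{2}(ger0_norm u0).
rewrite (ltr0_norm t0) -{1}(opprK t).
apply: (@derive_growth_pos (fun u => F (- u)) (fun u => - F' (- u))).
- by rewrite oppr0.
- move=> u _; have d := dF (- u); apply: is_derive_eq.
  by rewrite /GRing.scale /= mulrN1.
- by move=> u u0; rewrite normrN; have := bF (- u); rewrite (normrN u) (ger0_norm u0).
- by rewrite oppr_ge0 ltW.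
Qed.

(* [heatk1], [heatk2], [heatk3] are derivatives in [x] and [heatkHH] is the
   second derivative in [H]; the first one is [heatk2 / 2]. *)
Definition heatk1 H x : R := - (x / H) * heatk H x.
Definition heatk2 H x : R := (x ^+ 2 / H ^+ 2 - H^-1) * heatk H x.
Definition heatk3 H x : R := (3 * x / H ^+ 2 - x ^+ 3 / H ^+ 3) * heatk H x.
Definition heatkHH H x : R :=
  ((x ^+ 2 / (2 * H ^+ 2) - (2 * H)^-1) ^+ 2 - x ^+ 2 / H ^+ 3 + (2 * H ^+ 2)^-1) * heatk H x.

Lemma is_derive_heatk_x H x : 0 < H -> is_derive x 1 (heatk H) (heatk1 H x).
Proof.
move=> H0; rewrite /heatk1 /heatk; apply: is_derive_eq.
by rewrite /GRing.scale /=; field; rewrite gt_eqF.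
Qed.

Lemma is_derive_heatk1_x H x : 0 < H -> is_derive x 1 (heatk1 H) (heatk2 H x).
Proof.
move=> H0; have dk := is_derive_heatk_x x H0.
rewrite /heatk2 /(heatk1 H); apply: is_derive_eq.
by rewrite /GRing.scale /= /heatk1; field; rewrite gt_eqF.
Qed.

Lemma is_derive_heatk2_x H x : 0 < H -> is_derive x 1 (heatk2 H) (heatk3 H x).
Proof.
move=> H0; have dk := is_derive_heatk_x x H0.
rewrite /heatk3 /(heatk2 H); apply: is_derive_eq.
by rewrite /GRing.scale /= /heatk1; field; rewrite gt_eqF.
Qed.

Lemma is_derive_heatk_H x H : 0 < H ->
  is_derive H 1 (fun H => heatk H x) (heatk2 H x / 2).
Proof.
move=> H0; have dl := is_derive1_ln H0.
have dv : is_derive H 1 (fun H => (2 * H)^-1) (- (2 * H ^+ 2)^-1).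
  apply: is_derive_eq; first by apply: is_deriveV; rewrite mulf_neq0 ?gt_eqF.
  by rewrite /GRing.scale /=; field; rewrite gt_eqF.
rewrite /heatk2 /heatk; apply: is_derive_eq.
rewrite /GRing.scale /=; field; rewrite gt_eqF //.
Qed.

Lemma is_derive_heatk2_H x H : 0 < H ->
  is_derive H 1 (fun H => heatk2 H x) (2 * heatkHH H x).
Proof.
move=> H0; have dk := is_derive_heatk_H x H0.
have dv : is_derive H 1 (fun H => H^-1) (- (H ^+ 2)^-1).
  apply: is_derive_eq; first by apply: (@is_deriveV _ id); rewrite gt_eqF.
  by rewrite /GRing.scale /=; field; rewrite gt_eqF.
have -> : (fun H => heatk2 H x) =
    (fun H => (x ^+ 2 * (H^-1 ^+ 2) - H^-1) * heatk H x).
  by apply/funext => u; rewrite /heatk2 exprVn.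
apply: is_derive_eq.
rewrite /heatkHH /heatk2 /GRing.scale /=; field; rewrite gt_eqF //.
Qed.

Lemma exp_poly_le (z : R) : 0 <= z -> expR (- z) * (1 + z + z ^+ 2) <= 6.
Proof.
move=> z0; rewrite expRN mulrC ler_pdivrMr ?expR_gt0 //.
have h1 := expR_ge1Dx z.
have h2 : (z / 2) ^+ 2 <= expR z.
  rewrite (_ : z = z / 2 + z / 2) ?[in leRHS]expRD; last by field.
  rewrite {1}(_ : (z / 2 + z / 2) / 2 = z / 2); last by field.
  have h3 := expR_ge1Dx (z / 2).
  by rewrite expr2 ler_pM // ?divr_ge0 //; lra.
lra.
Qed.

(** With [j = 1 / H] and [z = x ^+ 2 / (2 * H)], each derivative is [heatk H x] times a factor
    bounded by [10 * (1 + j) ^+ 2 * (1 + z + z ^+ 2)]; the decay [expR (- z)] absorbs the polynomial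
    in [z], and [j <= 1 / h]. *)
Lemma heatk_bounds (h : R) : 0 < h -> exists2 C : R, 0 < C & forall H x, h <= H ->
  [/\ `|heatk H x| <= C, `|heatk1 H x| <= C, `|heatk2 H x| <= C,
      `|heatk3 H x| <= C & `|heatkHH H x| <= C].
Proof.
move=> h0; pose c0 : R := expR (- ln h / 2); pose K : R := 10 * (1 + h^-1) ^+ 2.
have K0 : 0 < K by rewrite mulr_gt0 // exprn_gt0 // ltr_wpDl // invr_gt0.
have c00 : 0 < c0 by exact: expR_gt0.
exists (K * (6 * c0)); first by apply: mulr_gt0 => //; apply: mulr_gt0.
move=> H x hH; have H0 : 0 < H by exact: lt_le_trans hH.
pose j := H^-1; have j0 : 0 < j by rewrite invr_gt0.
have jK : 10 * (1 + j) ^+ 2 <= K.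
  rewrite ler_pM2l // lerXn2r ?nnegrE ?addr_ge0 ?invr_ge0 ?(ltW h0) ?(ltW H0) //.
  by rewrite lerD2l lef_pV2.
pose z := x ^+ 2 / (2 * H); have z0 : 0 <= z by rewrite divr_ge0 ?sqr_ge0 ?mulr_ge0 ?ltW.
have ub : heatk H x * (1 + z + z ^+ 2) <= 6 * c0.
  rewrite /heatk expRD -/z mulrAC ler_pM ?mulr_ge0 ?expR_ge0 ?addr_ge0 ?sqr_ge0 //.
    exact: exp_poly_le.
  have : ln h <= ln H by rewrite ler_ln ?posrE.
  by rewrite ler_expR; lra.
have key (q : R) : `|q| <= 10 * (1 + j) ^+ 2 * (1 + z + z ^+ 2) ->
    `|q * heatk H x| <= K * (6 * c0).
  move=> qP; rewrite normrM (ger0_norm (heatk_ge0 _ _)).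
  apply: (@le_trans _ _ (10 * (1 + j) ^+ 2 * (1 + z + z ^+ 2) * heatk H x)).
    by rewrite ler_wpM2r ?heatk_ge0.
  rewrite -mulrA (mulrC (1 + _ + _)) ler_pM ?mulr_ge0 ?heatk_ge0 ?addr_ge0 ?sqr_ge0 ?(ltW j0) //.
have jz0 : 0 <= j * z by rewrite mulr_ge0 // ltW.
have m1 : 0 <= j * z ^+ 2 by rewrite mulr_ge0 ?sqr_ge0 // ltW.
have m2 : 0 <= j ^+ 2 * z by rewrite mulr_ge0 ?sqr_ge0.
have m3 : 0 <= j ^+ 2 * z ^+ 2 by rewrite mulr_ge0 ?sqr_ge0.
have m4 : 0 <= j ^+ 2 by rewrite sqr_ge0.
have m5 : 0 <= z ^+ 2 by rewrite sqr_ge0.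
have xj2 : (x * j) ^+ 2 = 2 * (j * z) by rewrite /j /z; field; rewrite gt_eqF.
(* The odd derivatives carry one factor [x * j], which is not a polynomial in [z]; it is traded for
   its square. *)
have xj : `|x * j| <= (1 + 2 * (j * z)) / 2.
  by rewrite -xj2 -(real_normK (num_real (x * j))); have := sqr_ge0 (`|x * j| - 1); lra.
split.
- by rewrite -[heatk H x]mul1r; apply: key; rewrite normr1; lra.
- by apply: key; rewrite normrN; apply: le_trans xj _; lra.
- apply: key; rewrite (_ : _ - _ = 2 * (j * z) - j); last first.
    by rewrite /j /z; field; rewrite gt_eqF.
  by rewrite ler_norml; apply/andP; split; lra.
- apply: key; rewrite (_ : _ - _ = x * j * (3 * j - 2 * (j * z))); last first.
    by rewrite /j /z; field; rewrite gt_eqF.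
  rewrite normrM; apply: (@le_trans _ _ ((1 + 2 * (j * z)) / 2 * (3 * j + 2 * (j * z)))).
    by apply: ler_pM => //; rewrite ler_norml; apply/andP; split; lra.
  lra.
- apply: key; rewrite [X in `|X|](_ : _ = (j * z - j / 2) ^+ 2 - 2 * (j ^+ 2 * z) + j ^+ 2 / 2); last first.
    by rewrite /j /z; field; rewrite gt_eqF.
  by rewrite ler_norml; apply/andP; split; lra.
Qed.

(** The functions [F2], [F1], [F0] vanish at 0 and each is the derivative of the next, so the bound
    on [heatk3] gains three powers of [b]. *)
Lemma heatk_taylor_x (h C : R) : 0 < h -> (forall H x, h <= H -> `|heatk3 H x| <= C) ->
  forall H x b, h <= H ->
  `|heatk H (x + b) - heatk H x - b * heatk1 H x - b ^+ 2 / 2 * heatk2 H x|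
     <= C * `|b| ^+ 3.
Proof.
move=> h0 bC H x b hH; have H0 : 0 < H by exact: lt_le_trans hH.
have ds t : is_derive t 1 (fun b => x + b) 1.
  by have := is_deriveD (is_derive_cst x t 1) (is_derive_id t 1); rewrite add0r.
have d0 t : is_derive t 1 (fun b => heatk H (x + b)) (heatk1 H (x + t)).
  have := is_derive_heatk_x (x + t) H0 => d; apply: is_derive_eq; exact: mulr1.
have d1 t : is_derive t 1 (fun b => heatk1 H (x + b)) (heatk2 H (x + t)).
  have := is_derive_heatk1_x (x + t) H0 => d; apply: is_derive_eq; exact: mulr1.
have d2 t : is_derive t 1 (fun b => heatk2 H (x + b)) (heatk3 H (x + t)).
  have := is_derive_heatk2_x (x + t) H0 => d; apply: is_derive_eq; exact: mulr1.
pose F2 b := heatk2 H (x + b) - heatk2 H x.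
pose F1 b := heatk1 H (x + b) - heatk1 H x - b * heatk2 H x.
pose F0 b := heatk H (x + b) - heatk H x - b * heatk1 H x - b ^+ 2 / 2 * heatk2 H x.
have F2b t : `|F2 t| <= C * `|t| ^+ 1.
  apply: (@derive_growth F2 (fun t => heatk3 H (x + t))).
  - by rewrite /F2 addr0 subrr.
  - by move=> u; rewrite /F2; apply: is_derive_eq; rewrite subr0.
  - by move=> u; rewrite expr0 mulr1; exact: bC.
have F1b t : `|F1 t| <= C * `|t| ^+ 2.
  apply: (@derive_growth F1 F2) => //.
  - by rewrite /F1 addr0 subrr mul0r subr0.
  - by move=> u; rewrite /F1 /F2; apply: is_derive_eq; rewrite /GRing.scale /=; ring.
apply: (@derive_growth F0 F1) => //.
- by rewrite /F0 addr0 subrr expr0n /= !mul0r !subr0.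
- by move=> u; rewrite /F0 /F1; apply: is_derive_eq; rewrite /GRing.scale /=; field.
Qed.

(** The linear term [c / 2 * heatk2] equals the mean quadratic term of the expansion in [x] for a
    displacement of mean square [c]; the exchange of a block for a Gaussian rests on this
    cancellation. *)
Lemma heatk_taylor_H (h C : R) : 0 < h -> (forall H x, h <= H -> `|heatkHH H x| <= C) ->
  forall H x c, h <= H -> 0 <= c ->
  `|heatk (H + c) x - heatk H x - c / 2 * heatk2 H x| <= C * c ^+ 2.
Proof.
move=> h0 bC H x c hH c0; have H0 : 0 < H by exact: lt_le_trans hH.
have ds t : is_derive t 1 (fun b => H + b) 1.
  by have := is_deriveD (is_derive_cst H t 1) (is_derive_id t 1); rewrite add0r.
have d0 t : 0 <= t ->
    is_derive t 1 (fun c => heatk (H + c) x) (heatk2 (H + t) x / 2).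
  move=> t0; have Ht : 0 < H + t by rewrite ltr_wpDr.
  have := @is_derive1_comp R (fun H => heatk H x) (fun c => H + c) t _ _
    (is_derive_heatk_H x Ht) (ds t).
  by rewrite mulr1.
have d2 t : 0 <= t ->
    is_derive t 1 (fun c => heatk2 (H + c) x) (2 * heatkHH (H + t) x).
  move=> t0; have Ht : 0 < H + t by rewrite ltr_wpDr.
  have := @is_derive1_comp R (fun H => heatk2 H x) (fun c => H + c) t _ _
    (is_derive_heatk2_H x Ht) (ds t).
  by rewrite mulr1.
pose F1 c := heatk2 (H + c) x / 2 - heatk2 H x / 2.
pose F0 c := heatk (H + c) x - heatk H x - c / 2 * heatk2 H x.
have F1b t : 0 <= t -> `|F1 t| <= C * t ^+ 1.
  apply: (@derive_growth_pos F1 (fun t => heatkHH (H + t) x)).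
  - by rewrite /F1 addr0 subrr.
  - by move=> u /d2 d; rewrite /F1; apply: is_derive_eq; rewrite /GRing.scale /=; field.
  - by move=> u u0; rewrite expr0 mulr1; apply: bC; rewrite ler_wpDr.
apply: (@derive_growth_pos F0 F1 C 1 _ _ F1b c c0).
- by rewrite /F0 addr0 subrr !mul0r subr0.
- by move=> u /d0 d; rewrite /F0 /F1; apply: is_derive_eq; rewrite /GRing.scale /=; field.
Qed.

Lemma heatk_lip_x (h C : R) : 0 < h -> (forall H x, h <= H -> `|heatk1 H x| <= C) ->
  forall H x y, h <= H -> `|heatk H x - heatk H y| <= C * `|x - y|.
Proof.
move=> h0 bC H x y hH; have H0 : 0 < H by exact: lt_le_trans hH.
have ds t : is_derive t 1 (fun b => y + b) 1.
  by have := is_deriveD (is_derive_cst y t 1) (is_derive_id t 1); rewrite add0r.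
rewrite -{1}(subrK y x) (addrC _ y).
apply: (@derive_growth (fun b => heatk H (y + b) - heatk H y) (fun b => heatk1 H (y + b)) _ 0).
- by rewrite addr0 subrr.
- move=> t; have d := is_derive_heatk_x (y + t) H0; apply: is_derive_eq.
  by rewrite /GRing.scale /= mulr1 subr0.
- by move=> t; rewrite expr0 mulr1; apply: bC.
Qed.

(** Compares the variance accumulated by the blocks with the limit variance. *)
Lemma heatk_lip_H (h C : R) : 0 < h -> (forall H x, h <= H -> `|heatk2 H x| <= C) ->
  forall H H' x, h <= H -> h <= H' -> `|heatk H x - heatk H' x| <= C * `|H - H'|.
Proof.
move=> h0 bC.
have C0 : 0 <= C by apply: le_trans (normr_ge0 _) (bC h 0 (lexx _)).
have key H c x : h <= H -> 0 <= c -> `|heatk (H + c) x - heatk H x| <= C * c.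
  move=> hH c0; have H0 : 0 < H by exact: lt_le_trans hH.
  have ds t : is_derive t 1 (fun b => H + b) 1.
    by have := is_deriveD (is_derive_cst H t 1) (is_derive_id t 1); rewrite add0r.
  apply: (@derive_growth_pos (fun c => heatk (H + c) x - heatk H x)
            (fun c => heatk2 (H + c) x / 2) C 0 _ _ _ c c0).
  - by rewrite addr0 subrr.
  - move=> t t0; have Ht : 0 < H + t by rewrite ltr_wpDr.
    have d := @is_derive1_comp R (fun H => heatk H x) (fun c => H + c) t _ _
      (is_derive_heatk_H x Ht) (ds t).
    by have := is_deriveB d (is_derive_cst (heatk H x) t 1); rewrite mulr1 subr0.
  - move=> t t0; rewrite expr0 mulr1 normrM normfV (ger0_norm (_ : 0 <= 2)) //.
    by have := bC (H + t) x; rewrite ler_wpDr // => /(_ isT); lra.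
move=> H H' x hH hH'; have [HH|HH] := leP H H'.
  rewrite distrC (distrC H) -{1}(subrK H H') (addrC (H' - H)).
  by rewrite (@ger0_norm _ (H' - H)) ?subr_ge0 // key ?subr_ge0.
rewrite -{1}(subrK H' H) (addrC (H - H')) (@ger0_norm _ (H - H')) ?subr_ge0 ?(ltW HH) //.
by rewrite key // subr_ge0 (ltW HH).
Qed.
End HeatTaylor.

(** * Block argument for mixing arrays *)

Section FiniteExpectation.
Variables (R : realType) (T : finType) (p : T -> R).
Implicit Types f g : T -> R.

Definition Ex f : R := \sum_t p t * f t.

Lemma eq_Ex f g : f =1 g -> Ex f = Ex g.
Proof. by move=> fg; apply: eq_bigr => t _; rewrite fg. Qed.

Lemma ExD f g : Ex (fun t => f t + g t) = Ex f + Ex g.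
Proof. by rewrite /Ex -big_split; apply: eq_bigr => t _; rewrite mulrDr. Qed.

Lemma ExB f g : Ex (fun t => f t - g t) = Ex f - Ex g.
Proof. by rewrite /Ex -sumrB; apply: eq_bigr => t _; rewrite mulrBr. Qed.

Lemma ExZ k f : Ex (fun t => k * f t) = k * Ex f.
Proof. by rewrite /Ex mulr_sumr; apply: eq_bigr => t _; rewrite mulrCA. Qed.

Lemma Ex_sum (I : Type) (r : seq I) (P : pred I) (F : I -> T -> R) :
  Ex (fun t => \sum_(i <- r | P i) F i t) = \sum_(i <- r | P i) Ex (F i).
Proof.
rewrite /Ex exchange_big /=; apply: eq_bigr => t _; exact: mulr_sumr.
Qed.

Hypothesis p_ge0 : forall t, 0 <= p t.
Hypothesis p_sum1 : \sum_t p t = 1.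

Lemma Ex_cst c : Ex (fun=> c) = c.
Proof. by rewrite /Ex -mulr_suml p_sum1 mul1r. Qed.

Lemma Ex_ge0 f : (forall t, 0 <= f t) -> 0 <= Ex f.
Proof. by move=> f0; apply: sumr_ge0 => t _; rewrite mulr_ge0. Qed.

Lemma le_norm_Ex f g : (forall t, `|f t| <= g t) -> `|Ex f| <= Ex g.
Proof.
move=> fg; apply: le_trans (ler_norm_sum _ _ _) _; apply: ler_sum => t _.
by rewrite normrM ger0_norm // ler_wpM2l.
Qed.
End FiniteExpectation.

Lemma big_blockS (V : nmodType) (F : nat -> V) (q b i : nat) :
  \sum_(j < i.+1 * (q + b) | (q <= j %% (q + b))%N) F j =
  \sum_(j < i * (q + b) | (q <= j %% (q + b))%N) F j +
  \sum_(r < b) F (i * (q + b) + q + r)%N.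
Proof.
rewrite mulSn addnC big_mkcond big_split_ord /= -big_mkcond /=; congr (_ + _).
rewrite big_split_ord /= big1 ?add0r.
  apply: eq_bigr => r _; rewrite addnA.
  by rewrite -addnA modnMDl modn_small ?leq_addr // ltn_add2l.
move=> r _; have rq := ltn_ord r.
have rl : (r < q + b)%N by rewrite ltn_addr.
by rewrite modnMDl (modn_small rl) leqNgt rq.
Qed.

Section Blocks.
Variables (R : realType) (T : finType) (p : T -> R) (n : nat) (X : nat -> T -> R).
Variables (a c A : nat -> R).
Hypothesis p_ge0 : forall t, 0 <= p t.
Hypothesis p_sum1 : \sum_t p t = 1.
Hypothesis X_le1 : forall j t, (j < n)%N -> `|X j t| <= 1.
Hypothesis cov_X : forall i j, (i < n)%N -> (j < n)%N ->
  Ex p (fun t => X i t * X j t) = c ((i - j) + (j - i)).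
Hypothesis a_ge0 : forall k, 0 <= a k.
Hypothesis c_le_a : forall k, `|c k| <= a k.
Hypothesis tail_a : forall q N, \sum_(r < N) a (q + r)%N <= A q.
(** The past enters through a bounded function of a partial sum over selected indices: a derivative
    of a bump, taken at the sum of the earlier blocks, has this form. *)
Hypothesis mix1 : forall (phi : R -> R) (M : R) (J : pred nat) k q j,
  (forall x, `|phi x| <= M) -> (k + q <= j)%N -> (j < n)%N ->
  `|Ex p (fun t => phi (\sum_(i < k | J i) X i t) * X j t)| <= M * a q.
Hypothesis mix2 : forall (phi : R -> R) (M : R) (J : pred nat) k q j j',
  (forall x, `|phi x| <= M) -> (k + q <= j)%N -> (k + q <= j')%N ->
  (j < n)%N -> (j' < n)%N ->
  `|Ex p (fun t => phi (\sum_(i < k | J i) X i t) *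
      (X j t * X j' t - c ((j - j') + (j' - j))))| <= M * a q.

Let B := A 0%N.

Lemma A_ge0 q : 0 <= A q.
Proof. by have := tail_a q 0; rewrite big_ord0. Qed.

(** In truncated subtraction [(i - j) + (j - i)] is the distance of [i] and [j]. The indices on
    either side of [i] contribute one [B] each. *)
Lemma sum_dist_le (i N : nat) : \sum_(j < N) a ((i - j) + (j - i)) <= 2 * B.
Proof.
apply: (@le_trans _ _ (\sum_(0 <= j < i + N) a ((i - j) + (j - i)))).
  rewrite big_mkord addnC big_split_ord /= -[leLHS]addr0 lerD //.
  exact: sumr_ge0.
rewrite (big_cat_nat _ (n := i)) //= ?leq_addr // mulr2n mulrDl !mul1r lerD //.
  rewrite big_nat_rev /= add0n big_mkord.
  apply: le_trans (tail_a 0 i.+1); rewrite [leRHS]big_ord_recl /= -[leLHS]add0r lerD //.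
  apply: ler_sum => j _; rewrite le_eqVlt; apply/orP; left; apply/eqP; congr a.
  by rewrite /bump /=; have := ltn_ord j; lia.
rewrite -{1}(add0n i) big_addn addKn big_mkord; apply: le_trans (tail_a 0 N).
by apply: ler_sum => j _; rewrite le_eqVlt; apply/orP; left; apply/eqP; congr a; lia.
Qed.

(** Bounded row sums of the covariance make the second moment linear in the number of selected
    indices, which is why the discarded gaps are negligible. *)
Lemma var_sum_le (K : pred nat) :
  Ex p (fun t => (\sum_(j < n | K j) X j t) ^+ 2) <= #|[pred j : 'I_n | K j]|%:R * (2 * B).
Proof.
under eq_Ex do rewrite expr2 big_distrlr /=.
rewrite Ex_sum; under eq_bigr do rewrite Ex_sum.
rewrite -sum1_card natr_sum mulr_suml; apply: ler_sum => i _; rewrite mul1r.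
apply: le_trans (sum_dist_le i n); rewrite [leRHS](bigID (fun j : 'I_n => K j)) /=.
rewrite -[leLHS]addr0 lerD ?sumr_ge0 //; apply: ler_sum => j _.
by rewrite cov_X //; apply: le_trans (ler_norm _) (c_le_a _).
Qed.

(* Indices are cut into blocks of length [q + b]; the first [q] indices of a
   block are a discarded gap, and [J] selects the others. *)
Variables (q b : nat).
Hypothesis b_gt0 : (0 < b)%N.
Let l := (q + b)%N.
Let J : pred nat := fun i => (q <= i %% l)%N.

Definition blockvar : R := \sum_(r < b) \sum_(r' < b) c ((r - r') + (r' - r)).
Definition block i t : R := \sum_(r < b) X (i * l + q + r) t.
Definition bsum i t : R := \sum_(j < i * l | J j) X j t.

Lemma bsum0 t : bsum 0 t = 0.
Proof. by rewrite /bsum mul0n big_ord0. Qed.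

Lemma bsumS i t : bsum i.+1 t = bsum i t + block i t.
Proof. exact: (big_blockS (fun j => X j t)). Qed.

Lemma block_le i t : (i.+1 * l <= n)%N -> `|block i t| <= b%:R.
Proof.
move=> il; apply: le_trans (ler_norm_sum _ _ _) _.
apply: (@le_trans _ _ (\sum_(r < b) 1)); last by rewrite sumr_const card_ord.
by apply: ler_sum => r _; apply: X_le1; have := ltn_ord r; rewrite /l in il *; lia.
Qed.

Lemma var_block i : (i.+1 * l <= n)%N -> Ex p (fun t => block i t ^+ 2) = blockvar.
Proof.
move=> il; under eq_Ex do rewrite expr2 big_distrlr /=.
rewrite Ex_sum; apply: eq_bigr => r _; rewrite Ex_sum; apply: eq_bigr => r' _.
have rb := ltn_ord r; have rb' := ltn_ord r'.
by rewrite cov_X ?subnDl //; rewrite /l in il *; lia.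
Qed.

Lemma blockvar_le : `|blockvar| <= b%:R * (2 * B).
Proof.
apply: le_trans (ler_norm_sum _ _ _) _.
rewrite -[b in b%:R]card_ord -sum1_card natr_sum mulr_suml; apply: ler_sum => r _.
rewrite mul1r; apply: le_trans (sum_dist_le r b).
by apply: le_trans (ler_norm_sum _ _ _) _; apply: ler_sum.
Qed.

Variables (h C y s : R).
Hypothesis h_gt0 : 0 < h.
Hypothesis heatC : forall H x, h <= H ->
  [/\ `|heatk H x| <= C, `|heatk1 H x| <= C, `|heatk2 H x| <= C,
      `|heatk3 H x| <= C & `|heatkHH H x| <= C].
Hypothesis s_ge0 : 0 <= s.

Lemma heatC_ge0 : 0 <= C.
Proof. by have [+ _ _ _ _] := heatC 0 (lexx h); apply: le_trans. Qed.

Lemma mix_block (phi : R -> R) i : (forall x, `|phi x| <= C) -> (i.+1 * l <= n)%N ->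
  `|Ex p (fun t => phi (bsum i t) * block i t)| <= C * A q.
Proof.
move=> phiC il; under eq_Ex do rewrite /block mulr_sumr.
rewrite Ex_sum; apply: le_trans (ler_norm_sum _ _ _) _.
apply: le_trans (_ : \sum_(r < b) C * a (q + r)%N <= _); last first.
  by rewrite -mulr_sumr ler_wpM2l ?heatC_ge0.
apply: ler_sum => r _; have rb := ltn_ord r.
by apply: mix1 => //; rewrite /l in il *; lia.
Qed.

(** A pair of indices decouples at the rate of the one nearer to the gap. The rate at the smaller of
    [r] and [r'] is bounded by the sum of the two rates, which leaves one index free in each sum:
    twice [b * A q]. *)
Lemma mix_block2 (phi : R -> R) i : (forall x, `|phi x| <= C) -> (i.+1 * l <= n)%N ->
  `|Ex p (fun t => phi (bsum i t) * (block i t ^+ 2 - blockvar))|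
     <= 2 * C * b%:R * A q.
Proof.
move=> phiC il.
have -> : Ex p (fun t => phi (bsum i t) * (block i t ^+ 2 - blockvar)) =
  \sum_(r < b) \sum_(r' < b) Ex p (fun t => phi (bsum i t) *
     (X (i * l + q + r) t * X (i * l + q + r') t - c ((r - r') + (r' - r)))).
  under eq_Ex do rewrite expr2 /blockvar big_distrlr /= -sumrB mulr_sumr.
  rewrite Ex_sum; apply: eq_bigr => r _; rewrite -Ex_sum; apply: eq_Ex => t.
  by rewrite -sumrB mulr_sumr.
apply: le_trans (ler_norm_sum _ _ _) _.
apply: le_trans (_ : \sum_(r < b) (b%:R * (C * a (q + r)%N) + C * A q) <= _); last first.
  rewrite big_split /= sumr_const card_ord -mulr_natl -mulr_sumr -mulr_sumr.
  have : C * \sum_(r < b) a (q + r)%N <= C * A q by rewrite ler_wpM2l ?heatC_ge0.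
  by move=> /(ler_wpM2l (ler0n R b)); lra.
apply: ler_sum => r _; have rb := ltn_ord r.
apply: le_trans (ler_norm_sum _ _ _) _.
apply: le_trans (_ : \sum_(r' < b) (C * a (q + r)%N + C * a (q + r')%N) <= _); last first.
  rewrite big_split /= sumr_const card_ord -[_ *+ b]mulr_natl -mulr_sumr lerD //.
  by apply: ler_wpM2l; [exact: heatC_ge0|exact: tail_a].
apply: ler_sum => r' _; have rb' := ltn_ord r'.
have C0 := heatC_ge0.
have [rr|rr] := leqP r r'.
  apply: (@le_trans _ _ (C * a (q + r)%N)); last by rewrite lerDl mulr_ge0.
  rewrite -(subnDl (i * l + q) r r') -(subnDl (i * l + q) r' r).
  by apply: mix2 => //; rewrite /l in il *; lia.
apply: (@le_trans _ _ (C * a (q + r')%N)); last by rewrite lerDr mulr_ge0.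
rewrite -(subnDl (i * l + q) r r') -(subnDl (i * l + q) r' r).
by apply: mix2 => //; rewrite /l in il *; lia.
Qed.

Let tau := blockvar * s ^+ 2.

(* Replacing the last block by an independent Gaussian of variance [tau] turns
   [heatk H] into [heatk (H + tau)]. *)
Lemma lindeberg_step i H : (i.+1 * l <= n)%N -> h <= H ->
  `|Ex p (fun t => heatk H (bsum i.+1 t * s - y)) -
    Ex p (fun t => heatk (H + tau) (bsum i t * s - y))|
  <= C * (b%:R * s * tau + s * A q + s ^+ 2 * b%:R * A q + tau ^+ 2).
Proof.
move=> il hH.
have C0 := heatC_ge0.
have V0 : 0 <= blockvar by rewrite -(var_block il); apply: Ex_ge0 => // t; exact: sqr_ge0.
have tau0 : 0 <= tau by rewrite mulr_ge0 ?sqr_ge0.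
pose x t := bsum i t * s - y; pose bb t := block i t * s.
pose R1 t := heatk H (x t + bb t) - heatk H (x t) - bb t * heatk1 H (x t)
   - bb t ^+ 2 / 2 * heatk2 H (x t).
pose R2 t := heatk (H + tau) (x t) - heatk H (x t) - tau / 2 * heatk2 H (x t).
pose f1 z := heatk1 H (z * s - y); pose f2 z := heatk2 H (z * s - y).
rewrite -ExB.
(* Exact rearrangement: beside the Taylor remainders [R1] and [R2] there remain terms linear in the
   block or in its centred square, and both correlate weakly with functions of the past. *)
have -> : Ex p (fun t => heatk H (bsum i.+1 t * s - y) - heatk (H + tau) (bsum i t * s - y))
   = Ex p (fun t => R1 t + s * (f1 (bsum i t) * block i t) +
      s ^+ 2 / 2 * (f2 (bsum i t) * (block i t ^+ 2 - blockvar)) - R2 t).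
  apply: eq_Ex => t; rewrite bsumS.
  rewrite (_ : (bsum i t + block i t) * s - y = x t + bb t); last by rewrite /x /bb; ring.
  by rewrite /R1 /R2 /f1 /f2 -/(x t) /bb /tau; field.
rewrite ExB 2!ExD !ExZ.
(* One factor of the cube is bounded by [b]; the remaining square has mean [blockvar], hence
   [tau]. *)
have E1 : `|Ex p R1| <= C * (b%:R * s * tau).
  have -> : C * (b%:R * s * tau) = Ex p (fun t => C * (b%:R * s) * s ^+ 2 * block i t ^+ 2).
    by rewrite ExZ (var_block il) /tau; ring.
  apply: le_norm_Ex => // t.
  have h3 H' x' : h <= H' -> `|heatk3 H' x'| <= C by move=> /(heatC x') [].
  apply: le_trans (heatk_taylor_x h_gt0 h3 (x t) (bb t) hH) _.
  rewrite -!mulrA ler_wpM2l // -(real_normK (num_real (block i t))) exprS normrM.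
  rewrite (ger0_norm s_ge0) exprMn.
  have : `|block i t| * (s ^+ 3 * `|block i t| ^+ 2) <= b%:R * (s ^+ 3 * `|block i t| ^+ 2).
    by rewrite ler_wpM2r ?mulr_ge0 ?exprn_ge0 // block_le.
  by rewrite !exprS !expr0; lra.
have E2 : `|Ex p R2| <= C * tau ^+ 2.
  rewrite -(Ex_cst p_sum1 (C * tau ^+ 2)); apply: le_norm_Ex => // t.
  have h3 H' x' : h <= H' -> `|heatkHH H' x'| <= C by move=> /(heatC x') [].
  exact: (heatk_taylor_H h_gt0 h3).
have E3 : `|s * Ex p (fun t => f1 (bsum i t) * block i t)| <= s * (C * A q).
  rewrite normrM (ger0_norm s_ge0) ler_wpM2l //; apply: mix_block => // z.
  by have [] := heatC (z * s - y) hH.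
have E4 : `|s ^+ 2 / 2 * Ex p (fun t => f2 (bsum i t) * (block i t ^+ 2 - blockvar))|
   <= s ^+ 2 / 2 * (2 * C * b%:R * A q).
  rewrite normrM ger0_norm ?divr_ge0 ?sqr_ge0 // ler_wpM2l ?divr_ge0 ?sqr_ge0 //.
  apply: mix_block2 => // z; by have [] := heatC (z * s - y) hH.
apply: le_trans (ler_normB _ _) _.
apply: le_trans (lerD (le_trans (ler_normD _ _) (lerD (ler_normD _ _) (lexx _))) (lexx _)) _.
by move: E1 E2 E3 E4; lra.
Qed.

(** Telescoping between [k] true blocks and none, where each block removed adds [tau] to the
    variance; with no block left the expectation is the value of a single bump. *)
Lemma lindeberg_sum k : (k * l <= n)%N ->
  `|Ex p (fun t => heatk h (bsum k t * s - y)) - heatk (h + k%:R * tau) y|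
  <= k%:R * (C * (b%:R * s * tau + s * A q + s ^+ 2 * b%:R * A q + tau ^+ 2)).
Proof.
set D := C * _ => kl.
case: (posnP k) => [->|k0].
  rewrite mul0r addr0 mul0r; under eq_Ex do rewrite bsum0 mul0r sub0r heatkN.
  by rewrite Ex_cst // subrr normr0.
have l1n : (1 * l <= n)%N by apply: leq_trans kl; rewrite leq_mul2r k0 orbT.
have V0 : 0 <= blockvar by rewrite -(var_block l1n); apply: Ex_ge0 => // t; exact: sqr_ge0.
have tau0 : 0 <= tau by rewrite mulr_ge0 ?sqr_ge0.
suff H i : (i <= k)%N -> `|Ex p (fun t => heatk (h + (k - i)%:R * tau) (bsum i t * s - y))
    - heatk (h + k%:R * tau) y| <= i%:R * D.
  by have := H k (leqnn k); rewrite subnn mul0r addr0.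
elim: i => [_|i IH ik].
  rewrite subn0 mul0r; under eq_Ex do rewrite bsum0 mul0r sub0r heatkN.
  by rewrite Ex_cst // subrr normr0.
have {IH} IH := IH (ltnW ik).
have ilb : (i.+1 * l <= n)%N by apply: leq_trans kl; rewrite leq_mul2r ik orbT.
have st := @lindeberg_step i (h + (k - i.+1)%:R * tau) ilb.
rewrite lerDl mulr_ge0 // in st; have {st} st := st isT.
move: IH; rewrite (_ : (k - i)%N = (k - i.+1).+1); last by lia.
rewrite -(natr1 (k - i.+1)) -(natr1 i) !mulrDl !mul1r [h + (_ + _)]addrA => IH.
by apply: le_trans (ler_distD _ _ _) _; rewrite [leRHS]addrC; apply: lerD; [exact: st|exact: IH].
Qed.

Lemma card_bsum i : \sum_(j < i * l | J j) (1 : R) = i%:R * b%:R.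
Proof.
elim: i => [|i IH]; first by rewrite mul0n big_ord0 mul0r.
rewrite (big_blockS (fun=> 1)) IH sumr_const card_ord -(natr1 i) mulrDl mul1r.
by [].
Qed.

(** The bump is Lipschitz and [|x| <= eta + x ^+ 2 / eta]. The second moment of the discarded
    indices, those in gaps and in the incomplete end alike, is linear in their number
    [n - k * b]. *)
Lemma gap_bound k eta : (k * l <= n)%N -> 0 < eta ->
  `|Ex p (fun t => heatk h ((\sum_(j < n) X j t) * s - y)) -
    Ex p (fun t => heatk h (bsum k t * s - y))|
  <= C * (eta + s ^+ 2 * (n%:R - k%:R * b%:R) * (2 * B) / eta).
Proof.
move=> kn eta0.
have C0 := heatC_ge0.
pose K : pred nat := fun j => ~~ (J j && (j < k * l)%N).
have bsumE (F : nat -> R) : \sum_(j < k * l | J j) F j =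
    \sum_(j < n | J j && (j < k * l)%N) F j.
  by rewrite (big_ord_widen_cond _ _ _ kn).
have DE t : \sum_(j < n) X j t = bsum k t + \sum_(j < n | K j) X j t.
  by rewrite (bigID (fun j : 'I_n => J j && (j < k * l)%N)) /= -(bsumE (X^~ t)).
have cardK : #|[pred j : 'I_n | K j]|%:R = n%:R - k%:R * b%:R :> R.
  have -> : n%:R = \sum_(j < n) (1 : R) by rewrite sumr_const card_ord.
  rewrite (bigID (fun j : 'I_n => J j && (j < k * l)%N)) /=.
  by rewrite -(bsumE (fun=> 1)) card_bsum addrAC subrr add0r -sum1_card natr_sum.
have vK := var_sum_le K; rewrite cardK in vK.
rewrite -ExB.
apply: le_trans (_ : Ex p (fun t => C * (eta + s ^+ 2 / eta *
    (\sum_(j < n | K j) X j t) ^+ 2)) <= _).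
  apply: le_norm_Ex => // t; rewrite DE.
  have h1 H' x' : h <= H' -> `|heatk1 H' x'| <= C by move=> /(heatC x') [].
  apply: le_trans (heatk_lip_x h_gt0 h1 _ _ (lexx h)) _.
  rewrite ler_wpM2l //; set d := \sum_(j < n | _) _.
  rewrite (_ : _ - _ = s * d); last by ring.
  have := sqr_ge0 (`|s * d| - eta); rewrite sqrrB (real_normK (num_real _)) => hh.
  rewrite (_ : s ^+ 2 / eta * d ^+ 2 = (s * d) ^+ 2 / eta); last by ring.
  rewrite -lerBlDl ler_pdivlMr //.
  by have := sqr_ge0 (s * d); have := sqr_ge0 eta; lra.
rewrite ExZ ExD Ex_cst // ExZ ler_wpM2l // lerD2l.
rewrite (_ : s ^+ 2 * _ * _ / _ = s ^+ 2 / eta * ((n%:R - k%:R * b%:R) * (2 * B))); last by ring.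
by rewrite ler_wpM2l ?divr_ge0 ?sqr_ge0 // ltW.
Qed.

(** [s] is [1 / sqrt n] and [G] bounds the discarded fraction of the indices. The number [k] of
    blocks disappears by [k * b * s ^+ 2 <= 1]. The first two errors come from the gaps, the next
    four from the exchange, the last two from replacing [k * tau] by [sig]. *)
Lemma block_clt_bound (sig eta G : R) : 0 < s -> n%:R * s ^+ 2 = 1 -> 0 < eta -> 0 <= sig ->
  G = q%:R / b%:R + s ^+ 2 * (q%:R + b%:R) ->
  `|Ex p (fun t => heatk h ((\sum_(j < n) X j t) * s - y)) - heatk (h + sig) y|
  <= C * (eta + 2 * B * G / eta + 2 * B * (b%:R * s) + A q / (b%:R * s) + A q +
          4 * B ^+ 2 * (b%:R * s ^+ 2) + `|blockvar / b%:R - sig| + sig * G).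
Proof.
move=> s0 ns eta0 sig0 GE.
have C0 := heatC_ge0; have B0 : 0 <= B by exact: A_ge0.
have l0 : (0 < l)%N by rewrite /l addn_gt0 b_gt0 orbT.
pose k := (n %/ l)%N.
have kn : (k * l <= n)%N by exact: leq_trunc_div.
have nk : (n <= k * l + l)%N by rewrite -mulSnr ltnW // ltn_ceil.
have b0 : 0 < b%:R :> R by rewrite ltr0n.
have s20 : 0 < s ^+ 2 by rewrite exprn_gt0.
have V0 : (0 < k)%N -> 0 <= blockvar.
  move=> k0; have l1n : (1 * l <= n)%N by apply: leq_trans kn; rewrite leq_mul2r k0 orbT.
  by rewrite -(var_block l1n); apply: Ex_ge0 => // t; exact: sqr_ge0.
have kbs : k%:R * b%:R * s ^+ 2 <= 1.
  rewrite -[leRHS]ns ler_wpM2r ?sqr_ge0 // -natrM ler_nat.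
  by apply: leq_trans kn; rewrite leq_mul2l /l leq_addl orbT.
have kbs0 : 0 <= k%:R * b%:R * s ^+ 2 by rewrite !mulr_ge0 // ltW.
have ks : k%:R * s ^+ 2 <= b%:R^-1.
  by rewrite -[leRHS]mul1r ler_pdivlMr // mulrAC.
have gap : s ^+ 2 * (n%:R - k%:R * b%:R) <= G.
  apply: (@le_trans _ _ (s ^+ 2 * (k%:R * q%:R + (q%:R + b%:R)))).
    rewrite ler_pM2l // lerBlDr -!natrM -!natrD ler_nat.
    by apply: leq_trans nk _; rewrite /l mulnDr addnAC.
  rewrite GE mulrDr lerD2r mulrA (mulrC (s ^+ 2)) (mulrC q%:R) ler_wpM2r //.
have gap0 : 0 <= s ^+ 2 * (n%:R - k%:R * b%:R).
  rewrite mulrBr [s ^+ 2 * _]mulrC ns; move: kbs; rewrite -mulrA; lra.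
have tauE : k%:R * tau = (k%:R * b%:R * s ^+ 2) * (blockvar / b%:R).
  by rewrite /tau; field; rewrite gt_eqF.
have E1 := gap_bound kn eta0.
have E2 := lindeberg_sum kn.
have htau : h <= h + k%:R * tau.
  rewrite lerDl; case: (posnP k) => [->|k0]; first by rewrite mul0r.
  by rewrite !mulr_ge0 ?sqr_ge0 // V0.
have E3 : `|heatk (h + k%:R * tau) y - heatk (h + sig) y| <= C * (`|blockvar / b%:R - sig| + sig * G).
  have h2 H' x' : h <= H' -> `|heatk2 H' x'| <= C by move=> /(heatC x') [].
  apply: le_trans (heatk_lip_H h_gt0 h2 _ htau (_ : h <= h + sig)) _; first by rewrite lerDl.
  rewrite ler_wpM2l // (_ : _ - _ = k%:R * b%:R * s ^+ 2 * (blockvar / b%:R - sig) -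
     sig * (s ^+ 2 * (n%:R - k%:R * b%:R))); last first.
    rewrite tauE (_ : s ^+ 2 * _ = n%:R * s ^+ 2 - k%:R * b%:R * s ^+ 2); last by ring.
    by rewrite ns; ring.
  apply: le_trans (ler_normB _ _) _; apply: lerD.
    by rewrite normrM (ger0_norm kbs0) ler_piMl.
  by rewrite normrM !ger0_norm // ler_wpM2l.
have T1 : k%:R * (b%:R * s * tau) <= 2 * B * (b%:R * s).
  have : k%:R * tau <= 2 * B.
    rewrite tauE -[leRHS]mul1r; apply: le_trans (_ : _ <= 1 * `|blockvar / b%:R|) _.
      apply: le_trans (_ : _ <= k%:R * b%:R * s ^+ 2 * `|blockvar / b%:R|) _.
        by rewrite ler_wpM2l // ler_norm.
      by rewrite ler_wpM2r.
    rewrite !mul1r normrM normfV (ger0_norm (ltW b0)) ler_pdivrMr // mulrC.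
    exact: blockvar_le.
  by move=> hh; rewrite mulrCA [leRHS]mulrC ler_wpM2l // mulr_ge0 // ltW.
have T2 : k%:R * (s * A q) <= A q / (b%:R * s).
  rewrite ler_pdivlMr ?mulr_gt0 // [leLHS](_ : _ = A q * (k%:R * b%:R * s ^+ 2)); last by ring.
  by rewrite ler_piMr // A_ge0.
have T3 : k%:R * (s ^+ 2 * b%:R * A q) <= A q.
  rewrite [leLHS](_ : _ = A q * (k%:R * b%:R * s ^+ 2)); last by ring.
  by rewrite ler_piMr // A_ge0.
have T4 : k%:R * tau ^+ 2 <= 4 * B ^+ 2 * (b%:R * s ^+ 2).
  have tb : `|tau| <= b%:R * (2 * B) * s ^+ 2.
    by rewrite /tau normrM (ger0_norm (ltW s20)) ler_wpM2r ?blockvar_le // ltW.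
  have : k%:R * `|tau| ^+ 2 <= k%:R * (b%:R * (2 * B) * s ^+ 2) ^+ 2.
    by rewrite ler_wpM2l // lerXn2r ?nnegrE // !mulr_ge0 // ltW.
  rewrite (real_normK (num_real _)) => /le_trans; apply.
  rewrite [leLHS](_ : _ = (k%:R * b%:R * s ^+ 2) * (4 * B ^+ 2 * (b%:R * s ^+ 2))); last by ring.
  by rewrite ler_piMl // !mulr_ge0 ?sqr_ge0 // ltW.
have T5 : s ^+ 2 * (n%:R - k%:R * b%:R) * (2 * B) / eta <= 2 * B * G / eta.
  by rewrite ler_wpM2r ?invr_ge0 ?(ltW eta0) // mulrC ler_wpM2l ?mulr_ge0.
apply: le_trans (ler_distD (Ex p (fun t => heatk h (bsum k t * s - y))) _ _) _.
apply: le_trans (lerD (le_trans E1 (ler_wpM2l C0 (lerD (lexx eta) T5)))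
  (le_trans (ler_distD (heatk (h + k%:R * tau) y) _ _) (lerD E2 E3))) _.
have : C * (k%:R * (b%:R * s * tau) + k%:R * (s * A q) + k%:R * (s ^+ 2 * b%:R * A q) +
   k%:R * tau ^+ 2) <= C * (2 * B * (b%:R * s) + A q / (b%:R * s) + A q +
          4 * B ^+ 2 * (b%:R * s ^+ 2)).
  by rewrite ler_wpM2l // !lerD.
lra.
Qed.
End Blocks.

Lemma near_inv_sqrt (R : realType) (e : R) : 0 < e ->
  \forall n \near \oo, (0 < n)%N /\ (Num.sqrt n%:R)^-1 <= e.
Proof.
move=> e0; exists (Num.truncn (e ^- 2)).+1 => // n /= en.
have n0 : (0 < n)%N by apply: leq_trans en.
split=> //; rewrite -[leRHS]invrK lef_pV2 ?posrE ?sqrtr_gt0 ?invr_gt0 ?ltr0n //.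
rewrite -(ger0_norm (_ : 0 <= e^-1)) ?invr_ge0 ?(ltW e0) // -sqrtr_sqr ler_wsqrtr //.
rewrite exprVn; apply: le_trans (ltW (truncnS_gt _)) _.
by rewrite ler_nat.
Qed.

Section CovarianceSeries.
Variables (R : realType) (c : nat -> R).

Lemma blockvarS b : blockvar c b.+1 =
  blockvar c b + (c 0%N + 2 * series (fun k => c k.+1) b).
Proof.
rewrite /blockvar big_ord_recr /= big_ord_recr /= subnn addn0.
under eq_bigr do rewrite big_ord_recr /=.
rewrite big_split /= -!addrA; congr (_ + _).
have E : \sum_(i < b) c (b - i)%N = series (fun k => c k.+1) b.
  rewrite /series /= -(big_mkord xpredT (fun i => c (b - i)%N)) big_nat_rev /= !big_mkord.
  by apply: eq_bigr => i _; congr c; have := ltn_ord i; lia.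
rewrite (_ : \sum_(i < b) c (i - b + (b - i))%N = series (fun k => c k.+1) b); last first.
  by rewrite -E; apply: eq_bigr => i _; congr c; have := ltn_ord i; lia.
rewrite (_ : \sum_(i < b) c (b - i + (i - b))%N = series (fun k => c k.+1) b); last first.
  by rewrite -E; apply: eq_bigr => i _; congr c; have := ltn_ord i; lia.
ring.
Qed.

(** Enlarging a block by one index adds [c 0] and twice a partial sum of covariances, so the
    variance per index is a Cesaro mean of these increments. *)
Lemma blockvar_cvg (s : R) : series (fun k => c k.+1) @ \oo --> s ->
  (fun b => blockvar c b.+1 / b.+1%:R) @ \oo --> c 0%N + 2 * s.
Proof.
move=> cs.
have -> : (fun b => blockvar c b.+1 / b.+1%:R) =
    arithmetic_mean (fun b => c 0%N + 2 * series (fun k => c k.+1) b).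
  apply/funext => b; rewrite /arithmetic_mean /= mulrC; congr (_ * _).
  elim: b => [|b IH]; first by rewrite blockvarS /series /= big_nat1 /blockvar big_ord0 add0r.
  by rewrite blockvarS IH [in RHS]/series /= big_nat_recr.
apply: cesaro; apply: (@cvgD _ R^o); first exact: cvg_cst.
by apply: cvgM; [exact: cvg_cst|exact: cs].
Qed.
End CovarianceSeries.

(** * Mixing triangular arrays tested on Gaussian bumps *)

Section TriangularArray.
Variables (R : realType) (T : nat -> finType) (p : forall n, T n -> R).
Variables (X : forall n, nat -> T n -> R) (a c : nat -> R).
Hypothesis p_ge0 : forall n t, 0 <= @p n t.
Hypothesis p_sum1 : forall n, \sum_t @p n t = 1.
Hypothesis X_le1 : forall n j t, (j < n)%N -> `|@X n j t| <= 1.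
Hypothesis cov_X : forall n i j, (i < n)%N -> (j < n)%N ->
  Ex (@p n) (fun t => X i t * X j t) = c ((i - j) + (j - i))%N.
Hypothesis a_ge0 : forall k, 0 <= a k.
Hypothesis c_le_a : forall k, `|c k| <= a k.
Hypothesis cvg_a : cvgn (series a).
Hypothesis mix1 : forall n (phi : R -> R) (M : R) (J : pred nat) k q j,
  (forall x, `|phi x| <= M) -> (k + q <= j)%N -> (j < n)%N ->
  `|Ex (@p n) (fun t => phi (\sum_(i < k | J i) X i t) * X j t)| <= M * a q.
Hypothesis mix2 : forall n (phi : R -> R) (M : R) (J : pred nat) k q j j',
  (forall x, `|phi x| <= M) -> (k + q <= j)%N -> (k + q <= j')%N ->
  (j < n)%N -> (j' < n)%N ->
  `|Ex (@p n) (fun t => phi (\sum_(i < k | J i) X i t) *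
      (X j t * X j' t - c ((j - j') + (j' - j))%N))| <= M * a q.

Let A q : R := limn (series a) - series a q.

Lemma tail_le q N : \sum_(r < N) a (q + r)%N <= A q.
Proof.
rewrite /A lerBrDl; apply: le_trans (nondecreasing_cvgn_le _ cvg_a (q + N)).
  rewrite /series /= [leRHS](big_cat_nat _ (n := q)) ?leq_addr //= lerD2l.
  rewrite -[X in \sum_(X <= _ < _) _](add0n q) big_addn addKn big_mkord.
  by apply: ler_sum => r _; rewrite addnC.
by apply: nondecreasing_series => k _ _; exact: a_ge0.
Qed.

Lemma tail_ge0 q : 0 <= A q.
Proof. by have := tail_le q 0; rewrite big_ord0. Qed.

Lemma tail_cvg0 : A @ \oo --> (0 : R).
Proof.
rewrite -(subrr (limn (series a))); apply: (@cvgB _ R^o); first exact: cvg_cst.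
exact: cvg_a.
Qed.

Lemma cvg_cov_series : cvgn (series (fun k => c k.+1)).
Proof.
apply: normed_cvg; apply: (@series_le_cvg _ _ (fun k => a k.+1)).
- by move=> k /=.
- by move=> k /=.
- by move=> k /=.
apply: nondecreasing_is_cvgn; first exact: nondecreasing_series.
by exists (A 1%N) => _ [n _ <-]; rewrite /series /= big_mkord; exact: (tail_le 1 n).
Qed.

Let sig : R := c 0%N + 2 * limn (series (fun k => c k.+1)).

(** A limit of block variances per index, each the mean of a square. *)
Lemma cov_series_ge0 : 0 <= sig.
Proof.
have H := blockvar_cvg (cvg_cov_series : series _ @ \oo --> limn _).
have : 0 <= limn (fun b => blockvar c b.+1 / b.+1%:R).
  apply: limr_ge; first by apply/cvg_ex; eexists; exact: H.
  apply: nearW => b; rewrite divr_ge0 //.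
  rewrite -(@var_block _ _ (@p b.+1) b.+1 (@X b.+1) c (@cov_X _) 0 b.+1 (ltn0Sn _) 0).
    by apply: Ex_ge0 => // t; exact: sqr_ge0.
  by rewrite mul1n.
by rewrite (cvg_lim _ H).
Qed.

(** Order of choice: blocks of length about [dl * sqrt n], with [dl] small for the cubic remainder;
    then a fixed gap [q] with [A q / dl] small; the discarded fraction is then of order
    [1 / sqrt n]. There are eight errors, each at most [e' = e / (8 * C)]. *)
Theorem triangular_bumps (h y : R) : 0 < h ->
  (fun n => Ex (@p n) (fun t => heatk h ((\sum_(j < n) X j t) / Num.sqrt n%:R - y)))
    @ \oo --> heatk (h + sig) y.
Proof.
move=> h0; have [C C0 hC] := heatk_bounds h0.
have sig0 := cov_series_ge0.
apply/cvgrPdist_le => /= e e0.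
pose e' := e / (8 * C); have e'0 : 0 < e' by rewrite divr_gt0 // mulr_gt0.
pose B := A 0%N.
have B0 : 0 <= B by exact: tail_ge0.
pose dl := e' / (4 * B + 1); have dl0 : 0 < dl by rewrite divr_gt0 // ltr_wpDl // mulr_ge0.
have hdl : 2 * B * (2 * dl) <= e'.
  have -> : 2 * B * (2 * dl) = (4 * B) * e' / (4 * B + 1) by rewrite /dl; ring.
  rewrite ler_pdivrMr; last by rewrite ltr_wpDl // mulr_ge0.
  by rewrite mulrC ler_wpM2l ?(ltW e'0) // lerDl.
have [q [Aq1 Aq2]] : exists q, A q <= e' /\ A q / dl <= e'.
  have m0 : 0 < Num.min e' (e' * dl) by rewrite lt_min e'0 mulr_gt0.
  have /cvgrPdist_le /(_ _ m0) [q _ /(_ q (leqnn q)) /=] := tail_cvg0.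
  rewrite sub0r normrN => /(le_trans (ler_norm _)); rewrite le_min => /andP[? ?].
  by exists q; rewrite ler_pdivrMr.
pose b n := (Num.truncn (dl * Num.sqrt n%:R)).+1.
have [N0 _ HN0] : \forall b \near \oo, `|blockvar c b.+1 / b.+1%:R - sig| <= e'.
  have /cvgrPdist_le /(_ _ e'0) := blockvar_cvg (cvg_cov_series : series _ @ \oo --> limn _).
  by apply: filterS => n; rewrite distrC.
(* Chosen so that [G <= g0 * s]: its terms match those of [G] by [dl <= b n * s <= 2 * dl] and
   [s <= 1]. *)
pose g0 := q%:R / dl + q%:R + 2 * dl.
have g00 : 0 <= g0.
  apply: addr_ge0; last by apply: mulr_ge0 => //; exact: ltW.
  by apply: addr_ge0 => //; apply: divr_ge0 => //; exact: ltW.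
have small (K : R) : 0 <= K -> \forall n \near \oo, K * (Num.sqrt n%:R)^-1 <= e'.
  move=> K0; have K1 : 0 < K + 1 by rewrite ltr_wpDl.
  have := near_inv_sqrt (divr_gt0 e'0 K1).
  apply: filterS => n [_ ns]; apply: le_trans (ler_wpM2l K0 ns) _.
  by rewrite mulrA ler_pdivrMr // mulrC ler_wpM2l ?(ltW e'0) // lerDl.
have S1 := near_inv_sqrt (lt_le_trans ltr01 (lexx 1) : 0 < 1 :> R).
have S2 := near_inv_sqrt dl0.
have N1 : 0 < (N0.+1)%:R :> R by rewrite ltr0n.
have S3 := near_inv_sqrt (divr_gt0 dl0 N1).
have S4 := small (2 * B / e' * g0) (mulr_ge0 (divr_ge0 (mulr_ge0 (ler0n _ 2) B0) (ltW e'0)) g00).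
have S5 := small (sig * g0) (mulr_ge0 sig0 g00).
have S6 := small (4 * B ^+ 2 * (2 * dl)) (mulr_ge0 (mulr_ge0 (ler0n _ 4) (sqr_ge0 _)) (mulr_ge0 (ler0n _ 2) (ltW dl0))).
near=> n.
have [n0 s1] : (0 < n)%N /\ (Num.sqrt n%:R)^-1 <= (1 : R) by near: n.
have [_ s2] : (0 < n)%N /\ (Num.sqrt n%:R)^-1 <= dl by near: n.
have [_ s3] : (0 < n)%N /\ (Num.sqrt n%:R)^-1 <= dl / N0.+1%:R by near: n.
have s4 : 2 * B / e' * g0 * (Num.sqrt n%:R)^-1 <= e' by near: n.
have s5 : sig * g0 * (Num.sqrt n%:R)^-1 <= e' by near: n.
have s6 : 4 * B ^+ 2 * (2 * dl) * (Num.sqrt n%:R)^-1 <= e' by near: n.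
have sn0 : 0 < Num.sqrt n%:R :> R by rewrite sqrtr_gt0 ltr0n.
set s := (Num.sqrt n%:R)^-1 in s1 s2 s3 s4 s5 s6 *.
have s0 : 0 < s by rewrite invr_gt0.
have ns : n%:R * s ^+ 2 = 1 :> R.
  by rewrite /s exprVn sqr_sqrtr ?ler0n // divff // pnatr_eq0 -lt0n.
have bn0 : (0 < b n)%N by [].
have b0 : 0 < (b n)%:R :> R by rewrite ltr0n.
have u1 : dl <= (b n)%:R * s by rewrite ler_pdivlMr // ltW // truncnS_gt.
have u2 : (b n)%:R * s <= 2 * dl.
  rewrite /b -natr1 mulrDl mul1r.
  have : (Num.truncn (dl * Num.sqrt n%:R))%:R * s <= dl.
    by rewrite /s ler_pdivrMr // truncn_le // mulr_ge0 // ltW.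
  by move: s2; lra.
have bN : (N0 < b n)%N.
  rewrite -(ltr_nat R); apply: lt_le_trans (_ : dl / s <= _); last by rewrite ler_pdivrMr.
  apply: (@lt_le_trans _ _ N0.+1%:R); first by rewrite ltr_nat.
  by rewrite ler_pdivlMr // mulrC -ler_pdivlMr.
pose G := q%:R / (b n)%:R + s ^+ 2 * (q%:R + (b n)%:R) : R.
have := @block_clt_bound R (T n) (@p n) n (@X n) a c A (@p_ge0 n) (@p_sum1 n) (@X_le1 n)
  (@cov_X n) a_ge0 c_le_a tail_le (@mix1 n) (@mix2 n) q (b n) bn0 h C y s h0 hC (ltW s0)
  sig e' G s0 ns e'0 sig0 (erefl _).
move=> bound.
have GE : G <= g0 * s.
  have G1 : q%:R / (b n)%:R <= q%:R / dl * s.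
    rewrite ler_pdivrMr // -!mulrA ler_peMr // ler_pdivlMl //.
    by rewrite mulr1 mulrC.
  have G2 : s ^+ 2 * q%:R <= q%:R * s.
    by rewrite expr2 mulrC ler_wpM2l // ler_piMl // ltW.
  have G3 : s ^+ 2 * (b n)%:R <= 2 * dl * s.
    by rewrite expr2 -mulrA mulrC ler_wpM2r ?(ltW s0) // mulrC.
  rewrite /G /g0 (mulrDr (s ^+ 2)) !(mulrDl _ _ s) addrA.
  exact: lerD (lerD G1 G2) G3.
have G0 : 0 <= G.
  apply: addr_ge0; first exact: divr_ge0.
  by apply: mulr_ge0; [exact: sqr_ge0|exact: addr_ge0].
rewrite distrC; apply: le_trans bound _.
have -> : e = C * (8 * e') by rewrite /e'; field; rewrite gt_eqF.
rewrite ler_pM2l //.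
have t1 : 2 * A 0%N * G / e' <= e'.
  apply: le_trans s4; rewrite -/B mulrAC -[leRHS]mulrA ler_wpM2l //.
  by rewrite divr_ge0 ?(ltW e'0) // mulr_ge0.
have t2 : 2 * A 0%N * ((b n)%:R * s) <= e'.
  by apply: le_trans hdl; rewrite -/B ler_wpM2l // mulr_ge0.
have t3 : A q / ((b n)%:R * s) <= e'.
  apply: le_trans Aq2; apply: ler_wpM2l; first exact: tail_ge0.
  by rewrite lef_pV2 // posrE mulr_gt0.
have t4 : 4 * A 0%N ^+ 2 * ((b n)%:R * s ^+ 2) <= e'.
  apply: le_trans s6; rewrite -/B -[leRHS]mulrA ler_wpM2l ?mulr_ge0 ?sqr_ge0 //.
  by rewrite expr2 mulrA ler_wpM2r // ltW.
have t5 : `|blockvar c (b n) / (b n)%:R - sig| <= e' by exact: HN0.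
have t6 : sig * G <= e'.
  by apply: le_trans s5; rewrite -mulrA ler_wpM2l.
lra.
Unshelve. all: by end_near.
Qed.
End TriangularArray.

(** * Trace norm and entries *)

Section ComplexMatrices.
Variable R : realType.
Local Notation C := R[i].
Local Notation Re := (@complex.Re R).
Local Notation Im := (@complex.Im R).
Implicit Types (x y z : C).

Lemma cReD x y : Re (x + y) = Re x + Re y. Proof. by case: x y => [? ?] []. Qed.
Lemma cImD x y : Im (x + y) = Im x + Im y. Proof. by case: x y => [? ?] []. Qed.
Lemma cReN x : Re (- x) = - Re x. Proof. by case: x. Qed.
Lemma cImN x : Im (- x) = - Im x. Proof. by case: x. Qed.
Lemma cReM x y : Re (x * y) = Re x * Re y - Im x * Im y.
Proof. by case: x y => [? ?] []. Qed.
Lemma cImM x y : Im (x * y) = Re x * Im y + Im x * Re y.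
Proof. by case: x y => [? ?] []. Qed.
Lemma cRe_conj x : Re x^* = Re x. Proof. by case: x. Qed.
Lemma cIm_conj x : Im x^* = - Im x. Proof. by case: x. Qed.

Lemma cRe_sum (I : Type) (r : seq I) (P : pred I) (F : I -> C) :
  Re (\sum_(i <- r | P i) F i) = \sum_(i <- r | P i) Re (F i).
Proof. exact: (big_morph Re cReD). Qed.

Lemma cIm_sum (I : Type) (r : seq I) (P : pred I) (F : I -> C) :
  Im (\sum_(i <- r | P i) F i) = \sum_(i <- r | P i) Im (F i).
Proof. exact: (big_morph Im cImD). Qed.

Lemma ge0_ReIm z : 0 <= z -> 0 <= Re z /\ Im z = 0.
Proof. by rewrite lecE => /andP[/eqP -> ?]. Qed.

Lemma adjmxM m n k (A : 'M[C]_(m, n)) (B : 'M[C]_(n, k)) :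
  adjmx (A *m B) = adjmx B *m adjmx A.
Proof.
apply/matrixP => i j; rewrite !mxE rmorph_sum; apply: eq_bigr => l _.
by rewrite rmorphM mulrC !mxE.
Qed.

Lemma adjmxK m n (A : 'M[C]_(m, n)) : adjmx (adjmx A) = A.
Proof. by apply/matrixP => i j; rewrite !mxE conjCK. Qed.

Lemma adjmxD m n (A B : 'M[C]_(m, n)) : adjmx (A + B) = adjmx A + adjmx B.
Proof. by apply/matrixP => i j; rewrite !mxE rmorphD. Qed.

Lemma adjmxZ m n z (A : 'M[C]_(m, n)) : adjmx (z *: A) = z^* *: adjmx A.
Proof. by apply/matrixP => i j; rewrite !mxE rmorphM. Qed.

Lemma adjmx1 n : adjmx (1%:M : 'M[C]_n) = 1%:M.
Proof.
by apply/matrixP => i j; rewrite !mxE eq_sym; case: eqP => _; rewrite ?conjC1 ?conjC0.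
Qed.

Section Square.
Variable d : nat.
Implicit Types (Q X Z W : 'M[C]_d).

Lemma psdmx_sandwich W X : psdmx X -> psdmx (W *m X *m adjmx W).
Proof.
move=> X0 v; have := X0 (adjmx W *m v).
by rewrite adjmxM adjmxK !mulmxA.
Qed.

Lemma psdmxD X Z : psdmx X -> psdmx Z -> psdmx (X + Z).
Proof.
by move=> X0 Z0 v; rewrite mulmxDr mulmxDl mxE addr_ge0.
Qed.

Lemma psdmxZ z X : 0 <= z -> psdmx X -> psdmx (z *: X).
Proof.
by move=> z0 X0 v; rewrite -scalemxAr -scalemxAl mxE mulr_ge0.
Qed.

Lemma psdmx0 : psdmx (0 : 'M[C]_d).
Proof. by move=> v; rewrite mulmx0 mul0mx mxE. Qed.

Lemma psdmx_sum (I : Type) (r : seq I) (F : I -> 'M[C]_d) :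
  (forall i, psdmx (F i)) -> psdmx (\sum_(i <- r) F i).
Proof. by move=> F0; apply: big_ind => //; [exact: psdmx0|exact: psdmxD]. Qed.

Lemma psdmx_diag_ge0 X i : psdmx X -> 0 <= X i i.
Proof.
move=> X0; have := X0 (delta_mx i 0).
have -> : adjmx (delta_mx i 0 : 'cV[C]_d) = delta_mx 0 i.
  by apply/matrixP => a b; rewrite !mxE andbC; case: andP => _; rewrite ?conjC1 ?conjC0.
by rewrite -rowE -colE !mxE.
Qed.

Lemma psdmx_tr_ge0 X : psdmx X -> 0 <= \tr X.
Proof. by move=> X0; apply: sumr_ge0 => i _; exact: psdmx_diag_ge0. Qed.

(** The quadratic form at [e_i + z e_j]. The values 1, -1, i, -i of [z] recover hermitian symmetry
    and bound an entry by the diagonal. *)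
Lemma psdmx_pair_ge0 X z i j : psdmx X ->
  0 <= X i i + z * X i j + z^* * X j i + z^* * z * X j j.
Proof.
move=> X0; have := X0 (delta_mx i 0 + z *: delta_mx j 0).
have E k : adjmx (delta_mx k 0 : 'cV[C]_d) = delta_mx 0 k.
  by apply/matrixP => a b; rewrite !mxE andbC; case: andP => _; rewrite ?conjC1 ?conjC0.
have F k l : (delta_mx 0 k *m X *m delta_mx l 0 : 'M[C]_1) 0 0 = X k l.
  by rewrite -rowE -colE !mxE.
rewrite adjmxD adjmxZ !E !mulmxDl !mulmxDr.
rewrite -!scalemxAl -!scalemxAr.
have aE (M N : 'M[C]_1) : (M + N) 0 0 = M 0 0 + N 0 0 by rewrite mxE.
have sE c (M : 'M[C]_1) : (c *: M) 0 0 = c * M 0 0 by rewrite mxE.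
by rewrite !aE !sE !F !addrA mulrA.
Qed.

Lemma psdmx_hermitian X i j : psdmx X ->
  Re (X j i) = Re (X i j) /\ Im (X j i) = - Im (X i j).
Proof.
move=> X0.
have [_ di] := ge0_ReIm (psdmx_diag_ge0 i X0).
have [_ dj] := ge0_ReIm (psdmx_diag_ge0 j X0).
have [_ h1] := ge0_ReIm (psdmx_pair_ge0 1 i j X0).
have [_ hi] := ge0_ReIm (psdmx_pair_ge0 ('i)%C i j X0).
move: h1 hi; rewrite !(cImD, cImM, cReM, cRe_conj, cIm_conj) /= di dj; lra.
Qed.

Lemma psdmx_entry_le X i j : psdmx X ->
  `|Re (X i j)| <= Re (\tr X) /\ `|Im (X i j)| <= Re (\tr X).
Proof.
move=> X0.
have [hre him] := psdmx_hermitian i j X0.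
have [di0 di] := ge0_ReIm (psdmx_diag_ge0 i X0).
have [dj0 dj] := ge0_ReIm (psdmx_diag_ge0 j X0).
have tle k : Re (X k k) <= Re (\tr X).
  rewrite /mxtrace cRe_sum (bigD1 k) //= lerDl; apply: sumr_ge0 => l _.
  by have [] := ge0_ReIm (psdmx_diag_ge0 l X0).
have ti := tle i; have tj := tle j.
have [h1 _] := ge0_ReIm (psdmx_pair_ge0 1 i j X0).
have [h2 _] := ge0_ReIm (psdmx_pair_ge0 (-1) i j X0).
have [h3 _] := ge0_ReIm (psdmx_pair_ge0 ('i)%C i j X0).
have [h4 _] := ge0_ReIm (psdmx_pair_ge0 (- ('i)%C) i j X0).
move: h1 h2 h3 h4; rewrite !(cReD, cImM, cReM, cReN, cImN, cRe_conj, cIm_conj) /= ?di ?dj ?hre ?him.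
by move=> *; split; rewrite ler_norml; apply/andP; split; lra.
Qed.

(* A measurable substitute for the trace norm, whose definition by choice makes
   measurability unavailable. *)
Definition entry_norm Z : R := \sum_i \sum_j (`|Re (Z i j)| + `|Im (Z i j)|).

Lemma entry_norm_ge0 Z : 0 <= entry_norm Z.
Proof. by apply: sumr_ge0 => i _; apply: sumr_ge0 => j _; exact: addr_ge0. Qed.

Lemma entry_norm_le Z (M : R) :
  (forall i j, `|Re (Z i j)| <= M /\ `|Im (Z i j)| <= M) ->
  entry_norm Z <= 2 * d%:R ^+ 2 * M.
Proof.
move=> H; apply: (@le_trans _ _ (\sum_(i < d) \sum_(j < d) (2 * M))).
  by apply: ler_sum => i _; apply: ler_sum => j _; have [] := H i j; lra.
by rewrite !sumr_const !card_ord -mulrnA -[leLHS]mulr_natr natrM expr2 -!mulrA (mulrC M) -mulrA.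
Qed.

(** By [2 |x y| <= |x|^2 + |y|^2] the entries of [adjmx W *m W] have real and imaginary parts
    bounded by the trace of [W *m adjmx W]. Over the Kraus operators of all words of a given length
    these traces have a fixed sum, so this replaces contractivity of the trace norm. *)
Lemma tr_sandwich_le W Z :
  `|Re (\tr (W *m Z *m adjmx W))| <= entry_norm Z * Re (\tr (W *m adjmx W)).
Proof.
pose n2 (z : C) : R := Re z ^+ 2 + Im z ^+ 2.
have n20 z : 0 <= n2 z by rewrite addr_ge0 ?sqr_ge0.
have FE : Re (\tr (W *m adjmx W)) = \sum_k \sum_i n2 (W k i).
  rewrite /mxtrace cRe_sum; apply: eq_bigr => k _; rewrite mxE cRe_sum.
  by apply: eq_bigr => i _; rewrite mxE cReM cRe_conj cIm_conj /n2; ring.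
have -> : \tr (W *m Z *m adjmx W) = \sum_i \sum_j \sum_k (W k i * (W k j)^* * Z i j).
  rewrite /mxtrace.
  under eq_bigr => k _.
    rewrite mxE.
    under eq_bigr => j _ do rewrite !mxE mulr_suml.
    over.
  rewrite exchange_big /=; under eq_bigr do rewrite exchange_big /=.
  rewrite exchange_big /=; apply: eq_bigr => i _; apply: eq_bigr => j _.
  by apply: eq_bigr => k _; rewrite mulrAC.
have col i : \sum_k n2 (W k i) <= \sum_k \sum_i n2 (W k i).
  by apply: ler_sum => k _; rewrite (bigD1 i) //= lerDl sumr_ge0.
rewrite cRe_sum FE /entry_norm mulr_suml; apply: le_trans (ler_norm_sum _ _ _) _.
apply: ler_sum => i _; rewrite cRe_sum mulr_suml; apply: le_trans (ler_norm_sum _ _ _) _.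
apply: ler_sum => j _; rewrite cRe_sum; apply: le_trans (ler_norm_sum _ _ _) _.
set nz := `|_| + `|_|; have nz0 : 0 <= nz by exact: addr_ge0.
apply: (@le_trans _ _ (\sum_k nz * ((n2 (W k i) + n2 (W k j)) / 2))).
  apply: ler_sum => k _; rewrite cReM mulrDl.
  have bd : `|Re (W k i * (W k j)^*)| <= (n2 (W k i) + n2 (W k j)) / 2 /\
            `|Im (W k i * (W k j)^*)| <= (n2 (W k i) + n2 (W k j)) / 2.
    rewrite cReM cImM cRe_conj cIm_conj /n2.
    have := sqr_ge0 (Re (W k i) + Re (W k j)); have := sqr_ge0 (Im (W k i) + Im (W k j)).
    have := sqr_ge0 (Re (W k i) - Re (W k j)); have := sqr_ge0 (Im (W k i) - Im (W k j)).
    have := sqr_ge0 (Re (W k i) + Im (W k j)); have := sqr_ge0 (Im (W k i) + Re (W k j)).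
    have := sqr_ge0 (Re (W k i) - Im (W k j)); have := sqr_ge0 (Im (W k i) - Re (W k j)).
    by move=> *; split; rewrite ler_norml; apply/andP; split; lra.
  case: bd => b1 b2; apply: le_trans (ler_normB _ _) _.
  by rewrite !normrM lerD // mulrC ler_wpM2l.
rewrite -mulr_sumr ler_wpM2l // -mulr_suml big_split /=.
by have := col i; have := col j; lra.
Qed.
End Square.
End ComplexMatrices.

Section TraceNorm.
Variables (R : realType) (d : nat).
Local Notation C := R[i].
Implicit Types (Q X Z W : 'M[C]_d).

Lemma psdmx_diag (D : 'rV[C]_d) : (forall i, 0 <= D 0 i) -> psdmx (diag_mx D).
Proof.
move=> D0 x; rewrite mul_mx_diag mxE; apply: sumr_ge0 => i _.
by rewrite !mxE mulrAC mulr_ge0 // mulrC mul_conjC_ge0.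
Qed.

(* Without a root, [trnorm] would take the trace of the default value [0]. *)
Lemma psdmx_sqrt_exists X : exists Q, psdmx Q /\ Q *m Q = adjmx X *m X.
Proof.
pose M := adjmx X *m X.
have adjE n (A : 'M[C]_n) : map_mx Num.conj A^T = adjmx A.
  by apply/matrixP => i j; rewrite !mxE.
have MH : adjmx M = M by rewrite /M adjmxM adjmxK.
have /orthomx_spectralP ME : M \is normalmx.
  by apply/normalmxP; rewrite adjE MH.
have PU := spectral_unitarymx M; set P := spectralmx M in PU ME.
have PP : P *m adjmx P = 1%:M by have /unitarymxP := PU; rewrite adjE.
rewrite (invmx_unitary PU) adjE in ME.
set D := spectral_diag M in ME.
have DE : diag_mx D = adjmx (X *m adjmx P) *m (X *m adjmx P).
  rewrite adjmxM adjmxK -!mulmxA (mulmxA (adjmx X)) -/M ME !mulmxA PP mul1mx.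
  by rewrite -mulmxA PP mulmx1.
have D0 i : 0 <= D 0 i.
  have -> : D 0 i = diag_mx D i i by rewrite mxE eqxx.
  by rewrite DE mxE; apply: sumr_ge0 => k _; rewrite !mxE mulrC mul_conjC_ge0.
pose S := \row_i sqrtC (D 0 i).
exists (adjmx P *m diag_mx S *m P); split.
  have := psdmx_sandwich (adjmx P) (psdmx_diag (_ : forall i, 0 <= S 0 i)).
  by rewrite adjmxK; apply => i; rewrite mxE sqrtC_ge0.
have SS : diag_mx S *m diag_mx S = diag_mx D.
  rewrite mulmx_diag; congr diag_mx.
  by apply/rowP => i; rewrite !mxE -expr2 sqrtCK.
rewrite -/M ME !mulmxA -(mulmxA (_ *m diag_mx S)) PP mulmx1.
by rewrite -(mulmxA (adjmx P)) SS.
Qed.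

(** By [Q *m Q = adjmx Z *m Z] the columns of [Z] and of its modulus [Q] have the same Euclidean
    norms, and the entries of [Q] are bounded by its trace [t]. Hence each real coordinate of [Z] is
    at most [2 * d * t], and there are [2 * d ^ 2] of them. *)
Lemma entry_norm_trnorm Z : entry_norm Z <= 4 * d%:R ^+ 3 * trnorm Z.
Proof.
rewrite /trnorm; case: (xgetP 0 [set Q : 'M[C]_d | psdmx Q /\ Q *m Q = adjmx Z *m Z]).
  move=> Q _ [Q0 QE]; set t := complex.Re (\tr Q).
  have t0 : 0 <= t by have [] := ge0_ReIm (psdmx_tr_ge0 Q0).
  apply: le_trans (entry_norm_le (M := 2 * d%:R * t) _) _; last first.
    by rewrite le_eqVlt; apply/orP; left; apply/eqP; ring.
  move=> i j.
  have d1 : 1 <= d%:R :> R by rewrite ler1n (leq_ltn_trans _ (ltn_ord i)).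
  pose n2 (z : C) : R := complex.Re z ^+ 2 + complex.Im z ^+ 2.
  have n20 z : 0 <= n2 z by rewrite addr_ge0 ?sqr_ge0.
  have EZ : complex.Re ((adjmx Z *m Z) j j) = \sum_k n2 (Z k j).
    rewrite mxE cRe_sum; apply: eq_bigr => k _; rewrite mxE cReM cRe_conj cIm_conj /n2; ring.
  have EQ : complex.Re ((Q *m Q) j j) = \sum_k n2 (Q k j).
    rewrite mxE cRe_sum; apply: eq_bigr => k _; rewrite cReM.
    by have [-> ->] := psdmx_hermitian k j Q0; rewrite /n2; ring.
  have n2le : n2 (Z i j) <= (2 * d%:R * t) ^+ 2.
    apply: (@le_trans _ _ (\sum_k n2 (Z k j))); first by rewrite (bigD1 i) //= lerDl sumr_ge0.
    rewrite -EZ -QE EQ; apply: (@le_trans _ _ (\sum_(k < d) 2 * t ^+ 2)).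
      apply: ler_sum => k _; have [a1 a2] := psdmx_entry_le k j Q0.
      have : complex.Re (Q k j) ^+ 2 <= t ^+ 2.
        by rewrite -(real_normK (num_real _)) lerXn2r ?nnegrE.
      have : complex.Im (Q k j) ^+ 2 <= t ^+ 2.
        by rewrite -(real_normK (num_real _)) lerXn2r ?nnegrE.
      by rewrite /n2; lra.
    rewrite sumr_const card_ord -[leLHS]mulr_natr exprMn exprMn.
    have t20 : 0 <= t ^+ 2 by exact: sqr_ge0.
    rewrite [leLHS]mulrAC ler_wpM2r //.
    have : d%:R <= d%:R ^+ 2 :> R by rewrite expr2 ler_peMr // (le_trans ler01).
    by have := le_trans ler01 d1; lra.
  have dt : 0 <= 2 * d%:R * t by rewrite !mulr_ge0.
  by split; rewrite -(ler_pXn2r (n := 2)) ?nnegrE // (real_normK (num_real _));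
    apply: le_trans n2le; rewrite /n2 ?lerDl ?lerDr sqr_ge0.
move=> /(_ _) H; have [Q QP] := psdmx_sqrt_exists Z.
by case: (H Q QP).
Qed.
End TraceNorm.

(** * Words, Kraus operators and quenched probabilities *)

Lemma big_tuple_cat (A : finType) (M : nmodType) k l (F : seq A -> M) :
  \sum_(u : (k + l).-tuple A) F u =
  \sum_(u : k.-tuple A) \sum_(v : l.-tuple A) F (u ++ v).
Proof.
rewrite pair_big /=; pose h (p : k.-tuple A * l.-tuple A) := cat_tuple p.1 p.2.
have tk (u : (k + l).-tuple A) : size (take k u) == k.
  by rewrite size_takel // size_tuple leq_addr.
have dk (u : (k + l).-tuple A) : size (drop k u) == l.
  by rewrite size_drop size_tuple addKn.
rewrite (reindex h) //=; exists (fun u => (Tuple (tk u), Tuple (dk u))).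
  move=> [u v] _; rewrite /h /=; congr pair; apply: val_inj => /=.
    by rewrite take_size_cat ?size_tuple.
  by rewrite drop_size_cat ?size_tuple.
by move=> u _; apply: val_inj; rewrite /h /= cat_take_drop.
Qed.

Lemma big_tuple1 (A : finType) (M : nmodType) (F : seq A -> M) :
  \sum_(u : 1.-tuple A) F u = \sum_a F [:: a].
Proof.
rewrite (reindex (fun a : A => [tuple a])) //=; exists (fun u => thead u) => //.
by move=> u _; rewrite [RHS]tuple_eta; apply: val_inj => /=; case: u => [[|a []]].
Qed.

Lemma big_tuple0 (A : finType) (M : nmodType) (F : seq A -> M) :
  \sum_(u : 0.-tuple A) F u = F [::].
Proof.
by rewrite (big_pred1 [tuple]) // => u; rewrite [u]tuple0; apply/esym/eqP.
Qed.

Section Words.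
Variables (R : realType) (A : finType) (d : nat) (d0 : measure_display) (Omega : measurableType d0).
Variables (V : A -> Omega -> 'M[R[i]]_d) (theta : Omega -> Omega).
Local Notation C := R[i].
Local Notation Tword := (Tword V theta).
Local Notation Phin := (Phin V theta).
Local Notation qprob := (qprob V theta).
Implicit Types (X Y Z : 'M[C]_d) (w : Omega) (t n : nat) (u v : seq A).

(** The Kraus operator of a word, last letter leftmost; through it a word acts by a single
    sandwich. *)
Fixpoint Wop t u w : 'M[C]_d :=
  if u is a :: u' then Wop t.+1 u' w *m V a (iter t theta w) else 1%:M.

Lemma TwordE t u w X : Tword t u w X = Wop t u w *m X *m adjmx (Wop t u w).
Proof.
elim: u t X => [|a u IH] t X /=; first by rewrite adjmx1 mul1mx mulmx1.
by rewrite IH /Top adjmxM !mulmxA.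
Qed.

Lemma TwordD t u w X Y : Tword t u w (X + Y) = Tword t u w X + Tword t u w Y.
Proof. by rewrite !TwordE mulmxDr mulmxDl. Qed.

Lemma TwordZ t u w c X : Tword t u w (c *: X) = c *: Tword t u w X.
Proof. by rewrite !TwordE -scalemxAr -scalemxAl. Qed.

Lemma TwordB t u w X Y : Tword t u w (X - Y) = Tword t u w X - Tword t u w Y.
Proof. by rewrite !TwordE mulmxBr mulmxBl. Qed.

Lemma Tword_sum t u w (I : Type) (s : seq I) (P : pred I) (F : I -> 'M[C]_d) :
  Tword t u w (\sum_(i <- s | P i) F i) = \sum_(i <- s | P i) Tword t u w (F i).
Proof.
rewrite TwordE mulmx_sumr mulmx_suml; apply: eq_bigr => i _.
by rewrite TwordE.
Qed.

Lemma psdmx_Tword t u w X : psdmx X -> psdmx (Tword t u w X).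
Proof. by rewrite TwordE; exact: psdmx_sandwich. Qed.

Lemma Tword_cat t u v w X :
  Tword t (u ++ v) w X = Tword (t + size u) v w (Tword t u w X).
Proof.
by elim: u t X => [|a u IH] t X /=; [rewrite addn0|rewrite IH addSnnS].
Qed.

Lemma Tword_shift t k u w X : Tword (t + k) u w X = Tword t u (iter k theta w) X.
Proof. by elim: u t X => //= a u IH t X; rewrite -addSn IH iterD. Qed.

Lemma Phin_words n w X : Phin n w X = \sum_(u : n.-tuple A) Tword 1 u w X.
Proof.
elim: n => [|n IH]; first by rewrite (big_tuple0 (fun u => Tword 1 u w X)).
rewrite /= IH -[in RHS](addn1 n) (big_tuple_cat n 1 (fun u => Tword 1 u w X)).
under [RHS]eq_bigr => u _.
  rewrite (big_tuple1 (fun v => Tword 1 (u ++ v) w X)).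
  under eq_bigr => a _ do rewrite Tword_cat size_tuple add1n /=.
  over.
rewrite exchange_big /=; apply: eq_bigr => a _.
by rewrite /Top mulmx_sumr mulmx_suml.
Qed.

Definition kraus w := \sum_a adjmx (V a w) *m V a w = 1%:M.

Lemma tr_Top_sum w X : kraus w -> \sum_a \tr (Top V a w X) = \tr X.
Proof.
move=> K; rewrite -raddf_sum /Top.
transitivity (\tr (\sum_a adjmx (V a w) *m V a w *m X)).
  rewrite !raddf_sum; apply: eq_bigr => a _ /=.
  by rewrite mxtrace_mulC mulmxA.
by rewrite -mulmx_suml K mul1mx.
Qed.

Lemma tr_Tword_sum t n w X : (forall k, (t <= k)%N -> kraus (iter k theta w)) ->
  \sum_(u : n.-tuple A) \tr (Tword t u w X) = \tr X.
Proof.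
elim: n t X => [|n IH] t X K; first by rewrite (big_tuple0 (fun u => \tr (Tword t u w X))).
rewrite -[n.+1]add1n (big_tuple_cat 1 n (fun u => \tr (Tword t u w X))).
rewrite (big_tuple1 (fun v => \sum_(u : n.-tuple A) \tr (Tword t (v ++ u) w X))) /=.
rewrite (eq_bigr _ (fun a _ => IH t.+1 _ (fun k h => K k (ltnW h)))).
exact: tr_Top_sum (K t (leqnn t)).
Qed.

(** The Kraus identity is given almost everywhere. By invariance it holds almost everywhere along
    whole orbits, and the algebra on words can then be pointwise. *)
Definition good w := forall k, kraus (iter k theta w).

Lemma good_iter k w : good w -> good (iter k theta w).
Proof. by move=> G j; rewrite -iterD. Qed.

Lemma qprobB X Y w u : qprob (X - Y) w u = qprob X w u - qprob Y w u.
Proof. by rewrite /qprob TwordB raddfB /= cReD cReN. Qed.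

Lemma qprobZ (c : R) X w u : qprob (c%:C%C *: X) w u = c * qprob X w u.
Proof. by rewrite /qprob TwordZ mxtraceZ cReM /= mul0r subr0. Qed.

Lemma qprob_sum (I : Type) (s : seq I) (P : pred I) (F : I -> 'M[C]_d) w u :
  qprob (\sum_(i <- s | P i) F i) w u = \sum_(i <- s | P i) qprob (F i) w u.
Proof. by rewrite /qprob Tword_sum (raddf_sum (@mxtrace C d)) cRe_sum. Qed.

Lemma qprob_ge0 X w u : psdmx X -> 0 <= qprob X w u.
Proof. by move=> X0; have [] := ge0_ReIm (psdmx_tr_ge0 (psdmx_Tword 1 u w X0)). Qed.

Lemma qprob_total n X w : good w -> \sum_(u : n.-tuple A) qprob X w u = complex.Re (\tr X).
Proof.
by move=> G; rewrite /qprob -cRe_sum tr_Tword_sum.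
Qed.

Lemma qprob_cat X w u v :
  qprob X w (u ++ v) = qprob (Tword 1 u w X) (iter (size u) theta w) v.
Proof. by rewrite /qprob Tword_cat Tword_shift. Qed.

Lemma tr1mx : complex.Re (\tr (1%:M : 'M[C]_d)) = d%:R.
Proof. by rewrite mxtrace1 -(rmorph_nat (real_complex R)). Qed.

(** [Z] is compared with the identity matrix, whose word weights sum to its trace [d]. For a
    difference of two states this bounds the distance of their word laws. *)
Lemma qprob_abs_total n Z w : good w ->
  \sum_(u : n.-tuple A) `|qprob Z w u| <= d%:R * entry_norm Z.
Proof.
move=> G; rewrite -tr1mx -(qprob_total n _ G) mulr_suml; apply: ler_sum => u _.
rewrite /qprob !TwordE mulmx1 mulrC; exact: tr_sandwich_le.
Qed.

Definition wordE n X w (F : seq A -> R) : R := \sum_(u : n.-tuple A) qprob X w u * F u.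

Lemma wordE_le n Z w F (M : R) : good w -> (forall u, `|F u| <= M) ->
  `|wordE n Z w F| <= M * (d%:R * entry_norm Z).
Proof.
move=> G FM; apply: le_trans (ler_norm_sum _ _ _) _.
have M0 : 0 <= M by apply: le_trans (FM [::]).
apply: (@le_trans _ _ (\sum_(u : n.-tuple A) M * `|qprob Z w u|)).
  by apply: ler_sum => u _; rewrite normrM mulrC ler_wpM2r.
by rewrite -mulr_sumr ler_wpM2l // qprob_abs_total.
Qed.

Lemma wordEB n X Y w F : wordE n (X - Y) w F = wordE n X w F - wordE n Y w F.
Proof.
by rewrite /wordE -sumrB; apply: eq_bigr => u _; rewrite qprobB mulrBl.
Qed.

Lemma wordEZ n (c : R) X w F : wordE n (c%:C%C *: X) w F = c * wordE n X w F.
Proof.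
by rewrite /wordE mulr_sumr; apply: eq_bigr => u _; rewrite qprobZ mulrA.
Qed.

(** The unnormalised state left by the first [n] letters when outcomes are weighted by [F]: all that
    the past passes on to later letters. *)
Definition weighted_state n X w (F : seq A -> R) : 'M[C]_d :=
  \sum_(u : n.-tuple A) (F u)%:C%C *: Tword 1 u w X.

Lemma tr_weighted_state n X w F : complex.Re (\tr (weighted_state n X w F)) = wordE n X w F.
Proof.
rewrite (raddf_sum (@mxtrace C d)) cRe_sum; apply: eq_bigr => u _ /=.
by rewrite mxtraceZ cReM /= mul0r subr0 mulrC.
Qed.

Lemma psdmx_weighted_state n X w F : (forall u, 0 <= F u) -> psdmx X ->
  psdmx (weighted_state n X w F).
Proof.
move=> F0 X0; apply: psdmx_sum => u; apply: psdmxZ; first by rewrite ler0c.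
exact: psdmx_Tword.
Qed.

(** The Markov property in the form used: by linearity the sum over past words moves inside the
    state. *)
Lemma wordE_cat k l X w H (F G : seq A -> R) :
  (forall u v, size u = k -> size v = l -> H (u ++ v) = F u * G v) ->
  wordE (k + l) X w H = wordE l (weighted_state k X w F) (iter k theta w) G.
Proof.
move=> HE; rewrite /wordE (big_tuple_cat k l (fun u => qprob X w u * H u)).
rewrite exchange_big /=; apply: eq_bigr => v _.
rewrite qprob_sum mulr_suml; apply: eq_bigr => u _.
by rewrite HE ?size_tuple // qprob_cat size_tuple qprobZ; ring.
Qed.

Lemma wordE_skip k l X w H (G : seq A -> R) :
  (forall u v, size u = k -> size v = l -> H (u ++ v) = G v) ->
  wordE (k + l) X w H = wordE l (Phin k w X) (iter k theta w) G.
Proof.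
move=> HE; rewrite (@wordE_cat k l X w H (fun=> 1) G); last by move=> u v uk vl; rewrite HE ?mul1r.
rewrite Phin_words; congr (wordE _ _ _ _); apply: eq_bigr => u _.
exact: scale1r.
Qed.

Lemma wordE_drop k l X w H (F : seq A -> R) : good w ->
  (forall u v, size u = k -> size v = l -> H (u ++ v) = F u) ->
  wordE (k + l) X w H = wordE k X w F.
Proof.
move=> Gw HE; rewrite (@wordE_cat k l X w H F (fun=> 1)); last by move=> u v uk vl; rewrite HE ?mulr1.
rewrite -[RHS]tr_weighted_state -(qprob_total l _ (good_iter k Gw)).
by apply: eq_bigr => u _; rewrite mulr1.
Qed.

Lemma PhinD n w X Y : Phin n w (X + Y) = Phin n w X + Phin n w Y.
Proof. by rewrite !Phin_words -big_split; apply: eq_bigr => u _; rewrite TwordD. Qed.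

Lemma PhinZ n w c X : Phin n w (c *: X) = c *: Phin n w X.
Proof. by rewrite !Phin_words scaler_sumr; apply: eq_bigr => u _; rewrite TwordZ. Qed.

Lemma wordE_state_le n X w F (M : R) : good w -> is_state X -> (forall u, `|F u| <= M) ->
  `|wordE n X w F| <= M.
Proof.
move=> G [X0 X1] FM; apply: le_trans (ler_norm_sum _ _ _) _.
have M0 : 0 <= M by apply: le_trans (FM [::]).
apply: (@le_trans _ _ (\sum_(u : n.-tuple A) qprob X w u * M)).
  by apply: ler_sum => u _; rewrite normrM ger0_norm ?qprob_ge0 // ler_wpM2l ?qprob_ge0.
by rewrite -mulr_suml qprob_total // X1 /= mul1r.
Qed.

Lemma wordE_state01 n X w F : good w -> is_state X -> (forall u, 0 <= F u <= 1) ->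
  0 <= wordE n X w F <= 1.
Proof.
move=> G sX F01; have Fn u : `|F u| <= 1 by have /andP[? ?] := F01 u; rewrite ger0_norm.
have := wordE_state_le n G sX Fn; rewrite ler_norml => /andP[_ ->]; rewrite andbT.
apply: sumr_ge0 => u _; rewrite mulr_ge0 ?qprob_ge0 //; first by case: sX.
by have /andP[] := F01 u.
Qed.

Lemma is_state_Phin n X w : good w -> is_state X -> is_state (Phin n w X).
Proof.
move=> G [X0 X1]; rewrite Phin_words; split.
  by apply: psdmx_sum => u; exact: psdmx_Tword.
by rewrite (raddf_sum (@mxtrace C d)) tr_Tword_sum.
Qed.
End Words.

(** * Measurability and integration *)

Section Integrals.
Variables (R : realType) (d0 : measure_display) (Omega : measurableType d0).
Variable P : probability Omega R.
Implicit Types (f g h : Omega -> R).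

Lemma ae_bounded_integrable h (M : R) : measurable_fun setT h ->
  {ae P, forall w, `|h w| <= M} -> P.-integrable setT (EFin \o h).
Proof.
move=> mh hM; apply/integrableP; split; first exact/measurable_EFinP.
apply: (@le_lt_trans _ _ (\int[P]_w (`|M|)%:E)%E).
  apply: ae_ge0_le_integral => //.
  - by apply: measurableT_comp => //; exact/measurable_EFinP.
  - by apply: filterS hM => w hw _; rewrite /= lee_fin (le_trans hw) // ler_norm.
by rewrite integral_cst // lte_mul_pinfty // (le_lt_trans (probability_le1 P measurableT)) // ltry.
Qed.

(* The integral of a nonnegative function is a supremum over simple functions
   below it, so monotonicity needs no measurability. *)
Lemma le_integral_nonmeas (f g : Omega -> \bar R) :
  (forall w, 0 <= f w)%E -> (forall w, f w <= g w)%E ->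
  (\int[P]_w f w <= \int[P]_w g w)%E.
Proof.
move=> f0 fg; rewrite !ge0_integralTE //; last by move=> w; apply: le_trans (fg w).
apply: ereal_sup_le => _ [h hf <-].
by exists h => // w; apply: le_trans (fg w).
Qed.

Lemma Rintegral_close f g (N : Omega -> R) (Mf Mg K c : R) :
  measurable_fun setT f -> measurable_fun setT g -> measurable_fun setT N ->
  {ae P, forall w, `|f w| <= Mf} -> {ae P, forall w, `|g w| <= Mg} ->
  (forall w, 0 <= N w) -> 0 <= K ->
  (\int[P]_w (N w)%:E <= c%:E)%E ->
  {ae P, forall w, `|f w - g w| <= K * N w} ->
  `|\int[P]_w f w - \int[P]_w g w| <= K * c.
Proof.
move=> mf mg mN bf bg N0 K0 Nc fg.
have i1 := ae_bounded_integrable mf bf.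
have i2 := ae_bounded_integrable mg bg.
have i12 : P.-integrable setT (EFin \o (fun w => f w - g w)).
  by have := integrableB measurableT i1 i2; apply: eq_integrable.
rewrite -RintegralB // -lee_fin EFin_normr_Rintegral //.
apply: le_trans (le_abse_integral _ _ _) _ => //.
  by apply/measurable_EFinP; apply: measurable_funB.
apply: (@le_trans _ _ (\int[P]_w (K%:E * (N w)%:E))%E).
  apply: ae_ge0_le_integral => //.
  - apply: measurableT_comp => //; apply/measurable_EFinP; exact: measurable_funB.
  - by move=> w _; rewrite -EFinM lee_fin mulr_ge0.
  - by apply/measurable_EFinP; exact: measurable_funM.
  - by apply: filterS fg => w; rewrite -EFinM /= lee_fin.
rewrite ge0_integralZl_EFin //; first last.
- exact/measurable_EFinP.
- by move=> w _; rewrite lee_fin.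
by rewrite EFinM lee_wpmul2l // lee_fin.
Qed.

Section Shift.
Variable th : Omega -> Omega.
Hypothesis mth : measurable_fun setT th.
Hypothesis pth : preserving P th.

Lemma ae_shift (Q : Omega -> Prop) : {ae P, forall w, Q w} -> {ae P, forall w, Q (th w)}.
Proof.
case=> N [mN PN QN]; exists (th @^-1` N); split.
- by rewrite -[X in measurable X]setTI; exact: mth.
- by rewrite pth.
- by move=> w /= nQ; apply: QN.
Qed.

Lemma ge0_integral_shift (f : Omega -> \bar R) : measurable_fun setT f ->
  (forall w, 0 <= f w)%E -> (\int[P]_w f (th w) = \int[P]_w f w)%E.
Proof.
move=> mf f0.
have := @ge0_integral_pushforward _ _ _ _ R th mth P setT f measurableT mf (fun w _ => f0 w).
rewrite preimage_setT => <-; apply: eq_measure_integral => A mA _.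
exact: pth.
Qed.

Lemma Rintegral_shift f : measurable_fun setT f ->
  \int[P]_w f (th w) = \int[P]_w f w.
Proof.
move=> mf; rewrite /Rintegral; congr fine.
have mEf : measurable_fun setT (EFin \o f) by exact/measurable_EFinP.
rewrite (integralE _ _ ((EFin \o f) \o th)) (integralE _ _ (EFin \o f)).
rewrite funepos_comp funeneg_comp; congr (_ - _)%E.
  by rewrite -[RHS](@ge0_integral_shift ((EFin \o f)^\+)%E) //; exact: measurable_funepos.
by rewrite -[RHS](@ge0_integral_shift ((EFin \o f)^\-)%E) //; exact: measurable_funeneg.
Qed.

Lemma measurable_iter k : measurable_fun setT (iter k th).
Proof.
elim: k => [|k IH]; first exact: measurable_id.
exact: (measurableT_comp mth IH).
Qed.

Lemma preserving_iter k : preserving P (iter k th).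
Proof.
elim: k => [|k IH] B mB //; rewrite -(IH B) //.
have mB' : measurable (iter k th @^-1` B).
  by rewrite -[X in measurable X]setTI; exact: measurable_iter.
by rewrite -(pth mB'); congr (P _); apply/seteqP; split => w; rewrite /= -iterSr.
Qed.
End Shift.

Lemma preserving_inverse th thinv : measurable_fun setT thinv -> preserving P th ->
  cancel th thinv -> preserving P thinv.
Proof.
move=> mi pth thK B mB.
have mB' : measurable (thinv @^-1` B) by rewrite -[X in measurable X]setTI; exact: mi.
by rewrite -(pth _ mB'); congr (P _); apply/seteqP; split => w /=; rewrite thK.
Qed.
End Integrals.

(** The sum counts the positive integers up to [x], so it is the integer part of [x]; as [x <= N],
    none is cut off. *)
Lemma layer_count (R : realType) (x : R) (N : nat) : 0 <= x -> x <= N%:R ->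
  `|x - \sum_(j < N) (nat_of_bool (j.+1%:R <= x)%R)%:R| <= 1.
Proof.
move=> x0 xN; pose k := Num.truncn x.
have kx : k%:R <= x by rewrite truncn_le.
have xk : x < k.+1%:R by exact: truncnS_gt.
have kN : (k <= N)%N by rewrite -(ler_nat R) (le_trans kx).
have -> : \sum_(j < N) (nat_of_bool (j.+1%:R <= x)%R)%:R = k%:R :> R.
  transitivity (\sum_(j < N) (j < k)%N%:R : R).
    apply: eq_bigr => j _; congr (_%:R); congr nat_of_bool; apply/idP/idP => [jx|jk].
      by rewrite -ltnS -(ltr_nat R) (le_lt_trans jx).
    by apply: le_trans kx; rewrite ler_nat.
  rewrite -(big_mkord xpredT (fun j => (j < k)%N%:R : R)) (big_cat_nat _ (n := k)) //=.
  rewrite (@eq_big_nat _ _ _ 0 k _ (fun=> 1)) => [|j /andP[_ ->] //].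
  rewrite (@eq_big_nat _ _ _ k N _ (fun=> 0)) => [|j /andP[kj _]]; last by rewrite ltnNge kj.
  by rewrite big1_eq addr0 big_const_nat subn0 iter_addr_0.
by rewrite -natr1 in xk; rewrite ler_norml; apply/andP; split; lra.
Qed.

(** * From mixing of events to covariances of functions *)

Section MixingFunctions.
Variables (R : realType) (d0 : measure_display) (Omega : measurableType d0).
Variable P : probability Omega R.

Lemma Rintegral_close_cst (f g : Omega -> R) (Mf Mg c : R) :
  measurable_fun setT f -> measurable_fun setT g ->
  {ae P, forall w, `|f w| <= Mf} -> {ae P, forall w, `|g w| <= Mg} -> 0 <= c ->
  {ae P, forall w, `|f w - g w| <= c} ->
  `|\int[P]_w f w - \int[P]_w g w| <= c.
Proof.
move=> mf mg bf bg c0 fg; rewrite -[leRHS]mulr1.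
apply: (@Rintegral_close _ _ _ P f g (fun=> 1) Mf Mg) => //.
  by rewrite integral_cst // mul1e; exact: probability_le1.
by apply: filterS fg => w; rewrite mulr1.
Qed.

Variables (G1 G2 : set (set Omega)) (al : R).
Hypothesis G1m : forall B, <<s G1 >> B -> measurable B.
Hypothesis G2m : forall B, <<s G2 >> B -> measurable B.
Hypothesis mixP : forall B D, <<s G1 >> B -> <<s G2 >> D ->
  `|fine (P (B `&` D)) - fine (P B) * fine (P D)| <= al.

(* [f] is uniformly within [1 / N] of the average of the indicators of its level
   sets [{j / N <= f}], to which the mixing bound applies pair by pair. *)
Lemma cov_le_mixing (f g : Omega -> R) :
  measurable_fun setT (f : g_sigma_algebraType G1 -> R) ->
  measurable_fun setT (g : g_sigma_algebraType G2 -> R) ->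
  {ae P, forall w, 0 <= f w <= 1} -> {ae P, forall w, 0 <= g w <= 1} ->
  `|\int[P]_w (f w * g w) - (\int[P]_w f w) * (\int[P]_w g w)| <= al.
Proof.
move=> mf1 mg2 f01 g01.
have mf : measurable_fun setT f.
  by move=> _ D mD; apply: G1m; exact: (mf1 measurableT D mD).
have mg : measurable_fun setT g.
  by move=> _ D mD; apply: G2m; exact: (mg2 measurableT D mD).
have fN : {ae P, forall w, `|f w| <= 1} by apply: filterS f01 => w /andP[? ?]; rewrite ger0_norm.
have gN : {ae P, forall w, `|g w| <= 1} by apply: filterS g01 => w /andP[? ?]; rewrite ger0_norm.
suff key (N : nat) : (0 < N)%N ->
    `|\int[P]_w (f w * g w) - (\int[P]_w f w) * (\int[P]_w g w)| * N%:R ^+ 2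
      <= al * N%:R ^+ 2 + 4 * N%:R.
  apply/ler_addgt0Pr => e e0.
  (* Discretisation costs [2 * N] in the mean of the product and [2 * N] in the product of means,
     hence [4 / N] after division by [N ^+ 2]. *)
  pose N := (Num.truncn (4 / e)).+1.
  have Ne : 4 / e < N%:R by exact: truncnS_gt.
  have N0 : 0 < N%:R :> R by rewrite ltr0n.
  have := key N (ltn0Sn _).
  rewrite -ler_pdivlMr ?exprn_gt0 // => /le_trans; apply.
  rewrite mulrDl mulfK ?gt_eqF ?exprn_gt0 // lerD2l expr2 invfM mulrA mulfK ?gt_eqF //.
  by rewrite ler_pdivrMr // mulrC -ler_pdivrMr // ltW.
move=> N0; have NR : 0 < N%:R :> R by rewrite ltr0n.
pose B j : set Omega := [set w | j.+1%:R <= N%:R * f w].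
pose D j : set Omega := [set w | j.+1%:R <= N%:R * g w].
have sB j : <<s G1 >> (B j).
  have := measurable_funM (measurable_cst (N%:R : R)) mf1.
  move=> /(_ measurableT _ (measurable_itv `[j.+1%:R, +oo[)); rewrite setTI.
  by congr (<<s G1 >> _); apply/seteqP; split => w; rewrite /B /= in_itv /= andbT.
have sD j : <<s G2 >> (D j).
  have := measurable_funM (measurable_cst (N%:R : R)) mg2.
  move=> /(_ measurableT _ (measurable_itv `[j.+1%:R, +oo[)); rewrite setTI.
  by congr (<<s G2 >> _); apply/seteqP; split => w; rewrite /D /= in_itv /= andbT.
pose fB w : R := \sum_(j < N) \1_(B j) w.
pose gD w : R := \sum_(j < N) \1_(D j) w.
have indE (E : set Omega) w : \1_E w = (asbool (E w))%:R :> R.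
  by rewrite indicE; congr (_%:R); congr nat_of_bool; apply/idP/asboolP => [/set_mem|/mem_set].
have mfB : measurable_fun setT fB.
  by apply: measurable_sum => j; apply: measurable_indic; exact: G1m.
have mgD : measurable_fun setT gD.
  by apply: measurable_sum => j; apply: measurable_indic; exact: G2m.
have fBE w : fB w = \sum_(j < N) (nat_of_bool (j.+1%:R <= N%:R * f w)%R)%:R.
  by apply: eq_bigr => j _; rewrite indE /B /= asboolb.
have gDE w : gD w = \sum_(j < N) (nat_of_bool (j.+1%:R <= N%:R * g w)%R)%:R.
  by apply: eq_bigr => j _; rewrite indE /D /= asboolb.
have bN (F : 'I_N -> bool) : 0 <= \sum_(j < N) ((F j)%:R : R) <= N%:R.
  rewrite sumr_ge0 //=.
  apply: (@le_trans _ _ (\sum_(j < N) 1)); last by rewrite sumr_const card_ord.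
  by apply: ler_sum => j _; case: (F j).
have fB0 w : 0 <= fB w <= N%:R by rewrite fBE; exact: bN.
have gD0 w : 0 <= gD w <= N%:R by rewrite gDE; exact: bN.
have fBn w : `|fB w| <= N%:R by have /andP[? ?] := fB0 w; rewrite ger0_norm.
have gDn w : `|gD w| <= N%:R by have /andP[? ?] := gD0 w; rewrite ger0_norm.
have cf : {ae P, forall w, `|N%:R * f w - fB w| <= 1}.
  apply: filterS f01 => w /andP[f0 f1]; rewrite fBE; apply: layer_count.
    by rewrite mulr_ge0.
  by rewrite ler_piMr.
have cg : {ae P, forall w, `|N%:R * g w - gD w| <= 1}.
  apply: filterS g01 => w /andP[g0 g1]; rewrite gDE; apply: layer_count.
    by rewrite mulr_ge0.
  by rewrite ler_piMr.
have fNb : {ae P, forall w, `|N%:R * f w| <= N%:R}.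
  by apply: filterS fN => w h; rewrite normrM (ger0_norm (ltW NR)) ler_piMr // ltW.
have gNb : {ae P, forall w, `|N%:R * g w| <= N%:R}.
  by apply: filterS gN => w h; rewrite normrM (ger0_norm (ltW NR)) ler_piMr // ltW.
have mNf : measurable_fun setT (fun w => N%:R * f w) by apply: measurable_funM.
have mNg : measurable_fun setT (fun w => N%:R * g w) by apply: measurable_funM.
have If := ae_bounded_integrable mf fN.
have Ig := ae_bounded_integrable mg gN.
have Ifg : P.-integrable setT (EFin \o (fun w => f w * g w)).
  apply: (@ae_bounded_integrable _ _ _ P _ 1); first exact: measurable_funM.
  by apply: filterS2 fN gN => w h1 h2; rewrite normrM mulr_ile1.
have c1 : `|\int[P]_w (N%:R * f w) - \int[P]_w fB w| <= 1.
  apply: (Rintegral_close_cst mNf mfB fNb) => //; exact: aeW.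
have c2 : `|\int[P]_w (N%:R * g w) - \int[P]_w gD w| <= 1.
  apply: (Rintegral_close_cst mNg mgD gNb) => //; exact: aeW.
have c3 : `|\int[P]_w ((N%:R * f w) * (N%:R * g w)) - \int[P]_w (fB w * gD w)| <= 2 * N%:R.
  apply: (@Rintegral_close_cst _ _ (N%:R * N%:R) (N%:R * N%:R)).
  - exact: measurable_funM.
  - exact: measurable_funM.
  - by apply: filterS2 fNb gNb => w h1 h2; rewrite normrM ler_pM.
  - by apply: aeW => w; rewrite normrM ler_pM.
  - by rewrite mulr_ge0.
  - apply: filterS3 cf cg gNb => w h1 h2 h3.
    rewrite (_ : _ - _ = (N%:R * f w - fB w) * (N%:R * g w) + fB w * (N%:R * g w - gD w)); last by ring.
    apply: le_trans (ler_normD _ _) _; rewrite !(normrM (_ - _)) (normrM (fB w)).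
    rewrite mulr2n mulrDl mul1r; apply: lerD.
      by rewrite -[leRHS]mul1r ler_pM.
    by rewrite -[leRHS]mulr1 ler_pM.
have IB j : \int[P]_w \1_(B j) w = fine (P (B j)).
  by rewrite /Rintegral integral_indic //= ?setIT //; exact: G1m.
have ID j : \int[P]_w \1_(D j) w = fine (P (D j)).
  by rewrite /Rintegral integral_indic //= ?setIT //; exact: G2m.
have IBD i j : \int[P]_w (\1_(B i) w * \1_(D j) w) = fine (P (B i `&` D j)).
  transitivity (\int[P]_w (\1_(B i `&` D j) w)).
    by apply: eq_Rintegral => w _; rewrite indicI.
  by rewrite /Rintegral integral_indic //= ?setIT //; apply: measurableI; [exact: G1m|exact: G2m].
have Isum (I : finType) (F : I -> Omega -> R) :
    (forall i, measurable_fun setT (F i)) -> (forall i w, `|F i w| <= 1) ->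
    \int[P]_w (\sum_i F i w) = \sum_i \int[P]_w F i w.
  move=> mF bF; rewrite /Rintegral; under eq_integral do rewrite -sumEFin.
  have iF i : P.-integrable setT (fun w => (F i w)%:E).
    exact: (@ae_bounded_integrable _ _ _ P _ 1 (mF i) (aeW _ (bF i))).
  rewrite integral_sum // -sum_fine // => i _; exact: integrable_fin_num.
have ind1 (E : set Omega) w : `|\1_E w : R| <= 1.
  by rewrite indE; case: asbool; rewrite ?normr1 ?normr0.
have mB j : measurable_fun setT (\1_(B j) : Omega -> R) by apply: measurable_indic; exact: G1m.
have mD j : measurable_fun setT (\1_(D j) : Omega -> R) by apply: measurable_indic; exact: G2m.
have c4 : `|\int[P]_w (fB w * gD w) - (\int[P]_w fB w) * (\int[P]_w gD w)| <= al * N%:R ^+ 2.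
  rewrite /fB /gD Isum // Isum //.
  have -> : \int[P]_w ((\sum_(j < N) \1_(B j) w) * (\sum_(j < N) \1_(D j) w)) =
     \sum_(i < N) \sum_(j < N) fine (P (B i `&` D j)).
    rewrite pair_big /=.
    transitivity (\int[P]_w (\sum_(p : 'I_N * 'I_N) \1_(B p.1) w * \1_(D p.2) w)).
      by apply: eq_Rintegral => w _; rewrite big_distrlr pair_big.
    rewrite Isum; first by apply: eq_bigr => p _; rewrite IBD.
    - by move=> p; apply: measurable_funM.
    - by move=> p w; rewrite normrM mulr_ile1.
  under [X in _ - X * _]eq_bigr do rewrite IB.
  under [X in _ - _ * X]eq_bigr do rewrite ID.
  rewrite big_distrlr /= -sumrB; apply: le_trans (ler_norm_sum _ _ _) _.
  apply: (@le_trans _ _ (\sum_(i < N) \sum_(j < N) al)).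
    apply: ler_sum => i _; rewrite -sumrB; apply: le_trans (ler_norm_sum _ _ _) _.
    by apply: ler_sum => j _; exact: mixP.
  by rewrite !sumr_const !card_ord -mulrnA -[leLHS]mulr_natr natrM expr2.
have nI (h : Omega -> R) : measurable_fun setT h -> {ae P, forall w, `|h w| <= N%:R} ->
    `|\int[P]_w h w| <= N%:R.
  move=> mh hN; rewrite -[X in `|X|]subr0.
  have -> : 0 = \int[P]_w (0 : R) by rewrite Rintegral_cst // mul0r.
  apply: (@Rintegral_close_cst h (fun=> 0) N%:R 1) => //.
    by apply: aeW => w; rewrite normr0.
  by apply: filterS hN => w; rewrite subr0.
have c5 : `|(\int[P]_w (N%:R * f w)) * (\int[P]_w (N%:R * g w)) -
     (\int[P]_w fB w) * (\int[P]_w gD w)| <= 2 * N%:R.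
  have n1 := nI _ mNg gNb; have n2 := nI _ mfB (aeW P fBn).
  rewrite (_ : _ - _ = (\int[P]_w (N%:R * f w) - \int[P]_w fB w) * (\int[P]_w (N%:R * g w)) +
     (\int[P]_w fB w) * (\int[P]_w (N%:R * g w) - \int[P]_w gD w)); last by ring.
  apply: le_trans (ler_normD _ _) _; rewrite !(normrM (_ - _)) (normrM (\int[P]_w fB w)).
  rewrite mulr2n mulrDl mul1r; apply: lerD.
    by rewrite -[leRHS]mul1r ler_pM.
  by rewrite -[leRHS]mulr1 ler_pM.
have e1 : \int[P]_w ((N%:R * f w) * (N%:R * g w)) = N%:R ^+ 2 * \int[P]_w (f w * g w).
  rewrite -RintegralZl //; apply: eq_Rintegral => w _; ring.
have e2 : (\int[P]_w (N%:R * f w)) * (\int[P]_w (N%:R * g w)) =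
    N%:R ^+ 2 * ((\int[P]_w f w) * (\int[P]_w g w)).
  by rewrite !RintegralZl //; ring.
rewrite e1 in c3; rewrite e2 in c5.
rewrite -[X in _ * X](ger0_norm (sqr_ge0 N%:R)) -normrM mulrBl.
set x := \int[P]_w (f w * g w) in c3 *; set y := (\int[P]_w f w) * (\int[P]_w g w) in c5 *.
rewrite [X in `|X|](_ : _ = (N%:R ^+ 2 * x - \int[P]_w (fB w * gD w)) +
  (\int[P]_w (fB w * gD w) - (\int[P]_w fB w) * (\int[P]_w gD w)) -
  (N%:R ^+ 2 * y - (\int[P]_w fB w) * (\int[P]_w gD w))); last by ring.
apply: le_trans (ler_normB _ _) _; apply: le_trans (lerD (ler_normD _ _) (lexx _)) _.
by move: c3 c4 c5; lra.
Qed.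
End MixingFunctions.

(** * Measurability of matrix-valued maps *)

Section MatrixMeasurability.
Variables (R : realType) (d1 : measure_display) (T : measurableType d1) (d : nat).
Local Notation C := R[i].
Implicit Types (X Y : T -> 'M[C]_d).

Lemma mx_measurable_cst (Z : 'M[C]_d) : mx_measurable (fun _ : T => Z).
Proof. by move=> i j; split; exact: measurable_cst. Qed.

Lemma mx_measurableD X Y : mx_measurable X -> mx_measurable Y ->
  mx_measurable (fun w => X w + Y w).
Proof.
move=> mX mY i j; have [rX iX] := mX i j; have [rY iY] := mY i j.
by split; [under eq_fun do rewrite mxE cReD|under eq_fun do rewrite mxE cImD];
  exact: measurable_funD.
Qed.

Lemma mx_measurableB X Y : mx_measurable X -> mx_measurable Y ->
  mx_measurable (fun w => X w - Y w).
Proof.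
move=> mX mY i j; have [rX iX] := mX i j; have [rY iY] := mY i j.
by split; [under eq_fun do rewrite !mxE cReD cReN|under eq_fun do rewrite !mxE cImD cImN];
  exact: measurable_funB.
Qed.

Lemma mx_measurableZ (h : T -> R) X : measurable_fun setT h -> mx_measurable X ->
  mx_measurable (fun w => (h w)%:C%C *: X w).
Proof.
move=> mh mX i j; have [rX iX] := mX i j; split.
  under eq_fun do rewrite mxE cReM /= mul0r subr0; exact: measurable_funM.
under eq_fun do rewrite mxE cImM /= mul0r addr0; exact: measurable_funM.
Qed.

Lemma mx_measurable_sum (I : Type) (s : seq I) (F : I -> T -> 'M[C]_d) :
  (forall i, mx_measurable (F i)) -> mx_measurable (fun w => \sum_(i <- s) F i w).
Proof.
move=> mF; elim: s => [|x s IH].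
  by under eq_fun do rewrite big_nil; exact: mx_measurable_cst.
by under eq_fun do rewrite big_cons; exact: mx_measurableD.
Qed.

Lemma measurable_Re_tr X : mx_measurable X ->
  measurable_fun setT (fun w => complex.Re (\tr (X w))).
Proof.
move=> mX; under eq_fun do rewrite cRe_sum.
by apply: measurable_sum => i; have [] := mX i i.
Qed.

Lemma measurable_entry_norm X : mx_measurable X ->
  measurable_fun setT (fun w => entry_norm (X w)).
Proof.
move=> mX; apply: measurable_sum => i; apply: measurable_sum => j.
have [rX iX] := mX i j.
by apply: measurable_funD; apply: measurableT_comp => //; exact: measurable_normr.
Qed.

Lemma mx_measurable_ite (h : T -> bool) X Y : measurable_fun setT h ->
  mx_measurable X -> mx_measurable Y -> mx_measurable (fun w => if h w then X w else Y w).
Proof.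
move=> mh mX mY i j; have [rX iX] := mX i j; have [rY iY] := mY i j; split.
  rewrite (_ : (fun _ => _) = fun w => if h w then complex.Re (X w i j) else complex.Re (Y w i j)).
    exact: measurable_fun_ifT.
  by apply/funext => w; case: ifP.
rewrite (_ : (fun _ => _) = fun w => if h w then complex.Im (X w i j) else complex.Im (Y w i j)).
  exact: measurable_fun_ifT.
by apply/funext => w; case: ifP.
Qed.

(** The hypothesis is on products of an entry and a conjugate entry, since a Kraus operator is fixed
    by its map only up to a phase; the sandwich involves [U] only through them. *)
Lemma mx_measurable_sandwich (U : T -> 'M[C]_d) X :
  (forall i k j l, measurable_fun setT (fun w => complex.Re (U w i k * (U w j l)^*)) /\
     measurable_fun setT (fun w => complex.Im (U w i k * (U w j l)^*))) ->
  mx_measurable X -> mx_measurable (fun w => U w *m X w *m adjmx (U w)).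
Proof.
move=> mU mX i j.
have E w : (U w *m X w *m adjmx (U w)) i j =
    \sum_l \sum_k (U w i k * (U w j l)^* * X w k l).
  rewrite mxE; apply: eq_bigr => l _; rewrite !mxE mulr_suml.
  by apply: eq_bigr => k _; rewrite mulrAC.
split.
  under eq_fun do rewrite E cRe_sum.
  apply: measurable_sum => l; under eq_fun do rewrite cRe_sum.
  apply: measurable_sum => k; under eq_fun do rewrite cReM.
  have [? ?] := mU i k j l; have [? ?] := mX k l.
  by apply: measurable_funB; exact: measurable_funM.
under eq_fun do rewrite E cIm_sum.
apply: measurable_sum => l; under eq_fun do rewrite cIm_sum.
apply: measurable_sum => k; under eq_fun do rewrite cImM.
have [? ?] := mU i k j l; have [? ?] := mX k l.
by apply: measurable_funD; exact: measurable_funM.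
Qed.
End MatrixMeasurability.

Lemma mx_measurable_comp (R : realType) (d1 d2 : measure_display)
  (T1 : measurableType d1) (T2 : measurableType d2) (d : nat)
  (X : T2 -> 'M[R[i]]_d) (g : T1 -> T2) : measurable_fun setT g ->
  mx_measurable X -> mx_measurable (fun w => X (g w)).
Proof.
by move=> mg mX i j; have [rX iX] := mX i j; split;
  [exact: (measurableT_comp rX mg)|exact: (measurableT_comp iX mg)].
Qed.

Section WordMeasurability.
Variables (R : realType) (A : finType) (d : nat) (d0 : measure_display) (Omega : measurableType d0).
Variables (V : A -> Omega -> 'M[R[i]]_d) (theta : Omega -> Omega).
Variables (d1 : measure_display) (T : measurableType d1) (g : T -> Omega).

(* Only the products [V_ik conj(V_jl)] are measurable, not the entries of [V]. *)
Definition coef_measurable (t : nat) := forall a i k j l b,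
  measurable_fun setT (fun w => Tcoef V a i k j l b (iter t theta (g w))).

(** [T] may carry a smaller sigma-algebra than [Omega], generated by the environment at certain
    times; hence the record of the times that a word reads. *)
Lemma mx_measurable_Tword t u (X : T -> 'M[R[i]]_d) :
  (forall t', (t <= t' < t + size u)%N -> coef_measurable t') -> mx_measurable X ->
  mx_measurable (fun w => Tword V theta t u (g w) (X w)).
Proof.
elim: u t X => [//|a u IH] t X mC mX /=.
apply: IH => [t' /andP[tt' t'u]|]; first by apply: mC; rewrite (ltnW tt') addnS -addSn.
apply: (mx_measurable_sandwich (U := fun w => V a (iter t theta (g w)))) => // i k j l.
have ct : coef_measurable t by apply: mC; rewrite leqnn addnS ltnS leq_addr.
by split; [exact: (ct a i k j l true)|exact: (ct a i k j l false)].
Qed.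

Lemma mx_measurable_Phin n (X : T -> 'M[R[i]]_d) :
  (forall t', (0 < t' <= n)%N -> coef_measurable t') -> mx_measurable X ->
  mx_measurable (fun w => Phin V theta n (g w) (X w)).
Proof.
move=> mC mX; under eq_fun do rewrite Phin_words.
apply: mx_measurable_sum => u; apply: mx_measurable_Tword => // t'.
by rewrite size_tuple add1n ltnS; exact: mC.
Qed.

Lemma measurable_wordE n F (X : T -> 'M[R[i]]_d) :
  (forall t', (0 < t' <= n)%N -> coef_measurable t') -> mx_measurable X ->
  measurable_fun setT (fun w => wordE V theta n (X w) (g w) F).
Proof.
move=> mC mX; apply: measurable_sum => u; apply: measurable_funM => //.
apply: measurable_Re_tr; apply: mx_measurable_Tword => // t'.
by rewrite size_tuple add1n ltnS; exact: mC.
Qed.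

Lemma mx_measurable_weighted_state n F (X : T -> 'M[R[i]]_d) :
  (forall t', (0 < t' <= n)%N -> coef_measurable t') -> mx_measurable X ->
  mx_measurable (fun w => weighted_state V theta n (X w) (g w) F).
Proof.
move=> mC mX; apply: mx_measurable_sum => u.
apply: mx_measurableZ; first exact: measurable_cst.
by apply: mx_measurable_Tword => // t'; rewrite size_tuple add1n ltnS; exact: mC.
Qed.
End WordMeasurability.

(** * The annealed output process *)

Lemma dN_catl (R : realType) (A : eqType) (b u v : seq A) j : (j + size b <= size u)%N ->
  dN b j.+1 (u ++ v) = dN b j.+1 u :> R.
Proof.
move=> ju; rewrite /dN /= drop_cat; case: ltnP => uj.
  by rewrite takel_cat // size_drop; lia.
(* A window starting at or past the end of [u] fits only if it is empty. *)
have -> : size b = 0%N by lia.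
by rewrite !take0.
Qed.

Lemma dN_catr (R : realType) (A : eqType) (b u v : seq A) j : (size u <= j)%N ->
  dN b j.+1 (u ++ v) = dN b (j - size u).+1 v :> R.
Proof. by move=> uj; rewrite /dN /= drop_cat ltnNge uj. Qed.

Section Process.
Variables (R : realType) (d0 : measure_display) (Omega : measurableType d0).
Variables (P : probability Omega R) (A : finType) (d : nat).
Variables (V : A -> Omega -> 'M[R[i]]_d) (theta thinv : Omega -> Omega).
Local Notation C := R[i].
Local Notation Phin := (Phin V theta).
Local Notation wordE := (wordE V theta).
Local Notation good := (good V theta).
Hypothesis HTmeas : Top_measurable V.
Hypothesis Hkraus : {ae P, forall w, \sum_(a : A) adjmx (V a w) *m V a w = 1%:M}.
Hypothesis Hth_meas : measurable_fun setT theta.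
Hypothesis Hthinv_meas : measurable_fun setT thinv.
Hypothesis Hth_inv1 : cancel theta thinv.
Hypothesis Hth_inv2 : cancel thinv theta.
Hypothesis Hth_pres : preserving P theta.
Variable s : Omega -> 'M[C]_d.
Hypothesis Hs : random_state s.
Hypothesis Hstat : dyn_stationary V theta P s.
Variable rho : nat -> R.
Hypothesis Hrho : forall vth, random_state vth -> forall n, (0 < n)%N ->
  (\int[P]_w (entry_norm (Phin n w (vth w) - s (iter n theta w)))%:E <= (rho n)%:E)%E.

Implicit Types (vth : Omega -> 'M[C]_d) (F G H : seq A -> R) (k l n q : nat).

Let miter k : measurable_fun setT (iter k theta).
Proof. exact: measurable_iter. Qed.
Let miterV k : measurable_fun setT (iter k thinv).
Proof. exact: measurable_iter. Qed.
Let piter k : preserving P (iter k theta).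
Proof. exact: preserving_iter. Qed.
Let piterV k : preserving P (iter k thinv).
Proof. apply: preserving_iter => //; exact: preserving_inverse Hth_pres Hth_inv1. Qed.
Let iterK k : cancel (iter k theta) (iter k thinv).
Proof. by elim: k => // k IH w; rewrite iterSr /= Hth_inv1 IH. Qed.
Let iterVK k : cancel (iter k thinv) (iter k theta).
Proof. by elim: k => // k IH w; rewrite iterSr /= Hth_inv2 IH. Qed.

Lemma ae_good : {ae P, forall w, good w}.
Proof. by apply/ae_foralln => k; exact: (ae_shift (miter k) (@piter k) Hkraus). Qed.

Lemma coef_measurable_comp (g : Omega -> Omega) t : measurable_fun setT g ->
  coef_measurable V theta g t.
Proof.
move=> mg a i k j l b.
exact: (measurableT_comp (HTmeas a i k j l b) (measurableT_comp (miter t) mg)).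
Qed.

Let cm t : coef_measurable V theta (fun w : Omega => w) t.
Proof. exact: coef_measurable_comp. Qed.

Definition annealed vth n F : R := \int[P]_w wordE n (vth w) w F.

Lemma measurable_annealed vth n F : random_state vth ->
  measurable_fun setT (fun w => wordE n (vth w) w F).
Proof. by case=> mv _; exact: (measurable_wordE F (fun t _ => cm t) mv). Qed.

Lemma measurable_shifted vth n F k : random_state vth ->
  measurable_fun setT (fun w => wordE n (vth (iter k theta w)) (iter k theta w) F).
Proof. by move=> /(measurable_annealed n F) m; exact: (measurableT_comp m (miter k)). Qed.

Lemma ae_wordE_le vth n F (M : R) : random_state vth -> (forall u, `|F u| <= M) ->
  {ae P, forall w, `|wordE n (vth w) w F| <= M}.
Proof.
by case=> _ sv FM; apply: filterS ae_good => w Gw; exact: wordE_state_le.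
Qed.

Lemma annealed_drop vth k l H F : random_state vth ->
  (forall u v, size u = k -> size v = l -> H (u ++ v) = F u) ->
  annealed vth (k + l) H = annealed vth k F.
Proof.
move=> rv HE; rewrite /annealed /Rintegral; congr fine.
apply: ae_eq_integral => //.
- by apply/measurable_EFinP; exact: measurable_annealed.
- by apply/measurable_EFinP; exact: measurable_annealed.
- by apply: filterS ae_good => w Gw _; rewrite (wordE_drop _ Gw HE).
Qed.

(** Skipping letters replaces [s] by its evolved state, which is [s] at the shifted environment;
    then [theta] preserves [P]. *)
Lemma annealed_stationary k l H G :
  (forall u v, size u = k -> size v = l -> H (u ++ v) = G v) ->
  annealed s (k + l) H = annealed s l G.
Proof.
move=> HE; rewrite /annealed.
rewrite -(Rintegral_shift (miter k) (@piter k) (measurable_annealed l G Hs)).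
rewrite /Rintegral; congr fine; apply: ae_eq_integral => //.
- by apply/measurable_EFinP; exact: measurable_annealed.
- by apply/measurable_EFinP; exact: measurable_shifted.
- by apply: filterS (Hstat k) => w sw _; rewrite (wordE_skip _ _ _ _ HE) sw.
Qed.

Let gap vth n w : R := entry_norm (Phin n w (vth w) - s (iter n theta w)).

Lemma measurable_gap vth n : random_state vth ->
  measurable_fun setT (fun w => entry_norm (Phin n w (vth w) - s (iter n theta w))).
Proof.
case=> mv _; apply: measurable_entry_norm; apply: mx_measurableB.
  exact: (mx_measurable_Phin (fun t _ => cm t) mv).
by case: Hs => ms _; exact: (mx_measurable_comp (miter n) ms).
Qed.

Let mgap vth n : random_state vth -> measurable_fun setT (gap vth n).
Proof. exact: measurable_gap. Qed.

Let gap_ge0 vth n w : 0 <= gap vth n w. Proof. exact: entry_norm_ge0. Qed.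

Let gap_shift (g : Omega -> Omega) vth n : measurable_fun setT g -> preserving P g ->
  random_state vth -> (0 < n)%N -> (\int[P]_w (gap vth n (g w))%:E <= (rho n)%:E)%E.
Proof.
move=> mg pg rv n0.
rewrite (ge0_integral_shift mg pg (f := fun w => (gap vth n w)%:E)).
- exact: Hrho.
- by apply/measurable_EFinP; exact: mgap.
- by move=> w; rewrite lee_fin.
Qed.

(** Both expectations depend on the initial state only through its evolution over the [k] skipped
    letters, to which (H3) applies. *)
Lemma annealed_forget vth k l H G (M : R) : random_state vth -> (0 < k)%N ->
  (forall u, `|H u| <= M) ->  (forall u, `|G u| <= M) ->
  (forall u v, size u = k -> size v = l -> H (u ++ v) = G v) ->
  `|annealed vth (k + l) H - annealed s (k + l) H| <= M * d%:R * rho k.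
Proof.
move=> rv k0 HM GM HE.
have M0 : 0 <= M by apply: le_trans (HM [::]).
apply: (@Rintegral_close _ _ _ P _ _ (gap vth k) M M).
- exact: measurable_annealed.
- exact: measurable_annealed.
- exact: mgap.
- exact: ae_wordE_le.
- exact: ae_wordE_le.
- exact: gap_ge0.
- exact: mulr_ge0.
- exact: Hrho.
- apply: filterS2 ae_good (Hstat k) => w Gw sw.
  rewrite !(wordE_skip _ _ _ _ HE) sw -wordEB -mulrA.
  by apply: wordE_le => //; exact: good_iter.
Qed.

Lemma is_state_mix (X Y : 'M[C]_d) (t : R) : psdmx X -> \tr X = t%:C%C -> t <= 1 ->
  is_state Y -> is_state (X + (1 - t)%:C%C *: Y).
Proof.
move=> X0 Xt t1 [Y0 Y1]; split.
  by apply: psdmxD => //; apply: psdmxZ => //; rewrite ler0c subr_ge0.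
by rewrite mxtraceD mxtraceZ Y1 Xt mulr1 -(rmorphD (real_complex R)) addrC subrK.
Qed.

Let cwordE_close k F w (X Y : 'M[C]_d) (M : R) : good w -> (forall u, `|F u| <= M) ->
  `|wordE k X w F - wordE k Y w F| <= M * d%:R * entry_norm (X - Y).
Proof. by move=> Gw FM; rewrite -wordEB -mulrA; exact: wordE_le. Qed.

(** (H3) is applied to an initial state that encodes the past word. Its evolution starts at
    [iter k theta w], so the past is read at [iter k thinv w]. A random state must be a state at
    every point, while the weight [t] is at most 1 only almost everywhere; hence the conditional in
    [th]. *)
Lemma annealed_memory k q l H F G : (0 < q)%N ->
  (forall u, `|H u| <= 1) -> (forall u, 0 <= F u <= 1) -> (forall u, `|G u| <= 1) ->
  (forall u v x, size u = k -> size v = q -> size x = l -> H (u ++ v ++ x) = F u * G x) ->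
  `|annealed s (k + (q + l)) H -
    \int[P]_w (wordE k (s w) w F *
       wordE l (s (iter (q + k) theta w)) (iter (q + k) theta w) G)| <= d%:R * rho q.
Proof.
move=> q0 HM F01 GM HE.
have Fn u : `|F u| <= 1 by have /andP[? ?] := F01 u; rewrite ger0_norm.
case: (Hs) => ms ss.
pose Y w := weighted_state V theta k (s w) w F.
pose t w := wordE k (s w) w F.
have mY : mx_measurable Y by exact: (mx_measurable_weighted_state F (fun t _ => cm t) ms).
have mt : measurable_fun setT t by exact: measurable_annealed.
have Y0 w : psdmx (Y w).
  apply: psdmx_weighted_state; last by case: (ss w).
  by move=> u; have /andP[] := F01 u.
have Yt w : \tr (Y w) = (t w)%:C%C.
  have [_ im0] := ge0_ReIm (psdmx_tr_ge0 (Y0 w)).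
  by apply/eqP; rewrite eq_complex im0 tr_weighted_state /t !eqxx.
(* the state [Y + (1 - t) s] is an admissible initial state, and subtracting
   the stationary orbit from its evolution leaves exactly [Phin Y - t s] *)
pose th w := if t (iter k thinv w) <= 1
  then Y (iter k thinv w) + (1 - t (iter k thinv w))%:C%C *: s w else s w.
have rth : random_state th.
  split; last by move=> w; rewrite /th; case: ifP => [t1|_] //; exact: is_state_mix.
  have mt' := measurableT_comp mt (miterV k).
  apply: mx_measurable_ite => //.
  - by apply: measurable_fun_ler => //; exact: measurable_cst.
  - apply: mx_measurableD; first exact: (mx_measurable_comp (miterV k) mY).
    apply: mx_measurableZ => //; apply: measurable_funB => //.
have E2 : {ae P, forall w, wordE (k + (q + l)) (s w) w H =
    wordE l (Phin q (iter k theta w) (Y w)) (iter (q + k) theta w) G}.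
  apply: aeW => w.
  rewrite (@wordE_cat _ _ _ _ _ V theta k (q + l) (s w) w H F (fun z => G (drop q z))); last first.
    move=> u z uk zl; have sv : size (take q z) = q by rewrite size_takel // zl leq_addr.
    have sx : size (drop q z) = l by rewrite size_drop zl addKn.
    by rewrite -(HE u (take q z) (drop q z)) // cat_take_drop.
  rewrite (@wordE_skip _ _ _ _ _ V theta q l _ _ _ G) ?iterD //.
  by move=> v x vq xl; rewrite drop_size_cat.
have mprod : measurable_fun setT (fun w => t w *
    wordE l (s (iter (q + k) theta w)) (iter (q + k) theta w) G).
  by apply: measurable_funM => //; exact: measurable_shifted.
rewrite -[d%:R]mul1r.
apply: (@Rintegral_close _ _ _ P _ _ (fun w => gap th q (iter k theta w)) 1 1) => //.
- exact: measurable_annealed.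
- by have := measurableT_comp (mgap q rth) (miter k).
- exact: ae_wordE_le.
- apply: filterS ae_good => w Gw; rewrite normrM mulr_ile1 //.
    by apply: wordE_state_le.
  by apply: wordE_state_le => //; exact: good_iter.
- exact: gap_shift.
- have Est := ae_shift (miter k) (@piter k) (Hstat q).
  apply: filterS3 ae_good E2 Est => w Gw -> st.
  rewrite -wordEZ.
  apply: le_trans (@cwordE_close l G _ _ _ 1 (good_iter _ Gw) GM) _.
  rewrite /gap /th iterK.
  have -> : t w <= 1 by have /andP[] := wordE_state01 k Gw (ss w) F01.
  rewrite PhinD PhinZ st -iterD le_eqVlt; apply/orP; left; apply/eqP.
  congr (_ * entry_norm _).
  rewrite rmorphB rmorph1 scalerBl scale1r -addrA; congr (_ + _).
  by rewrite addrAC subrr add0r.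
Qed.

(** A deterministic initial state, from which [s] is rebuilt through the recent environment
    alone. *)
Let sig0 : Omega -> 'M[C]_d := fun=> s point.
Let rsig0 : random_state sig0.
Proof. by case: Hs => _ ss; split; [exact: mx_measurable_cst|move=> w; exact: ss]. Qed.

Lemma iterz_add (j : int) k w : iterz theta thinv j (iter k theta w) =
  iterz theta thinv (j + k%:Z) w.
Proof.
case: j => n; first by rewrite (_ : Posz n + k%:Z = (n + k)%N%:Z) //= iterD.
rewrite /=; case: (leqP n.+1 k) => nk.
  have -> : Negz n + k%:Z = (k - n.+1)%N%:Z by lia.
  by rewrite /= -{1}(subnK nk) addnC iterD /= -/(iter n.+1 thinv _) iterK.
have -> : Negz n + k%:Z = Negz (n - k) by lia.
rewrite /= -/(iter n.+1 thinv _) -/(iter (n - k).+1 thinv _).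
rewrite (_ : n.+1 = ((n - k).+1 + k)%N); last by lia.
by rewrite iterD iterK.
Qed.

Lemma coef_gen (J : set int) j a (i k j' l : 'I_d) b : J j ->
  measurable_fun setT (fun w : g_sigma_algebraType (env_gen V theta thinv J) =>
    Tcoef V a i k j' l b (iterz theta thinv j w)).
Proof.
move=> Jj _ D mD; rewrite setTI; apply: sub_sigma_algebra.
by exists j, a, i, k, j', l, b, D.
Qed.

Lemma env_gen_measurable (J : set int) B : <<s env_gen V theta thinv J >> B -> measurable B.
Proof.
apply: smallest_sub; first exact: sigma_algebra_measurable.
move=> _ [j [a [i [k [j' [l [b [D [Jj [mD ->]]]]]]]]]].
rewrite -[X in measurable X]setTI.
suff mz : measurable_fun setT (iterz theta thinv j).
  by have mc := measurableT_comp (HTmeas a i k j' l b) mz; apply: mc.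
by case: j {Jj} => n; [exact: miter|exact: (miterV n.+1)].
Qed.

(** [sup] is an upper bound only for a bounded set; here 1 is a bound. *)
Lemma alpha_mix_ub n (k : int) B D : Fpast V theta thinv k B ->
  Ffut V theta thinv (k + n%:Z) D ->
  `|fine (P (B `&` D)) - fine (P B) * fine (P D)| <= alpha_mix V theta thinv P n.
Proof.
move=> FB FD; apply: ub_le_sup; last by exists k, B, D.
exists 1 => _ [k' [B' [D' [FB' [FD' ->]]]]].
have pr E : measurable E -> 0 <= fine (P E) <= 1.
  move=> mE; rewrite fine_ge0 //= -[leRHS]/(fine 1%E) fine_le ?probability_le1 //.
  exact: fin_num_measure.
have mB := env_gen_measurable FB'; have mD := env_gen_measurable FD'.
have /andP[? ?] := pr _ mB; have /andP[? ?] := pr _ mD.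
have /andP[? ?] := pr _ (measurableI _ _ mB mD).
have : fine (P B') * fine (P D') <= 1 by exact: mulr_ile1.
have : 0 <= fine (P B') * fine (P D') by exact: mulr_ge0.
by move=> *; rewrite ler_norml; apply/andP; split; lra.
Qed.

Lemma alpha_mix_ge0 n : 0 <= alpha_mix V theta thinv P n.
Proof.
apply: le_trans (normr_ge0 _) (@alpha_mix_ub n 0 set0 set0 _ _).
  by move=> B [[B0 _ _] _].
by move=> B [[B0 _ _] _].
Qed.

Lemma iter_iterV t n w : iter t theta (iter n thinv w) =
  iterz theta thinv (t%:Z - n%:Z) w.
Proof. by rewrite -{2}(iterVK n w) iterz_add subrK. Qed.

Lemma entry_normC (X Y : 'M[C]_d) : entry_norm (X - Y) = entry_norm (Y - X).
Proof.
rewrite /entry_norm; apply: eq_bigr => i _; apply: eq_bigr => j _.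
rewrite -(opprB Y X) !mxE cReN cImN !normrN.
by [].
Qed.

Let Rint_le1 (f : Omega -> R) : measurable_fun setT f -> {ae P, forall w, `|f w| <= 1} ->
  `|\int[P]_w f w| <= 1.
Proof.
move=> mf f1; rewrite -[X in `|X|]subr0.
have -> : 0 = \int[P]_w (0 : R) by rewrite Rintegral_cst // mul0r.
apply: (@Rintegral_close_cst _ _ _ P f (fun=> 0) 1 1) => //.
  by apply: aeW => w; rewrite normr0.
by apply: filterS f1 => w; rewrite subr0.
Qed.

(* Approximates [s w] using the environment at times in [(-n, 0]] only. *)
Let past n w := Phin n (iter n thinv w) (s point).

Let is_state_past n w : good (iter n thinv w) -> is_state (past n w).
Proof. by move=> G; apply: is_state_Phin => //; case: Hs. Qed.

(** [s] is measurable for the full sigma-algebra only, so both copies of it are replaced by states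
    rebuilt from finitely many times. Before the gap the horizon [n] is free, as all these times are
    past; after it the horizon [q'] reaches back into the gap and leaves the separation
    [(q - q').+1]. Each replacement is paid twice, in the mean of the product and in the product of
    means. *)
Let env_mixing n k q q' l F G : (0 < n)%N -> (0 < q')%N -> (q' <= q)%N ->
  (forall u, 0 <= F u <= 1) -> (forall u, 0 <= G u <= 1) ->
  `|\int[P]_w (wordE k (s w) w F *
       wordE l (s (iter (q + k) theta w)) (iter (q + k) theta w) G)
    - annealed s k F * annealed s l G|
  <= 2 * (d%:R * (rho n + rho q')) + alpha_mix V theta thinv P (q - q').+1.
Proof.
move=> n0 q'0 q'q F01 G01.
have Fn u : `|F u| <= 1 by have /andP[? ?] := F01 u; rewrite ger0_norm.
have Gn u : `|G u| <= 1 by have /andP[? ?] := G01 u; rewrite ger0_norm.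
case: (Hs) => ms ss.
pose t w := wordE k (s w) w F.
pose g w := wordE l (s (iter (q + k) theta w)) (iter (q + k) theta w) G.
pose tl w := wordE k (past n w) w F.
pose h w := wordE l (past q' (iter (q + k) theta w)) (iter (q + k) theta w) G.
pose gap1 w := gap sig0 n (iter n thinv w).
pose gap2 w := gap sig0 q' (iter q' thinv (iter (q + k) theta w)).
have mg2 : measurable_fun setT (fun w => iter q' thinv (iter (q + k) theta w)).
  exact: (measurableT_comp (miterV q') (miter (q + k))).
have pg2 : preserving P (fun w => iter q' thinv (iter (q + k) theta w)).
  move=> B mB; have mB' : measurable (iter q' thinv @^-1` B).
    by rewrite -[X in measurable X]setTI; exact: (miterV q').
  by rewrite -(@piterV q' B mB) -(@piter (q + k) _ mB').
have mgap1 : measurable_fun setT gap1.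
  exact: (measurableT_comp (mgap n rsig0) (miterV n)).
have mgap2 : measurable_fun setT gap2 by exact: (measurableT_comp (mgap q' rsig0) mg2).
have mpast (i : nat) (f : Omega -> Omega) : measurable_fun setT f ->
    mx_measurable (fun w => past i (f w)).
  move=> mf; apply: (@mx_measurable_Phin _ _ _ _ _ V theta _ _ (fun w => iter i thinv (f w))).
    by move=> t' _; apply: coef_measurable_comp; exact: (measurableT_comp (miterV i) mf).
  exact: mx_measurable_cst.
have mt : measurable_fun setT t by exact: measurable_annealed.
have mg : measurable_fun setT g by exact: measurable_shifted.
have mtl : measurable_fun setT tl.
  apply: (@measurable_wordE _ _ _ _ _ V theta _ _ (fun w => w)); first by move=> t' _; exact: cm.
  exact: (mpast n (fun w => w)).
have mh : measurable_fun setT h.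
  apply: (@measurable_wordE _ _ _ _ _ V theta _ _ (fun w => iter (q + k) theta w)).
    by move=> t' _; exact: coef_measurable_comp.
  exact: mpast.
have g1 : {ae P, forall w, good (iter n thinv w)} by exact: (ae_shift (miterV n) (@piterV n) ae_good).
have g2 : {ae P, forall w, good (iter q' thinv (iter (q + k) theta w))}.
  exact: (ae_shift mg2 pg2 ae_good).
have t1 : {ae P, forall w, `|t w| <= 1} by exact: ae_wordE_le.
have gb1 : {ae P, forall w, `|g w| <= 1}.
  by apply: filterS ae_good => w Gw; apply: wordE_state_le => //; exact: good_iter.
have tl01 : {ae P, forall w, 0 <= tl w <= 1}.
  by apply: filterS2 ae_good g1 => w Gw G1; apply: wordE_state01 => //; exact: is_state_past.
have h01 : {ae P, forall w, 0 <= h w <= 1}.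
  apply: filterS2 ae_good g2 => w Gw G2; apply: wordE_state01 => //; first exact: good_iter.
  exact: is_state_past.
have tl1 : {ae P, forall w, `|tl w| <= 1}.
  by apply: filterS tl01 => w /andP[? ?]; rewrite ger0_norm.
have h1 : {ae P, forall w, `|h w| <= 1}.
  by apply: filterS h01 => w /andP[? ?]; rewrite ger0_norm.
have ct : {ae P, forall w, `|t w - tl w| <= d%:R * gap1 w}.
  apply: filterS ae_good => w Gw; apply: le_trans (@cwordE_close k F _ _ _ 1 Gw Fn) _.
  by rewrite mul1r entry_normC /gap1 /gap iterVK.
have cg : {ae P, forall w, `|g w - h w| <= d%:R * gap2 w}.
  apply: filterS ae_good => w Gw.
  apply: le_trans (@cwordE_close l G _ _ _ 1 (good_iter _ Gw) Gn) _.
  by rewrite mul1r entry_normC /gap2 /gap iterVK.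
have p1 w : 0 <= gap1 w by exact: gap_ge0.
have p2 w : 0 <= gap2 w by exact: gap_ge0.
have i1 : (\int[P]_w (gap1 w)%:E <= (rho n)%:E)%E by exact: gap_shift.
have i2 : (\int[P]_w (gap2 w)%:E <= (rho q')%:E)%E by exact: gap_shift.
have e1 : `|\int[P]_w t w - \int[P]_w tl w| <= d%:R * rho n.
  by apply: (@Rintegral_close _ _ _ P t tl gap1 1 1).
have e2 : `|\int[P]_w g w - \int[P]_w h w| <= d%:R * rho q'.
  by apply: (@Rintegral_close _ _ _ P g h gap2 1 1).
have e3 : `|\int[P]_w (t w * g w) - \int[P]_w (tl w * h w)| <= d%:R * (rho n + rho q').
  apply: (@Rintegral_close _ _ _ P _ _ (fun w => gap1 w + gap2 w) 1 1) => //.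
  - exact: measurable_funM.
  - exact: measurable_funM.
  - exact: measurable_funD.
  - by apply: filterS2 t1 gb1 => w ? ?; rewrite normrM mulr_ile1.
  - by apply: filterS2 tl1 h1 => w ? ?; rewrite normrM mulr_ile1.
  - by move=> w; rewrite addr_ge0.
  - under eq_integral do rewrite EFinD.
    rewrite ge0_integralD //; first by rewrite EFinD leeD.
    + by move=> w _; rewrite lee_fin.
    + exact/measurable_EFinP.
    + by move=> w _; rewrite lee_fin.
    + exact/measurable_EFinP.
  - have gt1 : {ae P, forall w, `|g w| <= 1 /\ `|tl w| <= 1} by apply: filterS2 gb1 tl1.
    apply: filterS3 ct cg gt1 => w a1 a2 [a3 a4].
    rewrite [X in `|X|](_ : _ = (t w - tl w) * g w + tl w * (g w - h w)); last by ring.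
    apply: le_trans (ler_normD _ _) _; rewrite [leRHS]mulrDr.
    apply: lerD; rewrite normrM; first by apply: le_trans (ler_wpM2l (normr_ge0 _) a3) _; rewrite mulr1.
    by apply: le_trans (ler_wpM2r (normr_ge0 _) a4) _; rewrite mul1r.
pose J1 : set int := [set j | (j <= k%:Z)%R].
(* The state rebuilt over [q'] steps up to time [q + k] first reads time [q + k - q' + 1]. *)
pose J2 : set int := [set j | (k%:Z + (q - q').+1%:Z <= j)%R].
have mtl1 : measurable_fun setT (tl : g_sigma_algebraType (env_gen V theta thinv J1) -> R).
  apply: (@measurable_wordE _ _ _ _ _ V theta _ (g_sigma_algebraType (env_gen V theta thinv J1)) (fun w => w)).
    move=> t' /andP[_ tk] a i k1 j l1 b; apply: (@coef_gen J1 t'%:Z).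
    by rewrite /J1 /= lez_nat.
  apply: (@mx_measurable_Phin _ _ _ _ _ V theta _ (g_sigma_algebraType (env_gen V theta thinv J1)) (fun w => iter n thinv w)).
    move=> t' /andP[_ tn] a i k1 j l1 b; under eq_fun do rewrite iter_iterV.
    by apply: coef_gen; rewrite /J1 /=; lia.
  exact: mx_measurable_cst.
have mh2 : measurable_fun setT (h : g_sigma_algebraType (env_gen V theta thinv J2) -> R).
  apply: (@measurable_wordE _ _ _ _ _ V theta _ (g_sigma_algebraType (env_gen V theta thinv J2)) (fun w => iter (q + k) theta w)).
    move=> t' /andP[t0 _] a i k1 j l1 b; under eq_fun do rewrite -iterD.
    by apply: (@coef_gen J2 (t' + (q + k))%N%:Z); rewrite /J2 /=; lia.
  apply: (@mx_measurable_Phin _ _ _ _ _ V theta _ (g_sigma_algebraType (env_gen V theta thinv J2)) (fun w => iter q' thinv (iter (q + k) theta w))).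
    move=> t' /andP[t0 _] a i k1 j l1 b; under eq_fun do rewrite iter_iterV iterz_add.
    by apply: coef_gen; rewrite /J2 /=; lia.
  exact: mx_measurable_cst.
have e4 := cov_le_mixing (@env_gen_measurable J1) (@env_gen_measurable J2)
  (@alpha_mix_ub (q - q').+1 k%:Z) mtl1 mh2 tl01 h01.
have gE : annealed s l G = \int[P]_w g w.
  by rewrite /annealed -(Rintegral_shift (miter (q + k)) (@piter (q + k)) (measurable_annealed l G Hs)).
have tE : annealed s k F = \int[P]_w t w by [].
rewrite gE tE.
have n1 := Rint_le1 mg gb1; have n2 := Rint_le1 mtl tl1.
have e5 : `|(\int[P]_w t w) * (\int[P]_w g w) - (\int[P]_w tl w) * (\int[P]_w h w)|
    <= d%:R * (rho n + rho q').
  rewrite [X in `|X|](_ : _ = (\int[P]_w t w - \int[P]_w tl w) * (\int[P]_w g w) +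
    (\int[P]_w tl w) * (\int[P]_w g w - \int[P]_w h w)); last by ring.
  apply: le_trans (ler_normD _ _) _.
  rewrite [leRHS]mulrDr; apply: lerD; rewrite normrM.
    by apply: le_trans (ler_wpM2l (normr_ge0 _) n1) _; rewrite mulr1.
  by apply: le_trans (ler_wpM2r (normr_ge0 _) n2) _; rewrite mul1r.
rewrite [X in `|X|](_ : _ = (\int[P]_w (t w * g w) - \int[P]_w (tl w * h w)) +
  (\int[P]_w (tl w * h w) - (\int[P]_w tl w) * (\int[P]_w h w)) -
  ((\int[P]_w t w) * (\int[P]_w g w) - (\int[P]_w tl w) * (\int[P]_w h w))); last by ring.
apply: le_trans (ler_normB _ _) _; apply: le_trans (lerD (ler_normD _ _) (lexx _)) _.
by move: e3 e4 e5; lra.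
Qed.

Hypothesis rho_small : forall e : R, 0 < e -> exists2 n, (0 < n)%N & rho n <= e.

(* A gap of length [q] is split in two: one half lets the state after the gap
   be rebuilt from recent times, the other separates the environments. *)
Definition bmix q : R := d%:R * rho q + 2 * (d%:R * rho q./2) +
  alpha_mix V theta thinv P (q - q./2).+1.

Lemma annealed_mixing01 k q l H F G : (1 < q)%N ->
  (forall u, `|H u| <= 1) -> (forall u, 0 <= F u <= 1) -> (forall u, 0 <= G u <= 1) ->
  (forall u v x, size u = k -> size v = q -> size x = l -> H (u ++ v ++ x) = F u * G x) ->
  `|annealed s (k + (q + l)) H - annealed s k F * annealed s l G| <= bmix q.
Proof.
move=> q1 HM F01 G01 HE.
have Gn u : `|G u| <= 1 by have /andP[? ?] := G01 u; rewrite ger0_norm.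
have q2 : (0 < q./2)%N by rewrite half_gt0.
have q2q : (q./2 <= q)%N by have := odd_double_half q; rewrite -addnn; lia.
have m1 := annealed_memory (ltnW q1) HM F01 Gn HE.
apply/ler_addgt0Pr => e e0.
(* The horizon [n] occurs only in the error, so its contribution can be made arbitrarily small. *)
have e1 : 0 < e / (2 * d%:R + 1) by rewrite divr_gt0 // ltr_wpDl // mulr_ge0.
have [n n0 rn] := rho_small e1.
have m2 := @env_mixing n k q q./2 l F G n0 q2 q2q F01 G01.
apply: le_trans (ler_distD _ _ _) _; apply: le_trans (lerD m1 m2) _.
have : 2 * (d%:R * rho n) <= e.
  have dp : 0 < 2 * d%:R + 1 :> R by rewrite ltr_wpDl // mulr_ge0.
  move: rn; rewrite ler_pdivlMr // => rn.
  have [r0|r0] := leP 0 (rho n); last first.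
    by apply: le_trans (ltW e0); rewrite mulrA mulr_ge0_le0 ?mulr_ge0 // ltW.
  by rewrite mulrDr mulr1 in rn; move: r0 rn; rewrite (mulrC (rho n)) -mulrA; lra.
by rewrite /bmix; lra.
Qed.

Definition wlaw vth n (u : n.-tuple A) : R := \int[P]_w qprob V theta (vth w) w u.

(** Passes from integrals over the environment to weighted sums over words, the setting of the block
    argument. *)
Lemma annealed_Ex vth n F : random_state vth ->
  annealed vth n F = Ex (@wlaw vth n) (fun u => F u).
Proof.
move=> rv; have mv := rv.1.
have iq (u : n.-tuple A) : P.-integrable setT (fun w => (qprob V theta (vth w) w u)%:E).
  apply: (@ae_bounded_integrable _ _ _ P _ 1).
    apply: measurable_Re_tr; apply: (mx_measurable_Tword (g := fun w => w)) => //.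
  apply: filterS ae_good => w Gw; rewrite ger0_norm; last by apply: qprob_ge0; case: (rv.2 w).
  have := qprob_total n (vth w) Gw; have [v0 ->] := rv.2 w => /= <-.
  by rewrite (bigD1 u) //= lerDl sumr_ge0 // => v _; exact: qprob_ge0.
rewrite /annealed /wordE /Rintegral /Ex.
under eq_integral do rewrite -sumEFin.
rewrite integral_sum //; last first.
  move=> u; have := integrableZl measurableT (F u) (iq u).
  by apply: eq_integrable => // w _; rewrite -EFinM mulrC.
rewrite -sum_fine; last first.
  move=> u _; apply: integrable_fin_num => //.
  have := integrableZl measurableT (F u) (iq u).
  by apply: eq_integrable => // w _; rewrite -EFinM mulrC.
apply: eq_bigr => u _; rewrite /wlaw mulrC.
rewrite -(@RintegralZl _ _ _ P setT (fun w => qprob V theta (vth w) w u) (F u) measurableT (iq u)).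
by congr fine; apply: eq_integral => w _; rewrite mulrC.
Qed.

Lemma wlaw_ge0 vth n (u : n.-tuple A) : random_state vth -> 0 <= wlaw vth u.
Proof. by move=> [_ sv]; apply: Rintegral_ge0 => w _; apply: qprob_ge0; case: (sv w). Qed.

Lemma wlaw_sum1 vth n : random_state vth -> \sum_(u : n.-tuple A) wlaw vth u = 1.
Proof.
move=> rv; have := annealed_Ex n (fun=> 1) rv; rewrite /Ex.
under eq_bigr do rewrite mulr1; move=> <-.
rewrite [RHS](_ : 1 = \int[P]_w (1 : R)); last first.
  by rewrite /Rintegral integral_cst // mul1e -[LHS]/(fine 1%E); congr fine; symmetry; exact: probability_setT.
rewrite /annealed /Rintegral; congr fine; apply: ae_eq_integral => //.
- by apply/measurable_EFinP; exact: measurable_annealed.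
- apply: filterS ae_good => w Gw _; congr EFin; rewrite /wordE.
  under eq_bigr do rewrite mulr1.
  by rewrite qprob_total // (rv.2 w).2.
Qed.

(** Both functions are rescaled affinely to [[0, 1]]. The additive constants cancel in the
    covariance because the word laws are consistent and stationary, and the slopes [2 * M1] and
    [2 * M2] give the factor. *)
Lemma annealed_mixing k q l H F G (M1 M2 : R) : (1 < q)%N ->
  (forall u, `|F u| <= M1) -> (forall u, `|G u| <= M2) ->
  (forall u v x, size u = k -> size v = q -> size x = l -> H (u ++ v ++ x) = F u * G x) ->
  `|annealed s (k + (q + l)) H - annealed s k F * annealed s l G| <= 4 * M1 * M2 * bmix q.
Proof.
move=> q1 FM GM HE.
have M10 : 0 <= M1 by apply: le_trans (FM [::]).
have M20 : 0 <= M2 by apply: le_trans (GM [::]).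
(* For [M = 0] division by zero gives 0, so [aff] is one half and still inverts correctly at
   [x = 0]. *)
pose aff (M x : R) := (x / M + 1) / 2.
have aff01 (M x : R) : 0 <= M -> `|x| <= M -> 0 <= aff M x <= 1.
  rewrite /aff le_eqVlt => /predU1P[<-|M0]; first by rewrite invr0 mulr0; lra.
  have : `|x| <= M -> `|x / M| <= 1.
    by rewrite normrM normfV (ger0_norm (ltW M0)) ler_pdivrMr // mul1r.
  by move=> h /h; rewrite ler_norml => /andP[? ?]; apply/andP; split; lra.
have affE (M x : R) : 0 <= M -> `|x| <= M -> x = 2 * M * aff M x - M.
  rewrite /aff le_eqVlt => /predU1P[<-|M0]; last by move=> _; field; rewrite gt_eqF.
  by rewrite normr_le0 => /eqP ->; rewrite mulr0 mul0r subr0.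
pose F' u := aff M1 (F u); pose G' u := aff M2 (G u).
have F'01 u : 0 <= F' u <= 1 by exact: aff01.
have G'01 u : 0 <= G' u <= 1 by exact: aff01.
pose H' u := F' (take k u) * G' (drop (k + q) u).
have H'M u : `|H' u| <= 1.
  have /andP[? ?] := F'01 (take k u); have /andP[? ?] := G'01 (drop (k + q) u).
  by rewrite normrM !ger0_norm // mulr_ile1.
have H'E u v x : size u = k -> size v = q -> size x = l -> H' (u ++ v ++ x) = F' u * G' x.
  by move=> uk vq xl; rewrite /H' take_size_cat // catA drop_size_cat // size_cat uk vq.
have mx := annealed_mixing01 q1 H'M F'01 G'01 H'E.
have EF : annealed s k F = 2 * M1 * annealed s k F' - M1.
  rewrite !annealed_Ex // -ExZ.
  rewrite -[X in _ - X](Ex_cst (wlaw_sum1 k Hs)) -ExB; apply: eq_Ex => u.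
  exact: affE.
have EG : annealed s l G = 2 * M2 * annealed s l G' - M2.
  rewrite !annealed_Ex // -ExZ.
  rewrite -[X in _ - X](Ex_cst (wlaw_sum1 l Hs)) -ExB; apply: eq_Ex => u.
  exact: affE.
have EFd : annealed s (k + (q + l)) (fun u => F' (take k u)) = annealed s k F'.
  by apply: annealed_drop => // u v uk _; rewrite take_size_cat.
have EGd : annealed s (k + (q + l)) (fun u => G' (drop (k + q) u)) = annealed s l G'.
  rewrite addnA; apply: annealed_stationary => u v uk _.
  by rewrite drop_size_cat.
have EH : annealed s (k + (q + l)) H = 4 * M1 * M2 * annealed s (k + (q + l)) H'
   - 2 * M1 * M2 * annealed s k F' - 2 * M1 * M2 * annealed s l G' + M1 * M2.
  rewrite -EFd -EGd !annealed_Ex // -!ExZ -!ExB.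
  rewrite -[X in _ + X](Ex_cst (wlaw_sum1 (k + (q + l)) Hs)) -ExD; apply: eq_Ex => u.
  have su := size_tuple u.
  have tk : size (take k u) = k by rewrite size_takel // su leq_addr.
  have tq : size (take q (drop k u)) = q by rewrite size_takel // size_drop su addKn leq_addr.
  have tl : size (drop (k + q) u) = l by rewrite size_drop su addnA addKn.
  have uE : tval u = take k u ++ take q (drop k u) ++ drop (k + q) u.
    by have := drop_drop u q k; rewrite [(q + k)%N]addnC => <-; rewrite !cat_take_drop.
  rewrite [in LHS]uE HE // {1}(affE _ (F (take k u)) M10 (FM _)).
  by rewrite {1}(affE _ (G (drop (k + q) u)) M20 (GM _)) /H' /F' /G'; ring.
rewrite EF EG EH [X in `|X|](_ : _ = 4 * M1 * M2 *
  (annealed s (k + (q + l)) H' - annealed s k F' * annealed s l G')); last by ring.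
by rewrite normrM ger0_norm ?mulr_ge0 // ler_wpM2l ?mulr_ge0.
Qed.


(** * Centred occurrences of a pattern *)

Section Cylinder.
Variables (m : nat) (b : m.-tuple A).
Let mu := wlaw s b.
Let X j (u : seq A) : R := dN b j.+1 u - mu.

Lemma cyl_mean01 : 0 <= mu <= 1.
Proof.
rewrite wlaw_ge0 //= -(wlaw_sum1 m Hs) (bigD1 b) //= lerDl.
by apply: sumr_ge0 => u _; exact: wlaw_ge0.
Qed.

Lemma cyl_le1 j u : `|X j u| <= 1.
Proof.
have /andP[? ?] := cyl_mean01.
by rewrite /X /dN; case: (_ == _); rewrite ler_norml /=; apply/andP; split; lra.
Qed.

Lemma cyl_catl j (u v : seq A) : (j + m <= size u)%N -> X j (u ++ v) = X j u.
Proof. by move=> ju; rewrite /X dN_catl // size_tuple. Qed.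

Lemma cyl_catr j (u v : seq A) : (size u <= j)%N -> X j (u ++ v) = X (j - size u) v.
Proof. by move=> uj; rewrite /X dN_catr. Qed.

Lemma cyl_mean0 N j : (j + m <= N)%N -> annealed s N (X j) = 0.
Proof.
move=> jN; have -> : N = (j + (m + (N - j - m)))%N by lia.
rewrite (@annealed_stationary j _ _ (X 0)); last first.
  by move=> u v uj _; rewrite cyl_catr uj // subnn.
rewrite (@annealed_drop s m _ _ (X 0)) //; last first.
  by move=> u v um _; rewrite cyl_catl ?um.
rewrite annealed_Ex // ExB Ex_cst ?wlaw_sum1 //.
apply/eqP; rewrite subr_eq0; apply/eqP; rewrite /Ex (bigD1 b) //= big1 ?addr0.
  by rewrite /dN /= drop0 take_oversize ?size_tuple // eqxx mulr1.
move=> u ub; rewrite /dN /= drop0 take_oversize ?size_tuple //.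
by rewrite (negbTE (_ : tval u != b)) ?mulr0.
Qed.

Definition cyl_cov k : R := annealed s (k + m) (fun u => X 0 u * X k u).

Lemma cyl_covE N i j : (i + m <= N)%N -> (j + m <= N)%N ->
  annealed s N (fun u => X i u * X j u) = cyl_cov ((i - j) + (j - i)).
Proof.
wlog ij : i j / (i <= j)%N => [wl|] iN jN.
  have [|/ltnW ji] := leqP i j; first by move=> ij; exact: wl.
  rewrite addnC -wl //; rewrite /annealed; apply: eq_Rintegral => w _.
  by apply: eq_bigr => u _; rewrite (mulrC (X i u)).
have -> : (i - j + (j - i) = j - i)%N by lia.
rewrite (_ : N = (i + ((j - i + m) + (N - j - m)))%N); last by lia.
rewrite (@annealed_stationary i _ _ (fun v => X 0 v * X (j - i) v)); last first.
  by move=> u v ui _; rewrite !cyl_catr ui // subnn.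
by apply: annealed_drop => // u v ul _; rewrite !cyl_catl ?ul //; lia.
Qed.

Lemma bmix_ge0 q : (1 < q)%N -> 0 <= bmix q.
Proof.
move=> q1; apply: le_trans (@annealed_mixing01 0 q 0 (fun=> 0) (fun=> 0) (fun=> 0) q1 _ _ _ _) => //.
- by move=> u; rewrite normr0.
- by move=> u; rewrite lexx ler01.
- by move=> u; rewrite lexx ler01.
- by move=> *; rewrite mulr0.
Qed.

(* A word of length [m] eats up [m] letters of the gap; [2] bounds the centred
   products trivially, and [8 = 4 * 1 * 2] comes from [annealed_mixing]. *)
Definition cyl_rate k : R := if (k < m.+2)%N then 2 else 8 * bmix (k - m).

Lemma cyl_rate_ge0 k : 0 <= cyl_rate k.
Proof. by rewrite /cyl_rate; case: ltnP => // mk; rewrite mulr_ge0 // bmix_ge0 //; lia. Qed.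

Lemma cyl_cov_le1 k : `|cyl_cov k| <= 1.
Proof.
rewrite /cyl_cov annealed_Ex // -[leRHS](Ex_cst (wlaw_sum1 (k + m) Hs)).
apply: le_norm_Ex => [u|u]; first exact: wlaw_ge0.
by rewrite normrM mulr_ile1 // cyl_le1.
Qed.

Lemma cyl_cov_le k : `|cyl_cov k| <= cyl_rate k.
Proof.
rewrite /cyl_rate; case: ltnP => mk; first by apply: le_trans (cyl_cov_le1 k) _; lra.
have km : (1 < k - m)%N by lia.
have HE u v x : size u = m -> size v = (k - m)%N -> size x = m ->
    X 0 (u ++ v ++ x) * X k (u ++ v ++ x) = X 0 u * X 0 x.
  move=> um vk _; rewrite cyl_catl ?um // (@cyl_catr k u) ?um; last by lia.
  by rewrite (@cyl_catr _ v) vk // subnn.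
have := @annealed_mixing m (k - m) m (fun u => X 0 u * X k u) (X 0) (X 0) 1 1 km
   (cyl_le1 0) (cyl_le1 0) HE.
rewrite cyl_mean0 // mul0r subr0 (_ : (m + (k - m + m))%N = (k + m)%N); last by lia.
by move/le_trans; apply; rewrite !mulr1 ler_wpM2r ?bmix_ge0 // ler_nat.
Qed.

(** [n] windows of length [m] at consecutive starting points occupy [n + m - 1] letters. *)
Let Y n j (u : (n + m).-1.-tuple A) := X j u.

(** Windows counted in the past may run up to [m] letters into the gap, so [q - m] separating
    letters remain; the product of means vanishes because [G] is centred. *)
Lemma cyl_mix n (phi : R -> R) (M K : R) (J : pred nat) k q (G : seq A -> R) :
  (forall x, `|phi x| <= M) -> (k + q <= n)%N -> (m.+1 < q)%N -> (forall u, `|G u| <= K) ->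
  annealed s (n - k - q) G = 0 ->
  forall H, (forall u v, size u = (k + q)%N -> H (u ++ v) = G v) ->
  `|annealed s n (fun u => phi (\sum_(i < k | J i) X i u) * H u)| <= 4 * M * K * bmix (q - m).
Proof.
move=> phiM kqn mq GK G0 H HE.
have qm : (1 < q - m)%N by lia.
pose F u := phi (\sum_(i < k | J i) X i u).
have FE u v x : size u = (k + m)%N -> size v = (q - m)%N -> size x = (n - k - q)%N ->
    F (u ++ v ++ x) * H (u ++ v ++ x) = F u * G x.
  move=> uk vq xl; rewrite {2}catA HE; last by rewrite size_cat uk vq; lia.
  congr (phi _ * _); apply: eq_bigr => i _; rewrite cyl_catl // uk.
  by have := ltn_ord i; lia.
have FM u : `|F u| <= M by exact: phiM.
have := @annealed_mixing (k + m) (q - m) (n - k - q) (fun u => F u * H u) F G M K qm FM GK FE.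
by rewrite G0 mulr0 subr0 (_ : (k + m + (q - m + (n - k - q)))%N = n) //; lia.
Qed.

Lemma cyl_rate_trivial n (f g : (n + m).-1.-tuple A -> R) (M : R) k :
  (k < m.+2)%N -> (forall u, `|f u| <= M) -> (forall u, `|g u| <= 2) ->
  `|Ex (@wlaw s (n + m).-1) (fun u => f u * g u)| <= M * cyl_rate k.
Proof.
move=> km fM g2; rewrite /cyl_rate km.
rewrite -(Ex_cst (wlaw_sum1 (n + m).-1 Hs) (M * 2)).
apply: le_norm_Ex => [u|u]; first exact: wlaw_ge0.
by rewrite normrM; apply: ler_pM.
Qed.

Lemma cyl_cov_window n i j : (i < n)%N -> (j < n)%N ->
  Ex (@wlaw s (n + m).-1) (fun u => Y i u * Y j u) = cyl_cov ((i - j) + (j - i)).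
Proof.
move=> iN jN; rewrite -(@annealed_Ex s (n + m).-1 (fun u => X i u * X j u)) //.
by rewrite cyl_covE //; lia.
Qed.

Lemma cyl_var_ge0 : cvgn (series cyl_rate) ->
  0 <= cyl_cov 0 + 2 * limn (series (fun k => cyl_cov k.+1)).
Proof.
apply: (@cov_series_ge0 R _ (fun n => @wlaw s (n + m).-1) Y cyl_rate cyl_cov).
- by move=> n t; exact: wlaw_ge0.
- exact: cyl_cov_window.
- exact: cyl_rate_ge0.
- exact: cyl_cov_le.
Qed.

Lemma cyl_bumps h y : 0 < h -> cvgn (series cyl_rate) ->
  (fun n => Ex (@wlaw s (n + m).-1) (fun u =>
     heatk h ((\sum_(j < n) X j u) / Num.sqrt n%:R - y)))
    @ \oo --> heatk (h + (cyl_cov 0 + 2 * limn (series (fun k => cyl_cov k.+1)))) y.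
Proof.
move=> h0 cvgr.
apply: (@triangular_bumps R _ (fun n => @wlaw s (n + m).-1) Y cyl_rate cyl_cov) => //.
- by move=> n t; exact: wlaw_ge0.
- by move=> n; exact: wlaw_sum1.
- by move=> n j t _; exact: cyl_le1.
- exact: cyl_cov_window.
- exact: cyl_rate_ge0.
- exact: cyl_cov_le.
- move=> n phi M J k q j phiM kqj jn.
  have [qm|mq] := ltnP q m.+2.
    apply: (@cyl_rate_trivial n (fun u => phi _) (fun u => Y j u)) => // u.
    by apply: le_trans (cyl_le1 j u) _; rewrite ler1n.
  rewrite -(@annealed_Ex s (n + m).-1 (fun u => phi (\sum_(i < k | J i) X i u) * X j u)) //.
  have M0 : 0 <= M by apply: le_trans (phiM 0).
  apply: le_trans (@cyl_mix (n + m).-1 phi M 1 J k q (X (j - k - q)) phiM _ mq (cyl_le1 _) _ (X j) _) _.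
  + by lia.
  + by apply: cyl_mean0; lia.
  + by move=> u v uE; rewrite cyl_catr uE // subnDA.
  + rewrite /cyl_rate ltnNge mq /= mulr1 (mulrC 4) -mulrA ler_wpM2l //.
    by rewrite ler_wpM2r ?ler_nat // bmix_ge0 //; lia.
- move=> n phi M J k q j j' phiM kqj kqj' jn jn'.
  set cc := cyl_cov _.
  have cc1 : `|cc| <= 1 by exact: cyl_cov_le1.
  have G2 i i' u : `|X i u * X i' u - cc| <= 2.
    apply: le_trans (ler_normB _ _) _; have : `|X i u * X i' u| <= 1.
      by rewrite normrM mulr_ile1 // cyl_le1.
    by lra.
  have [qm|mq] := ltnP q m.+2.
    by apply: (@cyl_rate_trivial n (fun u => phi _) (fun u => Y j u * Y j' u - cc)) => // u; exact: G2.
  rewrite -(@annealed_Ex s (n + m).-1 (fun u => phi (\sum_(i < k | J i) X i u) * (X j u * X j' u - cc))) //.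
  have M0 : 0 <= M by apply: le_trans (phiM 0).
  apply: le_trans (@cyl_mix (n + m).-1 phi M 2 J k q
    (fun u => X (j - k - q) u * X (j' - k - q) u - cc) phiM _ mq (G2 _ _) _ (fun u => X j u * X j' u - cc) _) _.
  + by lia.
  + rewrite annealed_Ex // ExB Ex_cst ?wlaw_sum1 //.
    rewrite -(@annealed_Ex s _ (fun u => X (j - k - q) u * X (j' - k - q) u)) // cyl_covE; try lia.
    by rewrite /cc; apply/eqP; rewrite subr_eq0; apply/eqP; congr cyl_cov; lia.
  + by move=> u v uE; rewrite !cyl_catr ?uE // !subnDA.
  + rewrite /cyl_rate ltnNge mq /= (mulrC 4) -!mulrA ler_wpM2l //.
    by rewrite mulrA -natrM ler_wpM2r // bmix_ge0 //; lia.
Qed.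

Lemma cyl_bumps_gen vth h y : random_state vth -> 0 < h -> cvgn (series cyl_rate) ->
  (fun n => Ex (@wlaw vth (n + m).-1) (fun u =>
     heatk h ((\sum_(j < n) X j u) / Num.sqrt n%:R - y)))
    @ \oo --> heatk (h + (cyl_cov 0 + 2 * limn (series (fun k => cyl_cov k.+1)))) y.
Proof.
move=> rv h0 cvgr; have := @cyl_bumps h y h0 cvgr.
set l := heatk _ _ => cvgs.
have [C C0 Cb] := heatk_bounds h0.
have hb x : `|heatk h x| <= C by have [] := Cb h x (lexx h).
have hl x x' : `|heatk h x - heatk h x'| <= C * `|x - x'|.
  by apply: (heatk_lip_x h0) => // H z hH; have [] := Cb H z hH.
apply/cvgrPdist_le => e e0.
have e4 : 0 < e / 4 by rewrite divr_gt0.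
have Cd : 0 < C * d%:R + 1 by rewrite ltr_wpDl // mulr_ge0 // ltW.
(* The number of initial letters to discard: [C * d * rho n0] bounds the influence of the initial
   state beyond them. *)
have [n0 n00 rn] := rho_small (divr_gt0 e4 Cd).
have rn' : C * d%:R * rho n0 <= e / 4.
  have [r0|r0] := leP 0 (rho n0); last first.
    by apply: le_trans (ltW e4); rewrite mulr_ge0_le0 ?mulr_ge0 ?(ltW C0) // ltW.
  rewrite ler_pdivlMr // in rn; apply: le_trans rn.
  by rewrite mulrC ler_wpM2l // lerDl.
have K0 : 0 < C * n0%:R by rewrite mulr_gt0 // ltr0n.
near=> n.
have n0n : (n0 < n)%N by near: n; exact: nbhs_infty_gt.
have [_ ns] : (0 < n)%N /\ (Num.sqrt n%:R)^-1 <= e / 4 / (C * n0%:R).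
  by near: n; apply: near_inv_sqrt; rewrite divr_gt0.
have ls : `|l - Ex (@wlaw s (n + m).-1) (fun u =>
     heatk h ((\sum_(j < n) X j u) / Num.sqrt n%:R - y))| <= e / 4.
  by near: n; move/cvgrPdist_le: cvgs; exact.
pose S u := (\sum_(j < n) X j u) / Num.sqrt n%:R - y.
(* Dropping [n0] windows moves the argument by at most [n0 / sqrt n], and the windows that remain do
   not read the first [n0] letters. *)
pose S' u := (\sum_(n0 <= j < n) X j u) / Num.sqrt n%:R - y.
have SS' u : `|heatk h (S u) - heatk h (S' u)| <= e / 4.
  apply: le_trans (hl _ _) _; rewrite /S /S' (_ : forall a b c : R, a - c - (b - c) = a - b);
    last by move=> ? ? ?; ring.
  rewrite -mulrBl.
  rewrite -(big_mkord xpredT (fun j => X j u)) (big_cat_nat _ (n := n0)) ?(ltnW n0n) //= addrK.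
  rewrite normrM (ger0_norm (_ : 0 <= (Num.sqrt n%:R)^-1)) ?invr_ge0 ?sqrtr_ge0 //.
  have Xn : `|\sum_(0 <= j < n0) X j u| <= n0%:R.
    rewrite big_mkord; apply: le_trans (ler_norm_sum _ _ _) _.
    rewrite -[n0 in leRHS]card_ord -sumr_const.
    by apply: ler_sum => j _; exact: cyl_le1.
  apply: le_trans (ler_wpM2l (ltW C0) (ler_wpM2r _ Xn)) _; first by rewrite invr_ge0 sqrtr_ge0.
  by move: ns; rewrite ler_pdivlMr // mulrA mulrC.
have forget : `|annealed vth (n + m).-1 (fun u => heatk h (S' u)) -
    annealed s (n + m).-1 (fun u => heatk h (S' u))| <= C * d%:R * rho n0.
  have -> : (n + m).-1 = (n0 + ((n + m).-1 - n0))%N by clear -n0n; lia.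
  apply: (@annealed_forget vth n0 _ _ (fun v =>
    heatk h ((\sum_(n0 <= j < n) X (j - n0) v) / Num.sqrt n%:R - y)) C) => //.
  move=> u v un _; rewrite /S'.
  have -> : \sum_(n0 <= j < n) X j (u ++ v) = \sum_(n0 <= j < n) X (j - n0) v.
    by apply: eq_big_nat => j /andP[nj _]; rewrite cyl_catr un.
  by [].
have close w : random_state w -> `|Ex (@wlaw w (n + m).-1) (fun u => heatk h (S u)) -
    Ex (@wlaw w (n + m).-1) (fun u => heatk h (S' u))| <= e / 4.
  move=> rw; rewrite -ExB -[leRHS](Ex_cst (wlaw_sum1 (n + m).-1 rw)).
  by apply: le_norm_Ex => u; [exact: wlaw_ge0 | exact: SS'].
have := close vth rv; have := close s Hs.
move: forget; rewrite !annealed_Ex //.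
move: ls rn'; rewrite -/(S _).
rewrite !ler_norml => /andP[? ?] ? /andP[? ?] /andP[? ?] /andP[? ?].
by apply/andP; split; lra.
Unshelve. all: by end_near. Qed.

Theorem cyl_clt vth g : random_state vth -> bounded_continuous g -> cvgn (series cyl_rate) ->
  (fun n => annealed vth (n + m).-1
     (fun u => g ((\sum_(1 <= k < n.+1) (dN b k u - mu)) / Num.sqrt n%:R)))
    @ \oo --> gaussE (cyl_cov 0 + 2 * limn (series (fun k => cyl_cov k.+1))) g.
Proof.
move=> rv gb cvgr.
have := @lawE_cvg R _ (fun n => @wlaw vth (n + m).-1)
  (fun n u => (\sum_(j < n) X j u) / Num.sqrt n%:R) _ _ _ (cyl_var_ge0 cvgr) _ g gb.
set F := (fun n => lawE _ _ n g); set G := (fun n => annealed _ _ _).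
have -> : G = F.
  apply/funext => n; rewrite /G /F annealed_Ex //; apply: eq_Ex => u.
  by rewrite big_add1 /= big_mkord.
apply.
- by move=> n t; exact: wlaw_ge0.
- by move=> n; exact: wlaw_sum1.
- by move=> h y h0; exact: cyl_bumps_gen.
Qed.

(** After [m + 2] constant terms, the rate at [m + 2 + i] is [8 * bmix (i + 2)]: a shifted rate and
    two rates at about half the index, where halving at most doubles a sum. *)
Lemma cvg_cyl_rate (Br Ba : R) : (forall n, 0 <= rho n) ->
  (forall N, \sum_(i < N) rho i.+1 <= Br) ->
  (forall N, \sum_(i < N) alpha_mix V theta thinv P i.+1 <= Ba) ->
  cvgn (series cyl_rate).
Proof.
move=> rho0 rB aB.
pose r i := rho i.+1; pose al i := alpha_mix V theta thinv P i.+1.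
have al0 i : 0 <= al i by exact: alpha_mix_ge0.
have rS N : \sum_(i < N) rho i.+2 <= Br.
  apply: le_trans (rB N.+1); rewrite big_ord_recl /=.
  by rewrite lerDr.
have rH N : \sum_(i < N) r i./2 <= 2 * Br.
  by apply: le_trans (sum_half_le N (fun i => rho0 i.+1)) _; rewrite ler_wpM2l.
have aH N : \sum_(i < N) al (uphalf i).+1 <= 2 * Ba.
  (* [(i + 3)./2] is [(uphalf i).+1], so three leading terms are split off. *)
  have := sum_half_le N.+3 al0; rewrite 3!big_ord_recl /= !addrA => h.
  apply: le_trans (le_trans _ h) _; first by rewrite lerDr !addr_ge0.
  by rewrite ler_wpM2l //; exact: aB.
apply: (@bounded_series_cvg _ _ (2 * m.+2%:R + 8 * (d%:R * Br + 2 * (d%:R * (2 * Br)) + 2 * Ba))).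
  exact: cyl_rate_ge0.
move=> N; apply: (@le_trans _ _ (\sum_(0 <= i < m.+2 + N) cyl_rate i)).
  rewrite (big_cat_nat _ (n := N)) ?leq_addl //= big_mkord lerDl.
  by apply: sumr_ge0 => i _; exact: cyl_rate_ge0.
rewrite (big_cat_nat _ (n := m.+2)) ?leq_addr //=; apply: lerD.
  rewrite big_mkord (eq_bigr (fun=> 2)) => [|i _]; last by rewrite /cyl_rate ltn_ord.
  by rewrite sumr_const card_ord mulr_natr.
rewrite -{1}(add0n m.+2) big_addn addKn big_mkord.
rewrite (eq_bigr (fun i : 'I_N => 8 * (d%:R * rho i.+2 + 2 * (d%:R * r i./2) + al (uphalf i).+1))).
  rewrite -mulr_sumr ler_wpM2l // !big_split /= -!mulr_sumr.
  apply: lerD; last exact: aH.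
  by apply: lerD; rewrite ?ler_wpM2l //; [exact: rS | exact: rH].
move=> i _; rewrite /cyl_rate ltnNge leq_addl /= addnS addnS subSn ?subSn ?addnK; try lia.
rewrite /bmix /r /al /= ; congr (8 * (_ + alpha_mix V theta thinv P _)).
by rewrite uphalf_half; have := odd_double_half i; rewrite -addnn; lia.
Qed.
End Cylinder.
End Process.

(** An empty matrix has trace 0, so a state forces positive dimension, which makes the constant
    [4 * d ^+ 3] invertible. *)
Lemma random_state_dim (R : realType) (d0 : measure_display) (Omega : measurableType d0)
  (P : probability Omega R) (d : nat) (s : Omega -> 'M[R[i]]_d) : random_state s -> (0 < d)%N.
Proof.
case=> _ /(_ point) [_]; case: d s => // s; rewrite /mxtrace big_ord0 => /eqP.
by rewrite eq_sym oner_eq0.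
Qed.

(** The conclusion includes convergence of the covariance series and the sign of [Sigma2]: [limn]
    has a default value on divergent series and [Num.sqrt] is 0 on negative numbers, so these two
    facts make [gaussE Sigma2] the announced normal law. *)
Theorem theorem4
  (R : realType) (d0 : measure_display) (Omega : measurableType d0)
  (P : probability Omega R) (A : finType) (d : nat)
  (V : A -> Omega -> 'M[R[i]]_d) (theta thinv : Omega -> Omega)
  (* perfect random instrument *)
  (HTmeas : Top_measurable V)
  (Hkraus : {ae P, forall w, \sum_(a : A) adjmx (V a w) *m V a w = 1%:M})
  (* (H1) *)
  (Hth_meas : measurable_fun setT theta) (Hthinv_meas : measurable_fun setT thinv)
  (Hth_inv1 : cancel theta thinv) (Hth_inv2 : cancel thinv theta)
  (Hth_erg : ergodic P theta) (Hth_pres : preserving P theta)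
  (* (H2) *)
  (delta : R) (Hdelta : 0 < delta)
  (H2 : (\sum_(1 <= n <oo) ((alpha_mix V theta thinv P n) `^ (delta / (2 + delta)))%:E
           < +oo)%E)
  (* (H3) *)
  (s : Omega -> 'M[R[i]]_d) (Hs : random_state s) (Hstat : dyn_stationary V theta P s)
  (r : nat -> R) (Hr0 : forall n, 0 <= r n)
  (Hr : (\sum_(1 <= n <oo) ((r n) `^ (delta / (2 + delta)))%:E < +oo)%E)
  (H3 : forall vth : Omega -> 'M[R[i]]_d, random_state vth -> forall n : nat, (0 < n)%N ->
     (\int[P]_w (trnorm (Phin V theta n w (vth w) - s (iter n theta w)))%:E
        <= (r n)%:E)%E)
  (* (A.1) *)
  (e : 'I_d -> 'cV[R[i]]_d) (He : forall i j, (adjmx (e i) *m e j) 0 0 = (i == j)%:R)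
  (f : A -> 'I_d -> 'I_d)
  (HA1 : forall a : A, {ae P, forall w, forall i : 'I_d,
     (exists c : R[i], V a w *m e i = c *: e (f a i)) /\
     (forall j : 'I_d, i != j -> (adjmx (V a w *m e i) *m (V a w *m e j)) 0 0 = 0)})
  (* (A.2) *)
  (L : nat) (HL : (0 < L)%N) (eps : R) (Heps : 0 < eps)
  (kappa : Omega -> 'I_d -> 'I_d -> {ffun L.-tuple A * L.-tuple A -> R})
  (Hkappa_meas : forall i j uv, measurable_fun setT (fun w => kappa w i j uv))
  (Hkappa_prob : forall w i j, (forall uv, 0 <= kappa w i j uv) /\
     \sum_(uv : L.-tuple A * L.-tuple A) kappa w i j uv = 1)
  (HA2 : {ae P, forall w, forall i j : 'I_d,
     (forall u : L.-tuple A, \sum_(v : L.-tuple A) kappa w i j (u, v)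
        = qprob V theta (e i *m adjmx (e i)) w u) /\
     (forall v : L.-tuple A, \sum_(u : L.-tuple A) kappa w i j (u, v)
        = qprob V theta (e j *m adjmx (e j)) w v) /\
     eps <= \sum_(uv : L.-tuple A * L.-tuple A | fword f uv.1 i == fword f uv.2 j)
              kappa w i j uv}) :
  forall (m : nat) (b : m.-tuple A) (vth : Omega -> 'M[R[i]]_d), random_state vth ->
  let mu := fine (\int[P]_w (qprob V theta (s w) w b)%:E) in
  let cov := fun k : nat =>
    aexp V theta P s (k + m) (fun u => (dN b 1 u - mu) * (dN b k.+1 u - mu)) in
  let Sigma2 := cov 0%N + 2 * limn (series (fun k => cov k.+1)) in
  cvgn (series (fun k => cov k.+1)) /\ 0 <= Sigma2 /\
  forall g : R -> R, bounded_continuous g ->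
    (fun n : nat => aexp V theta P vth (n + m).-1
       (fun u => g ((\sum_(1 <= k < n.+1) (dN b k u - mu)) / Num.sqrt n%:R)))
      @ \oo --> gaussE Sigma2 g.

Proof.
move=> m b vth rv mu cov Sigma2.
have d0' := random_state_dim P Hs.
pose c : R := 4 * d%:R ^+ 3.
have c0 : 0 < c by rewrite mulr_gt0 // exprn_gt0 // ltr0n.
have kp : 0 < delta / (2 + delta) <= 1.
  have dp : 0 < 2 + delta by lra.
  by rewrite divr_gt0 //= ler_pdivrMr // mul1r; lra.
have Hrho w : random_state w -> forall n, (0 < n)%N ->
    (\int[P]_x (entry_norm (Phin V theta n x (w x) - s (iter n theta x)))%:E <= (c * r n)%:E)%E.
  move=> rw n n0.
  have mg := measurable_gap HTmeas Hth_meas Hs n rw.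
  set gap := (fun x => entry_norm _) in mg *.
  (* The factor is taken out on the side of [gap], which is measurable; what remains, [gap / c]
     against [trnorm], is monotonicity without measurability. *)
  have -> : (\int[P]_x (gap x)%:E = c%:E * \int[P]_x (gap x / c)%:E)%E.
    rewrite -ge0_integralZl //.
    - by apply: eq_integral => x _; rewrite -EFinM mulrCA divff ?gt_eqF // mulr1.
    - by apply/measurable_EFinP; apply: measurable_funM.
    - by move=> x _; rewrite lee_fin divr_ge0 ?(ltW c0) // entry_norm_ge0.
    - by rewrite lee_fin ltW.
  rewrite (EFinM c); apply: lee_wpmul2l; first by rewrite lee_fin ltW.
  apply: le_trans (H3 w rw n n0); apply: le_integral_nonmeas => x.
    by rewrite lee_fin divr_ge0 ?(ltW c0) // entry_norm_ge0.
  by rewrite lee_fin ler_pdivrMr // mulrC entry_norm_trnorm.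
have [Br Br0 rB] := powR_summable kp Hr0 Hr.
have al0 n : 0 <= alpha_mix V theta thinv P n.
  exact: alpha_mix_ge0.
have [Ba Ba0 aB] := powR_summable kp al0 H2.
have rho0 n : 0 <= c * r n by rewrite mulr_ge0 // ltW.
have rhoB N : \sum_(i < N) c * r i.+1 <= c * Br by rewrite -mulr_sumr ler_pM2l.
have small := @summable_small R (fun n => c * r n) _ rhoB.
have cvgr : cvgn (series (cyl_rate P V theta thinv (fun n => c * r n) m)).
  exact: (cvg_cyl_rate HTmeas Hkraus Hth_meas Hthinv_meas Hth_inv1 Hth_inv2 Hth_pres
    Hs Hstat Hrho small rho0 rhoB aB).
split.
  apply: cvg_cov_series cvgr.
    exact: (cyl_rate_ge0 HTmeas Hkraus Hth_meas Hthinv_meas Hth_inv1 Hth_inv2 Hth_pres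
      Hs Hstat Hrho small).
  exact: (cyl_cov_le HTmeas Hkraus Hth_meas Hthinv_meas Hth_inv1 Hth_inv2 Hth_pres
    Hs Hstat Hrho small).
split.
  exact: (cyl_var_ge0 HTmeas Hkraus Hth_meas Hthinv_meas Hth_inv1 Hth_inv2 Hth_pres
    Hs Hstat Hrho small b cvgr).
move=> g gb.
exact: (cyl_clt (b := b) HTmeas Hkraus Hth_meas Hthinv_meas Hth_inv1 Hth_inv2 Hth_pres
  Hs Hstat Hrho small rv gb cvgr).
Qed.
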